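(* Consider two topological partition functions $Z_1,Z_2$ and $d\in\mathbb Z_{>0}$. The following four properties are equivalent: (i) $Z_1(\lambda)=\mathfrak z_\lambda\sum_{\nu\vdash d}H^{<}(\lambda,\nu)\,Z_2(\nu)$ holds for any $\lambda\vdash d$; (ii) $\Phi_{Z_1,\hbar}=\zeta_\hbar\circledast\Phi_{Z_2,\hbar}$ holds between functions on $PS(d)$; (iii) $Z_2(\nu)=\mathfrak z_\nu\sum_{\lambda\vdash d}H^{\le}(\nu,\lambda)\,Z_1(\lambda)$ holds for any $\nu\vdash d$; (iv) $\Phi_{Z_2,\hbar}=\mu_\hbar\circledast\Phi_{Z_1,\hbar}$ holds between functions on $PS(d)$. Besides, the property $Z_1=\mathsf D Z_2$ is equivalent to any of these conditions simultaneously for all $d>0$.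
   Context: $R$ is a commutative ring containing $\mathbb Q$. **Partitions and permutations.** For $\lambda\vdash d$, $\ell(\lambda)$ is its length, $m_j(\lambda)$ the number of parts equal to $j$, $\mathfrak z_\lambda=\prod_i\lambda_i\prod_jm_j(\lambda)!$, $C_\lambda\subset S(d)$ the conjugacy class of cycle type $\lambda$, $p_\lambda=\prod_ip_{\lambda_i}$. $P(d)$ is the lattice of set partitions of $[d]=\{1,\dots,d\}$ ($\vee$ = join, $\mathbf 1_d=\{[d]\}$), and $\mathbf 0_\alpha\in P(d)$ is the partition into supports of cycles of $\alpha\in S(d)$. **Partitioned permutations.** $PS(d)=\{(\mathcal A,\alpha)\in P(d)\times S(d):\mathbf 0_\alpha\le\mathcal A\}$, $PS=\bigcup_{d\geq 1}PS(d)$, $|\alpha|=d-\#\mathbf 0_\alpha$. For functions on $PS(d)$, $$(f_1\circledast f_2)(\mathcal C,\gamma)=\sum_{\substack{(\mathcal A,\alpha),(\mathcal B,\beta)\in PS(d)\\ \mathcal A\vee\mathcal B=\mathcal C,\ \alpha\circ\beta=\gamma}}f_1(\mathcal A,\alpha)f_2(\mathcal B,\beta).$$ Its unit is $\delta$ ($1$ at $(\mathbf 0_{\mathrm{id}},\mathrm{id})$, $0$ elsewhere). $\zeta_\hbar(\mathcal A,\alpha)=\hbar^{|\alpha|}$ if $\mathcal A=\mathbf 0_\alpha$ and $0$ otherwise; $\mu_\hbar:PS(d)\to R[[\hbar]]$ is its two-sided $\circledast$-inverse (it exists). A function $f$ on $PS$ is multiplicative if $f(\mathbf 1_d,\sigma)$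 depends only on the conjugacy class of $\sigma$ and $f(\mathcal A,\alpha)=\prod_{A\in\mathcal A}f(\mathbf 1_{\#A},\alpha_{|A})$, where $\alpha_{|A}$ is the restriction of $\alpha$ to $A$ transported to $[\#A]$ by any bijection. **Monotone Hurwitz numbers.** For $\lambda,\nu\vdash d$, $H^<_r(\lambda,\nu)$ (resp. $H^\le_r(\lambda,\nu)$) is $\frac1{d!}$ times the number of tuples $(\alpha,\tau_1,\ldots,\tau_r,\beta)$ in $S(d)$ with $\alpha\in C_\lambda$, $\beta\in C_\nu$, $\tau_i=(a_i\,b_i)$ transpositions with $a_i<b_i$ and $(b_i)_i$ strictly (resp. weakly) increasing, and $\alpha\circ\tau_1\circ\cdots\circ\tau_r\circ\beta=\mathrm{id}$. Then $H^<(\lambda,\nu)=\sum_{r=0}^{d-1}\hbar^rH^<_r(\lambda,\nu)$ and $H^\le(\lambda,\nu)=\sum_{r\ge0}(-\hbar)^rH^\le_r(\lambda,\nu)$. **Topological partition functions.** A topological partition function is a formal power series in $p_1,p_2,\ldots$ over $R((\hbar))$ of the form $Z=e^F$ with $$F=\sum_{g\ge0,\,n\ge1}\frac{\hbar^{2g-2+n}}{n!}\sum_{k_1,\ldots,k_n\ge1}F_{g;k_1,\ldots,k_n}\prod_{i=1}^n\frac{p_{k_i}}{k_i},$$ where $F_{g;k_1,\ldots,k_n}\in R$ is symmetric in $k_1,\dots,k_n$. Its coefficients $Z(\lambda)$ are defined by $Z=1+\sum_{d\ge1}\sum_{\lambda\vdash d}\hbar^{-d}Z(\lambda)\,p_\lambda/\mathfrak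 z_\lambda$. Its associated function $\Phi_{Z,\hbar}:PS\to R[[\hbar]]$ is the unique multiplicative function with $F=\sum_{d\ge1}\sum_{\lambda\vdash d}\hbar^{-d}\,\Phi_{Z,\hbar}(\mathbf 1_d,\pi_\lambda)\,p_\lambda/\mathfrak z_\lambda$ ($\pi_\lambda$ any permutation of cycle type $\lambda$); that is, $\Phi_{Z,\hbar}(\mathbf 1_d,\pi_\lambda)=\sum_{g\ge0}\hbar^{2g-2+\ell(\lambda)+d}F_{g;\lambda_1,\ldots,\lambda_{\ell(\lambda)}}$. **The operator $\mathsf D$.** Let $s_\lambda$ be the Schur functions written as polynomials in the power sums $p_k$. $\mathsf D$ is the $R((\hbar))$-linear operator on formal power series in $p_1,p_2,\ldots$ (acting degree by degree, $\deg p_k=k$) with $\mathsf D s_\lambda=\prod_{(i,j):\,1\le i\le\ell(\lambda),\,1\le j\le\lambda_i}(1+\hbar(j-i))\,s_\lambda$.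
   Formalization: For a single d, (i) does not imply (ii) (it fails at d=2); the four-way equivalence is proved for the properties required in all degrees 1,…,d. At each single d, (i)⇔(iii), (ii)⇔(iv) and (ii)⇒(i) are proved. The statement for all d, with D, is unchanged. *)

(* Defs.v *)
From HB Require Import structures.
From mathcomp Require Import boolp classical_sets functions fsbigop.
From mathcomp Require Import all_boot all_order all_algebra all_fingroup.
From mathcomp Require Import mpoly.

Set Implicit Arguments.
Unset Strict Implicit.
Unset Printing Implicit Defensive.

Import Order.TTheory GRing.Theory Num.Theory.
Local Open Scope ring_scope.

(* R[[hbar]]: f stands for \sum_k (f k) hbar^k. *)

Definition fps (R : Type) := nat -> R.

HB.instance Definition _ (R : comNzRingType) :=
  GRing.Zmodule.copy (fps R) (nat -> R).

Section FormalPowerSeries.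
Variable R : comNzRingType.
Implicit Types f g h : fps R.

Definition fps_one : fps R := fun n => (n == 0%N)%:R.
Definition fps_mul f g : fps R := fun n => \sum_(i < n.+1) f i * g (n - i)%N.

Let trunc n f : {poly R} := \poly_(i < n) f i.

Let fps_mul_trunc n f g k :
  (k < n)%N -> fps_mul f g k = (trunc n f * trunc n g)`_k.
Proof.
move=> lkn; rewrite coefM; apply: eq_bigr => i _.
rewrite !coef_poly (leq_ltn_trans (leq_subr _ _) lkn).
by rewrite (leq_ltn_trans _ lkn) // -ltnS ltn_ord.
Qed.

Let trunc_mul n f g k : (k < n)%N ->
  (trunc n (fps_mul f g))`_k = (trunc n f * trunc n g)`_k.
Proof. by move=> lkn; rewrite coef_poly lkn (fps_mul_trunc _ _ lkn). Qed.

Fact fps_mulC : commutative fps_mul.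
Proof.
by move=> f g; apply/funext => n; rewrite !(@fps_mul_trunc n.+1) // mulrC.
Qed.

Fact fps_mulA : associative fps_mul.
Proof.
move=> f g h; apply/funext => n; rewrite !(@fps_mul_trunc n.+1) //.
have sub (i : 'I_n.+1) : (n - i < n.+1)%N by rewrite ltnS leq_subr.
transitivity ((trunc n.+1 f * (trunc n.+1 g * trunc n.+1 h))`_n).
  by rewrite !coefM; apply: eq_bigr => i _; rewrite trunc_mul.
rewrite mulrA !coefM; apply: eq_bigr => i _; congr (_ * _).
by rewrite trunc_mul.
Qed.

Fact fps_mul1 : left_id fps_one fps_mul.
Proof.
move=> f; apply/funext => n; rewrite /fps_mul big_ord_recl subn0 mul1r.
by rewrite big1 ?addr0 // => i _; rewrite mul0r.
Qed.

Fact fps_mulDl : left_distributive fps_mul +%R.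
Proof.
move=> f g h; apply/funext => n; rewrite /fps_mul.
rewrite [RHS](_ : _ = fps_mul f h n + fps_mul g h n) //.
by rewrite -big_split; apply: eq_bigr => i _; exact: mulrDl.
Qed.

Fact fps_one_neq0 : fps_one != 0.
Proof.
by apply/eqP => /(congr1 (fun f : fps R => f 0%N)) /eqP; rewrite oner_eq0.
Qed.

End FormalPowerSeries.

HB.instance Definition _ (R : comNzRingType) :=
  GRing.Zmodule_isComNzRing.Build (fps R) (@fps_mulA R) (@fps_mulC R)
    (@fps_mul1 R) (@fps_mulDl R) (@fps_one_neq0 R).

(* a hbar^n *)
Definition fps_mono (R : comNzRingType) (a : R) (n : nat) : fps R :=
  fun k => if k == n then a else 0.

(* R((hbar)): families of coefficients indexed by int, vanishing below some
   index. *)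

Definition bounded_below (R : comNzRingType) (f : int -> R) : bool :=
  `[< exists N : int, forall n : int, n < N -> f n = 0 >].

Record laurent (R : comNzRingType) := Laurent {
  lcoef :> int -> R;
  lcoefP : bounded_below lcoef
}.

HB.instance Definition _ (R : comNzRingType) := [isSub for @lcoef R].
HB.instance Definition _ (R : comNzRingType) := [Choice of laurent R by <:].

Section LaurentZmodule.
Variable R : comNzRingType.

Fact bounded_below_zmod : zmod_closed (@bounded_below R).
Proof.
split; first by apply/asboolP; exists 0.
move=> f g /asboolP[M fM] /asboolP[N gN]; apply/asboolP.
exists (Order.min M N) => n; rewrite lt_min => /andP[nM nN].
by rewrite [LHS](_ : _ = f n - g n) // fM // gN // subr0.
Qed.

HB.instance Definition _ :=
  GRing.isZmodClosed.Build (int -> R) (@bounded_below R) bounded_below_zmod.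
HB.instance Definition _ := [SubChoice_isSubZmodule of laurent R by <:].

End LaurentZmodule.

Section LaurentRing.
Variable R : comNzRingType.
Implicit Types f g h : laurent R.

(* The support of the sum is finite, so the finitely supported sum [\sum_(i \in _)]
   is the true one. *)
Definition laurent_conv (f g : int -> R) (n : int) : R :=
  \sum_(i \in [set: int]%classic) f i * g (n - i).

Let vb (f : int -> R) (a : int) := forall n, n < a -> f n = 0.
Let sh (f : int -> R) (a : int) : fps R := fun k => f (a + k%:Z).

Let conv_sh f g a b : vb f a -> vb g b -> forall k : nat,
  laurent_conv f g (a + b + k%:Z) = (sh f a * sh g b) k.
Proof.
move=> fa gb k; rewrite /laurent_conv.
rewrite (fsbigE [seq a + i%:Z | i <- iota 0 k.+1]).
- rewrite big_map -[k.+1 in LHS]subn0 -/(index_iota 0 k.+1).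
  rewrite (eq_bigl xpredT); last by move=> i; apply: mem_set.
  rewrite big_mkord; apply: eq_bigr => i _; rewrite /sh; congr (f _ * g _).
  have lik : (i <= k)%N by rewrite -ltnS ltn_ord.
  by rewrite -subzn // opprD addrACA [a + b]addrC addrK addrA.
- rewrite map_inj_uniq ?iota_uniq // => i j /addrI.
  by case.
- by [].
move=> i _ ni; have [lt_ia|le_ai] := ltP i a; first by rewrite fa ?mul0r.
suff lt_nib : a + b + k%:Z - i < b by rewrite (gb _ lt_nib) mulr0.
rewrite ltrBlDr -[X in X < _]addrA addrCA ltrD2l.
rewrite ltNge; apply: contra ni => le_iak.
have [m im] : exists m : nat, i = a + m%:Z.
  by exists `|i - a|%N; rewrite gez0_abs ?subr_ge0 // addrCA subrr addr0.
apply/mapP; exists m; rewrite // mem_iota add0n ltnS.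
by move: le_iak; rewrite im lerD2l lez_nat.
Qed.

Let conv_vb f g a b : vb f a -> vb g b -> vb (laurent_conv f g) (a + b).
Proof.
move=> fa gb n lt_n; rewrite /laurent_conv fsbig1 // => i _.
have [lt_ia|le_ai] := ltP i a; first by rewrite fa ?mul0r.
rewrite (gb (n - i)) ?mulr0 // ltrBlDr (lt_le_trans lt_n) //.
by rewrite addrC lerD2l.
Qed.

Let vb_ex f : exists a, vb f a.
Proof. by case: f => f /= /asboolP[a fa]; exists a. Qed.

Fact laurent_mul_subproof f g : bounded_below (laurent_conv f g).
Proof.
have [a fa] := vb_ex f; have [b gb] := vb_ex g.
by apply/asboolP; exists (a + b); apply: conv_vb.
Qed.

Definition laurent_mul f g : laurent R := Laurent (laurent_mul_subproof f g).

Fact laurent_mono_subproof (a : R) (n : int) :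
  bounded_below (fun k => if k == n then a else 0).
Proof. by apply/asboolP; exists n => k; case: eqP => // ->; rewrite ltxx. Qed.

(* a hbar^n *)
Definition laurent_mono (a : R) (n : int) : laurent R :=
  Laurent (laurent_mono_subproof a n).

Let laurentP f g : (forall n, f n = g n) -> f = g.
Proof. by move=> fg; apply/val_inj/funext. Qed.

Let eq_sh (f g : int -> R) a :
  vb f a -> vb g a -> sh f a = sh g a -> forall n, f n = g n.
Proof.
move=> fa ga E n; have [lt_na|le_an] := ltP n a; first by rewrite fa ?ga.
have -> : n = a + `|n - a|%N%:Z.
  by rewrite gez0_abs ?subr_ge0 // addrCA subrr addr0.
exact: (congr1 (fun s : fps R => s _) E).
Qed.

Let sh_conv f g a b : vb f a -> vb g b ->
  sh (laurent_conv f g) (a + b) = sh f a * sh g b.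
Proof. by move=> fa gb; apply/funext => k; apply: conv_sh. Qed.

Fact laurent_mulC : commutative laurent_mul.
Proof.
move=> f g; have [a fa] := vb_ex f; have [b gb] := vb_ex g.
apply/laurentP/(@eq_sh _ _ (a + b)); rewrite /=.
- exact: conv_vb.
- by rewrite addrC; apply: conv_vb.
- by rewrite sh_conv // addrC sh_conv // mulrC.
Qed.

Fact laurent_mulA : associative laurent_mul.
Proof.
move=> f g h; have [a fa] := vb_ex f; have [b gb] := vb_ex g.
have [c hc] := vb_ex h.
have fg := conv_vb fa gb; have gh := conv_vb gb hc.
apply/laurentP/(@eq_sh _ _ (a + b + c)).
- by rewrite -addrA; apply: (@conv_vb f (laurent_mul g h)).
- exact: (@conv_vb (laurent_mul f g) h).
rewrite (@sh_conv (laurent_mul f g) h) //= sh_conv //.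
by rewrite -addrA (@sh_conv f (laurent_mul g h)) //= sh_conv // mulrA.
Qed.

Fact laurent_mul1 : left_id (laurent_mono 1 0) laurent_mul.
Proof.
move=> f; have [a fa] := vb_ex f.
have v1 : vb (laurent_mono 1 0) 0 by move=> n /=; case: eqP => // ->; rewrite ltxx.
apply/laurentP/(@eq_sh _ _ a) => //.
  by rewrite -[a]add0r; apply: conv_vb.
rewrite -{1}[a]add0r sh_conv // -[RHS]mul1r; congr (_ * _).
by apply/funext => -[|k].
Qed.

Fact laurent_mulDl : left_distributive laurent_mul +%R.
Proof.
move=> f g h; have [a0 fa0] := vb_ex f; have [b0 gb0] := vb_ex g.
have [c hc] := vb_ex h; pose a := Order.min a0 b0.
have fa : vb f a by move=> n; rewrite lt_min => /andP[/fa0].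
have ga : vb g a by move=> n; rewrite lt_min => /andP[_ /gb0].
have fga : vb (f + g) a.
  by move=> n na; rewrite [LHS](_ : _ = f n + g n) // fa // ga // addr0.
apply/laurentP/(@eq_sh _ _ (a + c)).
- exact: conv_vb.
- move=> n nac.
  rewrite [LHS](_ : _ = laurent_conv f h n + laurent_conv g h n) //.
  by rewrite !(@conv_vb _ _ a c) // addr0.
rewrite sh_conv // [RHS](_ : _ = sh (laurent_conv f h) (a + c)
                               + sh (laurent_conv g h) (a + c)) //.
by rewrite !sh_conv // -mulrDl.
Qed.

Fact laurent_one_neq0 : laurent_mono 1 0 != 0.
Proof.
apply/eqP => /(congr1 (fun f : laurent R => f 0)).
by move=> /eqP; rewrite /= oner_eq0.
Qed.

HB.instance Definition _ :=
  GRing.Zmodule_isComNzRing.Build (laurent R) laurent_mulA laurent_mulC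
    laurent_mul1 laurent_mulDl laurent_one_neq0.

Fact laurent_of_fps_subproof (f : fps R) :
  bounded_below (fun n : int => if n is Posz k then f k else 0).
Proof. by apply/asboolP; exists 0 => -[]. Qed.

Definition laurent_of_fps (f : fps R) : laurent R :=
  Laurent (laurent_of_fps_subproof f).

End LaurentRing.

Definition is_intpart (s : seq nat) : bool := sorted geq s && (0%N \notin s).

Record intpart := IntPart { parts :> seq nat; partsP : is_intpart parts }.

HB.instance Definition _ := [isSub for parts].
HB.instance Definition _ := [Countable of intpart by <:].

Record part_of (d : nat) := PartOf {
  part_val :> intpart;
  part_ofP : sumn part_val == d
}.

HB.instance Definition _ d := [isSub for @part_val d].
HB.instance Definition _ d := [Countable of part_of d by <:].

Section PartOfFinite.
Variable d : nat.

Let code (la : part_of d) : d.-bseq 'I_d.+1 :=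
  insub_bseq d [seq inord k | k <- la].
Let decode (s : d.-bseq 'I_d.+1) : option (part_of d) :=
  obind (fun la : intpart => insub la) (insub [seq val k | k <- s]).

Let codeK : pcancel code decode.
Proof.
case=> -[s s_part] /= s_sum; rewrite /decode /code /=.
have s_le : all (fun k => k <= d)%N s.
  rewrite -(eqP s_sum); elim: s {s_part s_sum} => //= k s IHs.
  rewrite leq_addr /=; apply: sub_all IHs => j le_j.
  exact: leq_trans le_j (leq_addl _ _).
have s_size : (size s <= d)%N.
  case/andP: s_part => _ s_pos; rewrite -(eqP s_sum) /=.
  elim: s s_pos {s_sum s_le} => //= k s IHs; rewrite inE negb_or eq_sym -lt0n.
  by case/andP=> k_gt0 /IHs; rewrite -add1n => /(leq_add k_gt0).
have bseqE : insub_bseq d [seq inord k | k <- s]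
             = [seq inord k | k <- s] :> seq 'I_d.+1.
  by rewrite /insub_bseq val_insubd size_map s_size.
have -> : [seq val k | k <- insub_bseq d [seq (inord k : 'I_d.+1) | k <- s]]
          = s.
  rewrite bseqE -map_comp -[RHS]map_id; apply/eq_in_map => k ks /=.
  by rewrite inordK // ltnS (allP s_le).
rewrite (insubT is_intpart s_part) /= insubT /=.
by congr Some; apply/val_inj/val_inj.
Qed.

HB.instance Definition _ := isFinite.Build (part_of d) (pcan_enumP codeK).

End PartOfFinite.

(* z_la *)
Definition zee (la : seq nat) : nat :=
  (\prod_(k <- la) k * \prod_(j <- undup la) (count_mem j la)`!)%N.

(* Formal power series in p_1, p_2, ... over K: [f la] is the coefficient of
   p_la. *)

Definition pseries (K : Type) := intpart -> K.

Section PSeries.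
Variable K : comNzRingType.
Implicit Types f g : pseries K.

Definition pone : pseries K := fun la => (nilp la)%:R.

(* p_mu * p_nu = p_la exactly when la is the union of the multisets mu and nu *)
Definition pmul f g : pseries K := fun la =>
  \sum_(a < (sumn la).+1)
    \sum_(mu : part_of a) \sum_(nu : part_of (sumn la - a) |
                                perm_eq (mu ++ nu) la) f mu * g nu.

Definition ppow f n : pseries K := iter n (pmul f) pone.

(* homogeneous component of degree d *)
Definition phomog (d : nat) f : pseries K :=
  fun la => if sumn la == d then f la else 0.

End PSeries.

(* [R : comAlgType rat] is a nonzero commutative ring containing the rationals. *)

Section TopologicalPartitionFunctions.
Variable R : comAlgType rat.
Local Notation K := (laurent R).

(* q hbar^n for q rational *)
Definition qmono (q : rat) (n : int) : K := laurent_mono q%:A n.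

(* Exponential of a series f without constant term: f^k has no term of degree
   less than k, so that only k <= |la| contribute to the coefficient of p_la. *)
Definition pexp (f : pseries K) : pseries K := fun la =>
  \sum_(k < (sumn la).+1) qmono (k`!%:R)^-1 0 * ppow f k la.

Definition symmetric_coef (F : nat -> seq nat -> R) : Prop :=
  forall (g : nat) (s t : seq nat), perm_eq s t -> F g s = F g t.

(* [F g [:: k_1; ...; k_n]] is F_{g; k_1, ..., k_n}.  The tuples (k_1, ..., k_n)
   contributing to p_la are the distinct rearrangements of la; the factor
   \sum_g hbar^(2g-2+n) F_{g; k} is hbar^(n-2) times an even series. *)
Definition free_energy (F : nat -> seq nat -> R) : pseries K := fun la =>
  if nilp la then 0 else
  \sum_(k <- permutations la)
    qmono ((size la)`! * \prod_(i <- k) i)%N%:R^-1 ((size la)%:Z - 2)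
    * laurent_of_fps (fun m => if odd m then 0 else F m./2 k).

Definition topological (F : nat -> seq nat -> R) (Z : pseries K) : Prop :=
  symmetric_coef F /\ Z =1 pexp (free_energy F).

(* Z(la), where Z = 1 + \sum_la hbar^(-|la|) Z(la) p_la / z_la *)
Definition Zcoef (Z : pseries K) (la : intpart) : K :=
  qmono (zee la)%:R (sumn la)%:Z * Z la.

End TopologicalPartitionFunctions.

(* In the group 'S_d the product a * b means "a, then b". *)
Definition permcomp (d : nat) (a b : 'S_d) : 'S_d := (b * a)%g.

Fact permcompE d (a b : 'S_d) (i : 'I_d) : permcomp a b i = a (b i).
Proof. by rewrite /permcomp permM. Qed.

Definition cycle_type (d : nat) (s : 'S_d) : seq nat :=
  sort geq [seq #|B| | B : {set 'I_d} in porbits s].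

(* |s| = d - number of cycles *)
Definition perm_len (d : nat) (s : 'S_d) : nat := (d - #|porbits s|)%N.

(* d! times the number H_r of the definition; [cmp] is ltn (strictly monotone) or
   leq (weakly monotone).  A transposition (a b) is encoded by the pair (a, b),
   a < b. *)
Definition hurwitz_count (cmp : rel nat) (d r : nat) (la nu : seq nat) : nat :=
  #|[set x : 'S_d * r.-tuple ('I_d * 'I_d) * 'S_d |
      let: (alpha, t, beta) := x in
      [&& cycle_type alpha == la,
          cycle_type beta == nu,
          all (fun ab : 'I_d * 'I_d => ab.1 < ab.2)%N t,
          sorted cmp [seq val ab.2 | ab : 'I_d * 'I_d <- t] &
          permcomp alpha
            (foldr (@permcomp d) beta
               [seq tperm ab.1 ab.2 | ab : 'I_d * 'I_d <- t]) == 1%g]]|.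

Definition hurwitz (cmp : rel nat) (d r : nat) (la nu : seq nat) : rat :=
  (hurwitz_count cmp d r la nu)%:R / d`!%:R.

Section HurwitzSeries.
Variables (R : comAlgType rat) (d : nat).

Definition Hlt (la nu : part_of d) : fps R :=
  \sum_(r < d) fps_mono ((hurwitz ltn d r la nu)%:A) r.

Definition Hle (la nu : part_of d) : fps R :=
  fun r => (-1) ^+ r * (hurwitz leq d r la nu)%:A.

End HurwitzSeries.

(* the order A <= B of the lattice P(d) *)
Definition refines (d : nat) (A B : {set {set 'I_d}}) : bool :=
  [forall X in A, exists Y in B, X \subset Y].

(* C is the least upper bound of A and B in P(d) *)
Definition is_join (d : nat) (A B C : {set {set 'I_d}}) : bool :=
  [&& partition C [set: 'I_d], refines A C, refines B C &
      [forall D : {set {set 'I_d}},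
         [&& partition D [set: 'I_d], refines A D & refines B D]
         ==> refines C D]].

Definition is_PS (d : nat) (x : {set {set 'I_d}} * 'S_d) : bool :=
  partition x.1 [set: 'I_d] && refines (porbits x.2) x.1.

Record PS (d : nat) := PPerm {
  ps_pair :> {set {set 'I_d}} * 'S_d;
  ps_pairP : is_PS ps_pair
}.

HB.instance Definition _ d := [isSub for @ps_pair d].
HB.instance Definition _ d := [Finite of PS d by <:].

(* The partition with a single block [d]; its block is removed for d = 0. *)
Definition one_block (d : nat) : {set {set 'I_d}} :=
  [set [set: 'I_d]] :\ set0.

Fact PS_one_subproof d (s : 'S_d) : is_PS (one_block d, s).
Proof.
have part1 : partition (one_block d) [set: 'I_d].
  rewrite /one_block; case: (set_0Vmem [set: 'I_d]) => [->|[i _]].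
    by rewrite setDv partition_set0.
  rewrite (setDidPl _); last first.
    by rewrite disjoints1 inE; apply/set0Pn; exists i.
  rewrite /partition /cover big_set1 eqxx trivIset1 inE eq_sym /=.
  by apply/set0Pn; exists i.
rewrite /is_PS part1; apply/forall_inP => X /imsetP[i _ ->].
apply/exists_inP; exists [set: 'I_d]; last exact: subsetT.
by rewrite !inE eqxx andbT; apply/set0Pn; exists i.
Qed.

(* (1_d, s) *)
Definition PS_one (d : nat) (s : 'S_d) : PS d := PPerm (PS_one_subproof s).

(* The restriction of s to an s-stable block B, transported to [#B] by the
   enumeration of B. *)
Section RestrictPerm.
Variables (d : nat) (B : {set 'I_d}) (s : 'S_d).

Definition restr_fun (i : 'I_#|B|) : 'I_#|B| :=
  enum_rank_in (enum_valP i) (restr_perm B s (enum_val i)).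

Fact restr_fun_inj : injective restr_fun.
Proof.
have stab (i : 'I_#|B|) : restr_perm B s (enum_val i) \in B.
  have: restr_perm B s (enum_val i) \in [set restr_perm B s x | x in B].
    by rewrite imset_f ?enum_valP.
  by rewrite im_restr_perm.
move=> i j /(congr1 (@enum_val _ _)); rewrite !enum_rankK_in //.
by move/perm_inj/enum_val_inj.
Qed.

Definition restr : 'S_#|B| := perm restr_fun_inj.

End RestrictPerm.

Section PSFunctions.
Variable K : comNzRingType.

Definition psconv (d : nat) (f1 f2 : PS d -> K) : PS d -> K := fun z =>
  \sum_(x : PS d) \sum_(y : PS d |
      is_join x.1 y.1 z.1 && (permcomp x.2 y.2 == z.2)) f1 x * f2 y.

Definition psdelta (d : nat) : PS d -> K := fun z =>
  ((z.1 == porbits (1 : 'S_d)%g) && (z.2 == 1%g))%:R.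

Definition multiplicative (f : forall d : nat, PS d -> K) : Prop :=
  (forall (d : nat) (s t : 'S_d), (0 < d)%N ->
     f d (PS_one (s ^ t)%g) = f d (PS_one s)) /\
  (forall (d : nat) (z : PS d), (0 < d)%N ->
     f d z = \prod_(B in z.1) f #|B| (PS_one (restr B z.2))).

End PSFunctions.

Section ZetaMu.
Variable R : comNzRingType.

Definition pszeta (d : nat) : PS d -> fps R := fun z =>
  if z.1 == porbits z.2 then fps_mono 1 (perm_len z.2) else 0.

Definition is_psmu (mu : forall d : nat, PS d -> fps R) : Prop :=
  forall d : nat, (0 < d)%N ->
    psconv (@pszeta d) (mu d) =1 @psdelta (fps R) d /\
    psconv (mu d) (@pszeta d) =1 @psdelta (fps R) d.

End ZetaMu.

(* Phi is the multiplicative function attached to F: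
   F = \sum_la hbar^(-|la|) Phi(1_|la|, pi_la) p_la / z_la *)
Definition associated (R : comAlgType rat) (F : pseries (laurent R))
    (Phi : forall d : nat, PS d -> fps R) : Prop :=
  multiplicative Phi /\
  forall (d : nat) (la : part_of d) (s : 'S_d),
    (0 < d)%N -> cycle_type s = la ->
    F la = qmono R (zee la)%:R^-1 (- d%:Z) * laurent_of_fps (Phi d (PS_one s)).

Section Schur.
Variable K : comNzRingType.

Definition powersum (N k : nat) : {mpoly K[N]} := \sum_(i < N) 'X_i ^+ k.

(* a_{la + delta} for la of length at most N *)
Definition alternant (N : nat) (la : seq nat) : {mpoly K[N]} :=
  \det (\matrix_(i < N, j < N) ('X_i ^+ (nth 0%N la j + (N - j.+1)) : {mpoly K[N]})).

(* s is the Schur function s_la written in the power sums: it is homogeneous of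
   degree |la| and, in any number N >= l(la) of variables, specializes to the
   Schur polynomial a_{la + delta} / a_delta. *)
Definition is_schur (la : intpart) (s : pseries K) : Prop :=
  phomog (sumn la) s =1 s /\
  forall N : nat, (size la <= N)%N ->
    (\sum_(mu : part_of (sumn la)) s mu *: \prod_(k <- parts mu) powersum N k)
      * alternant N [::] = alternant N la.

End Schur.

Section OperatorD.
Variable R : comNzRingType.
Local Notation K := (laurent R).

(* Rows and columns are numbered from 0. *)
Definition content_prod (la : seq nat) : K :=
  \prod_(i < size la) \prod_(j < nth 0%N la i)
    (1 + laurent_mono (j%:Z - i%:Z)%:~R 1).

Definition is_D (D : pseries K -> pseries K) : Prop :=
  [/\ forall (a : K) (f g : pseries K),
        D (fun mu => a * f mu + g mu) =1 (fun mu => a * D f mu + D g mu),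
      forall (d : nat) (f : pseries K), D (phomog d f) =1 phomog d (D f) &
      forall (la : intpart) (s : pseries K), is_schur la s ->
        D s =1 (fun mu => content_prod la * s mu)].

End OperatorD.

(* The four relations below are those of degree d.  In one fixed degree d the
   Hurwitz relations do not imply the zeta and mu relations, whose values at
   (A, alpha) with several blocks involve the degrees smaller than d: over the
   rationals, for d = 2, take F2 = 0, and F1 zero but for F1 1 [:: 1] = 1 and
   F1 1 [:: 1; 1] = -1.  Then Zcoef Z1 and Zcoef Z2 both vanish in degree 2, but
   Phi1 is hbar^4 and Phi2 is 0 at the identity with two blocks. *)
Section Properties.
Variable R : comAlgType rat.
Implicit Types Z : pseries (laurent R).
Implicit Types Phi mu : forall d : nat, PS d -> fps R.

Definition Hlt_relation Z1 Z2 (d : nat) : Prop :=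
  forall la : part_of d,
    Zcoef Z1 la = (zee la)%:R
      * \sum_(nu : part_of d) laurent_of_fps (Hlt R la nu) * Zcoef Z2 nu.

Definition Hle_relation Z1 Z2 (d : nat) : Prop :=
  forall nu : part_of d,
    Zcoef Z2 nu = (zee nu)%:R
      * \sum_(la : part_of d) laurent_of_fps (Hle R nu la) * Zcoef Z1 la.

Definition zeta_relation Phi1 Phi2 (d : nat) : Prop :=
  Phi1 d =1 psconv (@pszeta R d) (Phi2 d).

Definition mu_relation mu Phi1 Phi2 (d : nat) : Prop :=
  Phi2 d =1 psconv (mu d) (Phi1 d).

End Properties.

(* Main.v *)
(* Jucys: every permutation s is, in exactly one way, a product of transpositions
   (a_i b_i) with a_i < b_i and (b_i) strictly monotone, and that product has |s|
   factors; so strictly monotone words generate zeta(s) = hbar^|s|.  Signed weakly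
   monotone words give its convolution inverse in the center of the group algebra,
   because the alternating sum over the ways of cutting a sequence into a strictly
   decreasing prefix and a weakly increasing suffix vanishes.  Hence (i) <-> (iii);
   (ii) <-> (iv) is associativity of the product of partitioned permutations.

   The exponential formula reads Z(type of s) = \sum_(A >= 0_s) Phi(A, s).  Summing
   the relation Phi1 = zeta * Phi2 over all partitions refining C gives a product
   over the blocks B of C of the relation between Z1 and Z2 in degree #|B|: C = {[d]}
   yields (ii) -> (i), and Moebius inversion on the partition lattice yields the
   converse, which uses (i) in all degrees up to d.

   For D, the Schur functions are built degree by degree as class functions: inducing
   the one of la from 'S_d to 'S_d.+1 (multiplication by p_1) gives the sum of those
   of all la + box, which the central sum of all transpositions separates.  Its action
   on power sums (cut-and-join) is read off from \sum_i (x_i d/dx_i)^2, for which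
   alternants are eigenvectors.  Factoring zeta on 'S_d.+1 as zeta on 'S_d times
   1 + hbar J, with J the last Jucys-Murphy element, then shows that convolution by
   zeta has eigenvalue \prod (1 + hbar content) on every Schur function; so D acts as
   convolution by zeta. *)

Require Import Defs.
From HB Require Import structures.
From mathcomp Require Import boolp classical_sets functions fsbigop.
From mathcomp Require Import all_boot all_order all_algebra all_fingroup.
From mathcomp Require Import zify ring lra.
From mathcomp Require Import mpoly.

Set Implicit Arguments.
Unset Strict Implicit.
Unset Printing Implicit Defensive.

Import Order.TTheory GRing.Theory Num.Theory.
Local Open Scope ring_scope.

(** * Stable sets and cycle types *)

(** Words with prescribed types, functions on partitioned permutations and coefficients of series
    meet in one language, convolution of class functions on ['S_d]. The factor z_la / d! is the
    inverse size of a conjugacy class and [Zcoef] is the value of a class function [psi], so that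
    (i) says that [psi Z1] is the convolution of [psi Z2] with zeta. Cycle types of restrictions are
    read on stable subsets of one ambient permutation; blocks are transported to a smaller symmetric
    group only where a relation of degree [#|B|] is used. For [D], the obstacle is that Schur
    functions are known only by the bialternant formula in every number of variables, so a power sum
    expansion satisfying it has to be produced. A box is added in one prescribed row by a Lagrange
    projection over [rat], possible because la_i - i strictly decreases in i. The last Jucys-Murphy
    element J is not central, but 2 J is the difference of the elements [kap] of ['S_d.+1] and
    ['S_d], each central in its own group algebra; in this form the factorisation of zeta survives
    both induction and projection. *)

Section Orbits.
Variable T : finType.
Implicit Types (s t : {perm T}) (X Y : {set T}).
Local Open Scope group_scope.

(** An equivalence rather than an implication, so that complements, differences and inverses need no
    counting argument. *)
Definition stable s X := [forall x, (s x \in X) == (x \in X)].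

Lemma stableP s X : reflect (forall x, (s x \in X) = (x \in X)) (stable s X).
Proof. exact: 'forall_eqP. Qed.

Lemma stable_expg s X i x : stable s X -> ((s ^+ i) x \in X) = (x \in X).
Proof.
move/stableP=> sX; elim: i => [|i IHi]; first by rewrite expg0 perm1.
by rewrite expgSr permM sX.
Qed.

Lemma stable_porbit s X x : stable s X -> (porbit s x \subset X) = (x \in X).
Proof.
move=> sX; apply/subsetP/idP => [-> //|xX y /porbitP[i ->]].
  exact: porbit_id.
by rewrite stable_expg.
Qed.

Lemma porbits_stable s O : O \in porbits s -> stable s O.
Proof.
case/imsetP=> x _ ->; apply/stableP => y.
by rewrite -!eq_porbit_mem; have := porbit_perm s 1 y; rewrite expg1 => ->.
Qed.

Lemma stableT s : stable s setT.
Proof. by apply/stableP => x; rewrite !inE. Qed.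

Lemma stable0 s : stable s set0.
Proof. by apply/stableP => x; rewrite !inE. Qed.

Lemma stableU s X Y : stable s X -> stable s Y -> stable s (X :|: Y).
Proof. by move=> /stableP sX /stableP sY; apply/stableP => x; rewrite !inE sX sY. Qed.

Lemma stableD s X Y : stable s X -> stable s Y -> stable s (X :\: Y).
Proof. by move=> /stableP sX /stableP sY; apply/stableP => x; rewrite !inE sX sY. Qed.

Lemma stableM s t X : stable s X -> stable t X -> stable (s * t) X.
Proof. by move=> /stableP sX /stableP tX; apply/stableP => x; rewrite permM tX sX. Qed.

Lemma stableV s X : stable s X -> stable s^-1 X.
Proof. by move=> /stableP sX; apply/stableP => x; rewrite -sX permKV. Qed.

Lemma partition_porbits s : partition (porbits s) setT.
Proof.
apply/and3P; split.
- rewrite eqEsubset subsetT; apply/subsetP => x _; apply/bigcupP.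
  by exists (porbit s x); [apply: imset_f | apply: porbit_id].
- apply/trivIsetP => A B /imsetP[x _ ->] /imsetP[y _ ->]; apply: contraR.
  case/pred0Pn => z /andP[/= zx zy]; apply/eqP.
  by move: zx zy; rewrite -!eq_porbit_mem => /eqP<- /eqP<-.
apply/imsetP => -[x _ /setP/(_ x)].
by rewrite porbit_id inE.
Qed.

Definition orbits_in s X := [set B in porbits s | B \subset X].

Lemma orbits_in_partition s X : stable s X -> partition (orbits_in s X) X.
Proof.
move=> sX; have /and3P[_ /trivIsetP tI n0] := partition_porbits s.
apply/and3P; split.
- rewrite eqEsubset; apply/andP; split.
    by apply/bigcupsP => O; rewrite inE => /andP[].
  apply/subsetP => x xX; apply/bigcupP; exists (porbit s x); last exact: porbit_id.
  by rewrite inE imset_f //= stable_porbit.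
- by apply/trivIsetP => A B; rewrite !inE => /andP[A1 _] /andP[B1 _]; apply: tI.
by rewrite inE (negPf n0).
Qed.

(** The cycle type of the restriction of [s] to a stable set [X], computed without leaving
    [{perm T}]. *)
Definition ctype s X := sort geq [seq #|B| | B : {set T} in orbits_in s X].

Lemma perm_ctype s X : perm_eq (ctype s X) [seq #|B| | B : {set T} in orbits_in s X].
Proof. by rewrite /ctype perm_sort. Qed.

Lemma size_ctype s X : size (ctype s X) = #|orbits_in s X|.
Proof. by rewrite size_sort size_image. Qed.

Lemma big_ctype (R : Type) (idx : R) (op : Monoid.com_law idx) (F : nat -> R) s X :
  \big[op/idx]_(k <- ctype s X) F k = \big[op/idx]_(O in orbits_in s X) F #|O|.
Proof. by rewrite (perm_big _ (perm_ctype s X)) /= big_map big_enum. Qed.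

Lemma sumn_ctype s X : stable s X -> sumn (ctype s X) = #|X|.
Proof.
move=> sX; rewrite sumnE big_ctype /=.
by rewrite -(card_partition (orbits_in_partition sX)).
Qed.

Lemma intpart_ctype s X : is_intpart (ctype s X).
Proof.
rewrite /is_intpart sort_sorted /=; last by move=> m n; rewrite /geq /= leq_total.
rewrite (perm_mem (perm_ctype s X)); apply/imageP => -[O].
rewrite inE => /andP[/imsetP[x _ ->] _] /esym/eqP.
by rewrite (negPf (card_porbit_neq0 _ _)).
Qed.

Definition ctypeP s X := IntPart (intpart_ctype s X).

Lemma porbit_agree s t X x : stable s X -> {in X, s =1 t} -> x \in X ->
  porbit s x = porbit t x.
Proof.
move=> sX st xX; apply/setP => y.
suff E i : (s ^+ i) x = (t ^+ i) x by apply/porbitP/porbitP => -[i ->]; exists i.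
elim: i => // i IHi; rewrite !expgSr !permM -IHi st //.
by rewrite stable_expg.
Qed.

Lemma orbits_in_agree s t X : stable s X -> stable t X -> {in X, s =1 t} ->
  orbits_in s X = orbits_in t X.
Proof.
move=> sX tX st; apply/setP => O; rewrite !inE.
apply/andP/andP => -[/imsetP[x _ ->]]; rewrite stable_porbit // => xX.
  by rewrite (porbit_agree sX st xX) imset_f ?stable_porbit.
have ts : {in X, t =1 s} by move=> y yX; rewrite st.
by rewrite (porbit_agree tX ts xX) imset_f ?stable_porbit.
Qed.

Lemma ctype_agree s t X : stable s X -> stable t X -> {in X, s =1 t} ->
  ctype s X = ctype t X.
Proof. by move=> *; rewrite /ctype (@orbits_in_agree s t). Qed.

Lemma orbits_inU s X Y : stable s X -> stable s Y -> [disjoint X & Y] ->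
  orbits_in s (X :|: Y) = orbits_in s X :|: orbits_in s Y.
Proof.
move=> sX sY dXY; apply/setP => O; rewrite !inE -andb_orr.
have [/imsetP[x _ ->]/=|//] := boolP (O \in porbits s).
by rewrite !stable_porbit ?stableU // inE.
Qed.

Lemma disjoint_orbits_in s X Y : [disjoint X & Y] ->
  [disjoint orbits_in s X & orbits_in s Y].
Proof.
move=> dXY; apply/pred0Pn => -[O /andP[/=]]; rewrite !inE.
case/andP=> /imsetP[x _ ->] /subsetP/(_ x (porbit_id _ _)) xX.
case/andP=> _ /subsetP/(_ x (porbit_id _ _)) xY.
by move/pred0P/(_ x): dXY; rewrite /= xX xY.
Qed.

Lemma ctypeU s X Y : stable s X -> stable s Y -> [disjoint X & Y] ->
  perm_eq (ctype s X ++ ctype s Y) (ctype s (X :|: Y)).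
Proof.
move=> sX sY dXY; rewrite perm_sym (permPl (perm_ctype _ _)) perm_sym.
apply: (@perm_trans _ ([seq #|B| | B : {set T} in orbits_in s X] ++ [seq #|B| | B : {set T} in orbits_in s Y])).
  by rewrite perm_cat ?perm_ctype.
rewrite orbits_inU // -map_cat; apply: perm_map; apply: uniq_perm; rewrite ?enum_uniq //.
  rewrite cat_uniq !enum_uniq andbT /=; apply/hasPn => O; rewrite !mem_enum => OY.
  have /pred0P/(_ O) := disjoint_orbits_in s dXY.
  by rewrite /= OY andbT => ->.
move=> O; rewrite mem_cat !mem_enum.
by rewrite in_setU.
Qed.

Lemma ctype_eq s X (mu : seq nat) : is_intpart mu ->
  perm_eq mu (ctype s X) -> mu = ctype s X.
Proof.
case/andP=> smu _ /(sorted_eq _ _ smu); apply => //.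
- by move=> y x z /=; rewrite /geq /=; lia.
- by move=> x y /=; rewrite /geq /=; lia.
by apply: sort_sorted => x y; rewrite /geq /=; lia.
Qed.

Lemma ctype_orbit s O : O \in porbits s -> ctype s O = [:: #|O|].
Proof.
move=> Op; have E : orbits_in s O = [set O].
  apply/setP => O'; rewrite !inE; apply/andP/eqP => [[/imsetP[x _ ->]]|->//].
  rewrite stable_porbit; last exact: porbits_stable.
  by case/imsetP: Op => y _ ->; rewrite -eq_porbit_mem => /eqP.
apply/esym/ctype_eq.
  rewrite /is_intpart /= inE eq_sym; case/imsetP: Op => x _ ->.
  exact: card_porbit_neq0.
by rewrite perm_sym (permPl (perm_ctype _ _)) E /image_mem enum_set1.
Qed.

Lemma ctype0 s : ctype s set0 = [::].
Proof.
apply/eqP; rewrite -size_eq0 size_ctype cards_eq0; apply/eqP/setP => O.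
rewrite !inE; apply/andP => -[/imsetP[x _ ->]].
by rewrite stable_porbit ?stable0 // inE.
Qed.

End Orbits.

Lemma cycle_typeE d (s : 'S_d) : cycle_type s = ctype s setT.
Proof.
rewrite /cycle_type /ctype; congr sort; congr map; apply: eq_enum => O.
by rewrite inE subsetT andbT.
Qed.

Section Transport.
Variables (T1 T2 : finType) (f : T1 -> T2) (s1 : {perm T1}) (s2 : {perm T2}).
Hypotheses (f_inj : injective f) (fs : forall x, f (s1 x) = s2 (f x)).

Lemma porbit_transport x : porbit s2 (f x) = f @: porbit s1 x.
Proof.
have E i : f ((s1 ^+ i)%g x) = (s2 ^+ i)%g (f x).
  by elim: i => [|i IHi]; rewrite ?expg0 ?perm1 // !expgSr !permM fs IHi.
apply/setP => y; apply/porbitP/imsetP => [[i ->]|[z /porbitP[i ->] ->]].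
  by exists ((s1 ^+ i)%g x); rewrite ?E // mem_porbit.
by exists i.
Qed.

Lemma stable_transport (X : {set T1}) : stable s2 (f @: X) = stable s1 X.
Proof.
apply/stableP/stableP => h x; first by have := h (f x); rewrite -fs !mem_imset.
apply/imsetP/imsetP => -[y yX]; last by move=> ->; exists (s1 y); rewrite ?h.
rewrite -[y](permKV s1) fs => /perm_inj ->; exists (s1^-1 y)%g => //.
by rewrite -h permKV.
Qed.

Lemma orbits_in_transport (X : {set T1}) : stable s1 X ->
  orbits_in s2 (f @: X) = [set f @: B | B : {set T1} in orbits_in s1 X].
Proof.
move=> sX; have s2X : stable s2 (f @: X) by rewrite stable_transport.
apply/setP => O; rewrite !inE; apply/andP/imsetP.
  case=> /imsetP[y _ ->]; rewrite stable_porbit // => /imsetP[x xX ->].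
  by exists (porbit s1 x); rewrite ?inE ?imset_f ?stable_porbit ?porbit_transport.
case=> O1; rewrite inE => /andP[/imsetP[x _ ->]]; rewrite stable_porbit // => xX ->.
by rewrite -porbit_transport imset_f ?stable_porbit ?imset_f.
Qed.

(** Injectivity of [f] suffices, which covers conjugation, the inclusion of ['I_d] in ['I_d.+1] and
    the enumeration of a block. *)
Lemma ctype_transport (X : {set T1}) : stable s1 X -> ctype s2 (f @: X) = ctype s1 X.
Proof.
move=> sX; apply/esym/ctype_eq; first exact: intpart_ctype.
apply: perm_trans (perm_ctype _ _) _; rewrite perm_sym.
apply: perm_trans (perm_ctype _ _) _; rewrite orbits_in_transport //.
apply: (@perm_trans _ [seq #|pred_of_set B| | B : {set T2} <- [seq f @: B | B : {set T1} in orbits_in s1 X]]).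
  apply: perm_map; apply: uniq_perm; rewrite ?enum_uniq //.
    by rewrite map_inj_uniq ?enum_uniq //; apply: imset_inj.
  move=> O; rewrite mem_enum; apply/imsetP/mapP => -[O1 h ->]; exists O1 => //.
    by rewrite mem_enum.
  by rewrite mem_enum in h.
rewrite -map_comp (eq_map (g := fun B : {set T1} => #|B|)) // => O /=.
by rewrite card_imset.
Qed.

End Transport.

(** * Cutting and joining cycles by a transposition *)

Section CutJoin.
Variable T : finType.
Implicit Types (s t u v : {perm T}) (X Y : {set T}).
Local Open Scope group_scope.

Lemma porbit_expg_inj u x i j : (i < #|porbit u x|)%N -> (j < #|porbit u x|)%N ->
  ((u ^+ i) x == (u ^+ j) x) = (i == j).
Proof.
move=> li lj; rewrite !permX -(nth_traject u li x) -(nth_traject u lj x).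
by rewrite nth_uniq ?size_traject ?uniq_traject_porbit.
Qed.

Lemma porbit_expg_neq u x i : (0 < i < #|porbit u x|)%N -> (u ^+ i) x != x.
Proof.
case/andP=> i0 ilt; rewrite -[X in _ != X]perm1 -(expg0 u) porbit_expg_inj ?(leq_ltn_trans (leq0n i) ilt) //.
by rewrite -lt0n.
Qed.

Lemma card_porbit_min u x k : (0 < k)%N -> (u ^+ k) x = x ->
  (forall i, (0 < i < k)%N -> (u ^+ i) x != x) -> #|porbit u x| = k.
Proof.
move=> k0 uk ui; set n := #|_|.
have n0 : (0 < n)%N by rewrite lt0n card_porbit_neq0.
have un : (u ^+ n) x = x by rewrite permX iter_porbit.
have [ltnk|ltkn|//] := ltngtP n k.
  by have := ui n; rewrite n0 ltnk un eqxx => /(_ isT).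
by have := @porbit_expg_neq u x k; rewrite k0 ltkn uk eqxx => /(_ isT).
Qed.

(** The permutation [u] sends [b] to [s a] and then follows [s], so its cycle through [b] is
    [s a, ..., (s ^+ k) a = b]. *)
Lemma tperm_split s a k : (0 < k < #|porbit s a|)%N ->
  let b := (s ^+ k) a in let u := tperm a b * s in
  #|porbit u b| = k /\ a \notin porbit u b.
Proof.
case/andP=> k0 kL b u.
have L0 : (0 < #|porbit s a|)%N by apply: leq_ltn_trans kL.
have ui i : (0 < i <= k)%N -> (u ^+ i) b = (s ^+ i) a.
  elim: i => // i IHi /andP[_ lik]; rewrite !expgSr !permM.
  case: (posnP i) => [->|i0]; first by rewrite !expg0 !perm1 tpermR.
  have iL := ltn_trans lik kL.
  have ia : (s ^+ i) a != a by rewrite porbit_expg_neq // i0.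
  have ib : (s ^+ i) a != b by rewrite porbit_expg_inj //; apply/eqP => E; rewrite E ltnn in lik.
  by rewrite IHi ?i0 ?(ltnW lik) // tpermD // eq_sym.
have uk : (u ^+ k) b = b by rewrite ui // k0 leqnn.
have cb : #|porbit u b| = k.
  apply: card_porbit_min => // i /andP[i0 ik]; rewrite ui ?i0 ?(ltnW ik) //.
  by rewrite porbit_expg_inj ?(ltn_trans ik kL) //; lia.
split=> //; rewrite porbit_traject cb; apply/trajectP => -[i lik]; rewrite -permX => E.
case: (posnP i) E => [->|i0 E].
  by rewrite expg0 perm1 => E; have := @porbit_expg_neq s a k; rewrite k0 kL -/b -E eqxx => /(_ isT).
have := @porbit_expg_neq s a i; rewrite i0 (ltn_trans lik kL) => /(_ isT).
by rewrite -ui ?i0 ?(ltnW lik) // -E eqxx.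
Qed.

Lemma stable_tperm s a b X : stable s X -> a \in X -> b \in X ->
  stable (tperm a b * s) X.
Proof.
move=> sX aX bX; apply: stableM => //; apply/stableP => x.
by case: tpermP => // ->; rewrite aX bX.
Qed.

Lemma stableC s X : stable s X -> stable s (~: X).
Proof. by move/stableP=> sX; apply/stableP => x; rewrite !inE sX. Qed.

Lemma stable_porbit_set s x : stable s (porbit s x).
Proof. by apply: porbits_stable; apply: imset_f. Qed.

Lemma ctypeUC s X : stable s X -> perm_eq (ctype s X ++ ctype s (~: X)) (ctype s setT).
Proof.
move=> sX; rewrite -(setUCr X); apply: ctypeU => //; first exact: stableC.
by rewrite disjoints_subset setCK.
Qed.

Lemma ctypeT_porbit s a :
  perm_eq (#|porbit s a| :: ctype s (~: porbit s a)) (ctype s setT).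
Proof.
by rewrite -(permPr (ctypeUC (stable_porbit_set s a))) (ctype_orbit (imset_f _ _)) // perm_refl.
Qed.

Lemma ctype_tperm_out s a b X : stable s X -> a \in X -> b \in X ->
  ctype (tperm a b * s) (~: X) = ctype s (~: X).
Proof.
move=> sX aX bX; apply: ctype_agree.
- by apply: stableC; apply: stable_tperm.
- exact: stableC.
move=> x; rewrite inE => xX; rewrite permM tpermD //.
  by apply: contraNneq xX => <-.
by apply: contraNneq xX => <-.
Qed.

(** [tperm_split] is used from both ends: from [a] with exponent [k], and from [b] with the
    complementary exponent, which leads back to [a]. *)
Lemma ctype_cut s a k : (0 < k < #|porbit s a|)%N ->
  perm_eq (ctype (tperm a ((s ^+ k) a) * s) setT)
    [:: k, #|porbit s a| - k & ctype s (~: porbit s a)]%N.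
Proof.
move=> hk; set b := (s ^+ k) a; set u := tperm a b * s.
have [cb aB] := tperm_split hk; rewrite -/b -/u in cb aB.
have hL : (s ^+ (#|porbit s a| - k)) b = a.
  rewrite /b -permM -expgD subnKC; last by lia.
  by rewrite permX iter_porbit.
have pb : porbit s b = porbit s a by rewrite porbit_perm.
have hk' : (0 < #|porbit s a| - k < #|porbit s b|)%N by rewrite pb; lia.
have [ca _] := tperm_split hk'; rewrite hL tpermC -/u in ca.
have sX := stable_porbit_set s a.
have bX : b \in porbit s a by rewrite mem_porbit.
have uX : stable u (porbit s a) by apply: stable_tperm; rewrite ?porbit_id.
have sub : porbit u b \subset porbit s a by rewrite stable_porbit.
have E : porbit s a :\: porbit u b = porbit u a.
  apply/esym/eqP; rewrite eqEcard ca cardsD (setIidPr sub) cb leqnn andbT.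
  rewrite stable_porbit; first by rewrite inE aB porbit_id.
  by apply: stableD => //; apply: stable_porbit_set.
rewrite -(permPl (ctypeUC uX)) ctype_tperm_out ?porbit_id //.
rewrite -[[:: k, _ & _]]/([:: k; _]%N ++ _) perm_cat2r.
have {1}-> : porbit s a = porbit u b :|: porbit u a.
  by rewrite -E setDE setUIr setUCr setIT; apply/esym/setUidPr.
rewrite perm_sym; apply: perm_trans (ctypeU _ _ _); try exact: stable_porbit_set.
  by rewrite !ctype_orbit ?imset_f // cb ca.
by rewrite -E disjoint_sym disjoints_subset; apply/subsetP => x; rewrite !inE => /andP[].
Qed.

(** Otherwise multiplying twice by the transposition would lower the number of cycles twice,
    although it gives back [s]. *)
Lemma tperm_join_porbit s a b : b \notin porbit s a ->
  b \in porbit (tperm a b * s) a.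
Proof.
move=> nb; have ab : a != b by apply: contraNneq nb => ->; rewrite porbit_id.
have /= := porbits_mul_tperm s a b; have /= := porbits_mul_tperm (tperm a b * s) a b.
rewrite mulgA tperm2 mul1g ab porbit_sym [a \in porbit s b]porbit_sym nb.
by case: (b \in _) => //=; lia.
Qed.

(** A join is a cut read backwards: [s] is obtained from [v] by cutting the cycle that contains [a]
    and [b]. *)
Lemma ctype_join s a b : b \notin porbit s a ->
  perm_eq (ctype (tperm a b * s) setT)
    ((#|porbit s a| + #|porbit s b|)%N :: ctype s (~: (porbit s a :|: porbit s b))).
Proof.
move=> nb; set v := tperm a b * s.
have bv : b \in porbit v a by apply: tperm_join_porbit.
have ab : a != b by apply: contraNneq nb => ->; rewrite porbit_id.
have sv : s = tperm a b * v by rewrite mulgA tperm2 mul1g.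
have [k kL kb] : exists2 k, (k < #|porbit v a|)%N & b = (v ^+ k) a.
  by move: bv; rewrite porbit_traject => /trajectP[k ? ->]; exists k; rewrite ?permX.
have k0 : (0 < k)%N by case: k kb {kL} => // E; rewrite E expg0 perm1 eqxx in ab.
have hk : (0 < k < #|porbit v a|)%N by rewrite k0.
have [cb aB] := tperm_split hk; rewrite -kb -sv in cb aB.
have sX := stable_porbit_set v a.
have s'X : stable s (porbit v a) by rewrite sv; apply: stable_tperm; rewrite ?porbit_id.
have hL : (v ^+ (#|porbit v a| - k)) b = a.
  rewrite kb -permM -expgD subnKC; last by lia.
  by rewrite permX iter_porbit.
have pb : porbit v b = porbit v a by rewrite kb porbit_perm.
have hk' : (0 < #|porbit v a| - k < #|porbit v b|)%N by rewrite pb; lia.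
have [ca _] := tperm_split hk'; rewrite hL tpermC -sv in ca.
have E : porbit v a = porbit s a :|: porbit s b.
  apply/esym/eqP; rewrite eqEcard subUset !stable_porbit // porbit_id bv /=.
  rewrite cardsU ca cb (_ : _ :&: _ = set0) ?cards0; first by lia.
  apply/setP => x; rewrite !inE; apply/negP => /andP[].
  rewrite -!eq_porbit_mem => /eqP-> /eqP E.
  by move: nb; rewrite -eq_porbit_mem E eqxx.
have sz : (#|porbit s a| + #|porbit s b| = #|porbit v a|)%N by rewrite ca cb; lia.
by rewrite -E sz -(permPl (ctypeT_porbit v a)) ctype_tperm_out ?porbit_id ?perm_refl //.

Qed.

End CutJoin.

(** * Length and cycle type in the symmetric group *)

Section PermLen.
Variable d : nat.
Implicit Types s t : 'S_d.
Local Open Scope group_scope.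

Lemma card_porbits_le s : (#|porbits s| <= d)%N.
Proof. by rewrite -[X in (_ <= X)%N]card_ord; apply: leq_imset_card. Qed.

Lemma perm_len1 : perm_len (1 : 'S_d) = 0%N.
Proof.
rewrite /perm_len card_imset ?card_ord ?subnn // => x y /eqP.
by rewrite eq_porbit_mem porbit.unlock cycle1 imset_set1 /aperm perm1 inE => /eqP.
Qed.

Lemma perm_len0 s : perm_len s = 0%N -> s = 1.
Proof.
move=> h; have : #|porbits s| = #|'I_d|.
  by rewrite card_ord; have := card_porbits_le s; rewrite /perm_len in h; lia.
move=> /eqP/imset_injP inj; apply/permP => x; rewrite perm1; apply: inj => //.
by have := porbit_perm s 1 x; rewrite expg1.
Qed.

Lemma perm_len_tperm s a b : a != b -> a \in porbit s b ->
  perm_len s = (perm_len (tperm a b * s)).+1.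
Proof.
move=> ab h; have /= := porbits_mul_tperm s a b; rewrite ab h /=.
rewrite addn0 addn1 => E; have := card_porbits_le (tperm a b * s); rewrite /perm_len E => lt_s.
by rewrite subnSK.
Qed.

Lemma cycle_typeJ s t : cycle_type (s ^ t) = cycle_type s.
Proof.
rewrite !cycle_typeE -(@ctype_transport _ _ t s (s ^ t)) ?stableT //.
- by congr ctype; apply/esym/setP => x; rewrite inE -[x](permKV t) mem_imset ?inE //; apply: perm_inj.
- exact: perm_inj.
by move=> x; rewrite permJ.
Qed.

Lemma perm_len_size s : perm_len s = (d - size (cycle_type s))%N.
Proof. by rewrite /perm_len size_sort size_image. Qed.

Lemma perm_lenJ s t : perm_len (s ^ t) = perm_len s.
Proof. by rewrite !perm_len_size cycle_typeJ. Qed.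

Lemma cycle_typeV s : cycle_type s^-1 = cycle_type s.
Proof. by rewrite /cycle_type porbitsV. Qed.

Lemma perm_lenV s : perm_len s^-1 = perm_len s.
Proof. by rewrite /perm_len porbitsV. Qed.

Lemma perm_len_lt s : (0 < d)%N -> (perm_len s < d)%N.
Proof.
move=> d0; suff : (0 < #|porbits s|)%N by have := card_porbits_le s; rewrite /perm_len; lia.
by rewrite card_gt0; apply/set0Pn; exists (porbit s (Ordinal d0)); apply: imset_f.
Qed.

Lemma sumn_cycle_type s : sumn (cycle_type s) = d.
Proof. by rewrite cycle_typeE sumn_ctype ?stableT // cardsT card_ord. Qed.

Lemma cycle_part_subproof s : sumn (IntPart (intpart_ctype s setT)) == d.
Proof. by rewrite /= -cycle_typeE sumn_cycle_type. Qed.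

Definition cycle_part s : part_of d := PartOf (cycle_part_subproof s).

Lemma cycle_partE s : cycle_part s = cycle_type s :> seq nat.
Proof. by rewrite cycle_typeE. Qed.

Lemma cycle_partP s (la : part_of d) : (cycle_type s == la) = (cycle_part s == la).
Proof.
rewrite -cycle_partE; apply/eqP/eqP => [E|->//].
by apply/val_inj/val_inj.
Qed.

Lemma cycle_partJ s t : cycle_part (s ^ t) = cycle_part s.
Proof. by apply/eqP; rewrite -cycle_partP cycle_partE cycle_typeJ. Qed.

Lemma cycle_partV s : cycle_part s^-1 = cycle_part s.
Proof. by apply/eqP; rewrite -cycle_partP cycle_partE cycle_typeV. Qed.

End PermLen.

(** * Scalars *)

Section LaurentMorphisms.
Variable R : comNzRingType.
Implicit Types (f g : fps R) (h : laurent R).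

Lemma laurentP h1 h2 : (forall n, lcoef h1 n = lcoef h2 n) -> h1 = h2 :> laurent R.
Proof. by move=> E; apply/val_inj/funext. Qed.

Lemma laurent_mulE h1 h2 n : lcoef (h1 * h2) n = laurent_conv h1 h2 n.
Proof. by []. Qed.

Lemma laurent_mono_mull a n h k : lcoef (laurent_mono a n * h) k = a * h (k - n).
Proof.
rewrite laurent_mulE /laurent_conv (fsbigE [:: n]) //=.
  by rewrite big_cons big_nil mem_set //= eqxx addr0.
by move=> i _; rewrite inE; case: eqP => //; rewrite mul0r.
Qed.

Lemma laurent_monoM (a b : R) (m n : int) :
  laurent_mono a m * laurent_mono b n = laurent_mono (a * b) (m + n).
Proof.
apply/laurentP => k; rewrite laurent_mono_mull /= subr_eq [n + m]addrC.
by case: eqP; rewrite ?mulr0.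
Qed.

Lemma laurent_of_fps_inj : injective (@laurent_of_fps R).
Proof.
move=> f g /(congr1 (@lcoef R)) E; apply/funext => n.
by have := congr1 (fun u : int -> R => u n%:Z) E.
Qed.

Lemma laurent_of_fps_is_zmod_morphism : zmod_morphism (@laurent_of_fps R).
Proof.
move=> f g; apply/laurentP => -[n|n] //=.
by rewrite [RHS](_ : _ = (0 : R) - 0) //; rewrite subr0.
Qed.

Lemma laurent_of_fps_is_monoid_morphism : monoid_morphism (@laurent_of_fps R).
Proof.
split.
  by apply/laurentP => -[n|n] //=; rewrite [LHS](_ : _ = (n == 0%N)%:R) //; case: n.

move=> f g; apply/laurentP => k; rewrite laurent_mulE /laurent_conv.
case: k => [n|n] /=; last first.
  rewrite fsbig1 // => -[i|i] _ /=; rewrite ?mul0r //.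
  by case E : (Negz n - Posz i) => [j|j]; rewrite ?mulr0 //; lia.
rewrite [LHS](_ : _ = \sum_(i < n.+1) f i * g (n - i)%N) //.
rewrite (fsbigE [seq Posz i | i <- iota 0 n.+1]) //.
- rewrite big_map -[n.+1 in RHS]subn0 -/(index_iota 0 n.+1).
  rewrite [RHS](eq_bigl xpredT); last by move=> i; apply: mem_set.
  rewrite big_mkord; apply: eq_bigr => i _ /=.
  by rewrite subzn // -ltnS.
- by rewrite (map_inj_uniq (f := Posz)) ?iota_uniq // => i j [].
case=> [i|i] _; last by rewrite mul0r.
rewrite mem_map ?mem_iota ?add0n /=; last by move=> x y [].
move=> hi; case E : (Posz n - Posz i) => [j|j]; rewrite ?mulr0 //; lia.
Qed.

HB.instance Definition _ := GRing.isZmodMorphism.Build (fps R) (laurent R)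
  (@laurent_of_fps R) laurent_of_fps_is_zmod_morphism.
HB.instance Definition _ := GRing.isMonoidMorphism.Build (fps R) (laurent R)
  (@laurent_of_fps R) laurent_of_fps_is_monoid_morphism.

Lemma laurent_of_mono a n : laurent_of_fps (fps_mono a n) = laurent_mono a n%:Z :> laurent R.
Proof. by apply/laurentP => -[k|k]. Qed.

Definition laurentC (a : R) : laurent R := laurent_mono a 0.

Lemma laurentC_is_zmod_morphism : zmod_morphism laurentC.
Proof.
move=> a b; apply/laurentP => n /=.
rewrite [RHS](_ : _ = (if n == 0 then a else 0) - (if n == 0 then b else 0)) //.
by case: eqP; rewrite ?subr0.
Qed.

Lemma laurentC_is_monoid_morphism : monoid_morphism laurentC.
Proof. by split=> // a b; rewrite /laurentC laurent_monoM addr0. Qed.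

HB.instance Definition _ := GRing.isZmodMorphism.Build R (laurent R)
  laurentC laurentC_is_zmod_morphism.
HB.instance Definition _ := GRing.isMonoidMorphism.Build R (laurent R)
  laurentC laurentC_is_monoid_morphism.

Definition hbar : laurent R := laurent_mono 1 1.

Lemma hbarX n : hbar ^+ n = laurent_mono 1 n%:Z.
Proof.
elim: n => // n IHn; rewrite exprS IHn laurent_monoM mul1r.
by rewrite -PoszD add1n.
Qed.

Lemma laurent_monoE a n : laurent_mono a n = laurentC a * laurent_mono 1 n.
Proof. by rewrite laurent_monoM mulr1 add0r. Qed.

Lemma laurent_of_hbarX n : laurent_of_fps (fps_mono 1 n) = hbar ^+ n :> laurent R.
Proof. by rewrite laurent_of_mono hbarX. Qed.

Lemma mono_unitK n : laurent_mono 1 n * laurent_mono 1 (- n) = 1 :> laurent R.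
Proof. by rewrite laurent_monoM mulr1 subrr. Qed.

End LaurentMorphisms.

Section RatLaurent.
Variable R : comAlgType rat.

(** Schur functions are constructed over [rat] and carried to [laurent R] by this morphism. *)
Definition ratK : rat -> laurent R := @laurentC R \o in_alg R.

HB.instance Definition _ := GRing.RMorphism.on ratK.

Lemma qmonoE q n : qmono R q n = ratK q * laurent_mono 1 n.
Proof. exact: laurent_monoE. Qed.

Lemma qmonoM p q m n : qmono R p m * qmono R q n = qmono R (p * q) (m + n).
Proof. by rewrite !qmonoE mulrACA -rmorphM laurent_monoM mulr1. Qed.

Lemma qmono1 : qmono R 1 0 = 1.
Proof. by rewrite qmonoE rmorph1 mul1r. Qed.

Lemma ratK_nat n : ratK n%:R = n%:R.
Proof. exact: rmorph_nat. Qed.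

End RatLaurent.

(** * Jucys' correspondence *)

Section WordSums.
Variables (A : finType) (V : nmodType).

(** The summand is a function of plain sequences, so that words can be cut, reversed and
    concatenated without casts. *)
Definition wsum n (P : seq A -> V) : V := \sum_(w : n.-tuple A) P w.

Lemma wsum0 P : wsum 0 P = P [::].
Proof. by rewrite /wsum (big_pred1 [tuple]) // => w; apply/esym/eqP; exact: tuple0. Qed.

Lemma wsumS n P : wsum n.+1 P = \sum_a wsum n (fun w => P (a :: w)).
Proof.
rewrite /wsum pair_big /= (reindex (fun aw : A * n.-tuple A => cons_tuple aw.1 aw.2)) //=.
exists (fun w : n.+1.-tuple A => (thead w, behead_tuple w)) => [[a w] _ | w _] /=.
  by congr (_, _); apply/val_inj.
by rewrite [w in RHS]tuple_eta; apply/val_inj.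
Qed.

Lemma eq_wsum n P Q : (forall w, size w = n -> P w = Q w) -> wsum n P = wsum n Q.
Proof. by move=> E; apply: eq_bigr => w _; rewrite E ?size_tuple. Qed.

Lemma wsum_cat m n P : wsum m (fun u => wsum n (fun v => P (u ++ v))) = wsum (m + n) P.
Proof.
elim: m P => [|m IHm] P; first by rewrite wsum0.
by rewrite addSn !wsumS; apply: eq_bigr => a _; rewrite -IHm.
Qed.

Lemma wsum_rev n P : wsum n (fun w => P (rev w)) = wsum n P.
Proof.
rewrite /wsum [RHS](reindex (fun w : n.-tuple A => rev_tuple w)) //=.
by exists (fun w : n.-tuple A => rev_tuple w) => w _; apply/val_inj/revK.
Qed.

End WordSums.

Section Jucys.
Variable d : nat.
Local Notation letter := ('I_d * 'I_d)%type.
Implicit Types (s t : 'S_d) (w : seq letter).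

Definition valid w := all (fun ab : letter => ab.1 < ab.2)%N w.
Definition tops w := [seq val ab.2 | ab : letter <- w].
Definition wprod w : 'S_d := (\prod_(ab <- w) tperm ab.1 ab.2)%g.

Lemma wprod_rev w : wprod (rev w) = (wprod w)^-1%g.
Proof.
elim: w => [|ab w IHw]; rewrite /wprod ?big_nil ?invg1 //.
rewrite rev_cons -cats1 big_cat big_seq1 big_cons invMg tpermV.
by congr (_ * _)%g.
Qed.

Lemma wprod_cat u w : wprod (u ++ w) = (wprod u * wprod w)%g.
Proof. by rewrite /wprod big_cat. Qed.

Definition fixes_from k s := [forall x : 'I_d, (k <= x)%N ==> (s x == x)].

Lemma fixes_fromP k s : reflect (forall x : 'I_d, (k <= x)%N -> s x = x) (fixes_from k s).
Proof. by apply: (iffP forall_inP) => h x /h => [/eqP|->]. Qed.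

(* The first letter is forced: b is the largest point moved by s, and a its
   preimage under s. *)
Lemma jucys_step (k r : nat) s :
  (\sum_(ab : letter) [&& ab.1 < ab.2, ab.2 < k, fixes_from ab.2 (tperm ab.1 ab.2 * s)%g
      & perm_len (tperm ab.1 ab.2 * s)%g == r] = (fixes_from k s && (perm_len s == r.+1)))%N.
Proof.
have key (a b : 'I_d) : (a < b)%N -> fixes_from b (tperm a b * s)%g ->
    [/\ s a = b, s b != b & forall x : 'I_d, (b < x)%N -> s x = x].
  move=> ab /fixes_fromP h; have E : s a = b by have := h b (leqnn b); rewrite permM tpermR.
  split=> //; first by apply/eqP => E'; move: ab; rewrite (perm_inj (etrans E (esym E'))) ltnn.
  move=> x bx; have := h x (ltnW bx); rewrite permM tpermD //.
    by apply: contraTneq bx => <-; rewrite -leqNgt ltnW.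
  by apply: contraTneq bx => <-; rewrite ltnn.
have [x0 sx0|s1] := pickP [pred x | s x != x]; last first.
  have -> : s = 1%g by apply/permP => x; rewrite perm1; have := s1 x; rewrite /= => /negbFE/eqP.
  rewrite perm_len1 andbF big1 // => -[a b] _ /=.
  have [ab|] := ltnP a b => //=; case: (b < k)%N => //=.
  rewrite mulg1; case: fixes_fromP => //= h; have := h b (leqnn b).
  by rewrite tpermR => E; rewrite E ltnn in ab.
case: (@arg_maxnP _ x0 [pred x | s x != x] (@nat_of_ord d) sx0) => /= b sb bmax.
have bfix (x : 'I_d) : (b < x)%N -> s x = x.
  by move=> bx; apply/eqP; apply: contraTT bx => /bmax; rewrite -leqNgt.
pose a := (s^-1)%g b.
have sa : s a = b by rewrite permKV.
have ab : (a < b)%N.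
  rewrite ltn_neqAle (bmax a) ?andbT; last by rewrite sa; apply: contraNneq sb => E; rewrite {1}E sa.
  by apply: contraNneq sb => /val_inj {1}<-; rewrite sa.
have nab : a != b by apply: contraTneq ab => ->; rewrite ltnn.
have len_s : perm_len s = (perm_len (tperm a b * s)%g).+1.
  apply: perm_len_tperm => //; rewrite porbit_sym -sa.
  by have := mem_porbit s 1 a; rewrite expg1.
have fix_b : fixes_from b (tperm a b * s)%g.
  apply/fixes_fromP => x; rewrite leq_eqVlt permM => /orP[/eqP/val_inj <-|bx].
    by rewrite tpermR.
  rewrite tpermD ?bfix //; last by apply: contraTneq bx => <-; rewrite ltnn.
  by apply: contraTneq bx => <-; rewrite -leqNgt ltnW.
rewrite (bigD1 (a, b)) //= big1 ?addn0; last first.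
  move=> [a' b'] /= ne; case E : [&& _, _, _ & _] => //.
  case/and4P: E => lt' _ /(key _ _ lt')[sa' sb' bf'] _.
  have bb : b' = b.
    apply/val_inj/eqP; rewrite eqn_leq bmax //= leqNgt; apply/negP => /bf'/eqP.
    by rewrite (negPf sb).
  by case/eqP: ne; congr (_, _) => //; apply: (@perm_inj _ s); rewrite sa' sa.
rewrite ab fix_b len_s eqSS /=; congr (nat_of_bool (_ && _)).
apply/idP/fixes_fromP => [bk x kx|h].
  by apply: bfix; apply: leq_trans kx.
by rewrite ltnNge; apply/negP => /h/eqP; rewrite (negPf sb).
Qed.

(** Decreasing, so that the first letter has the largest top. Reversal turns these words into the
    increasing ones of the Hurwitz numbers and inverts their product, which keeps the length. *)
Definition dec_word k w := [&& valid w, sorted gtn (tops w) & all (fun b => b < k)%N (tops w)].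

(** The bound [k] is what the induction needs: after the letter [(a, b)], the tops of the remaining
    word are bounded by [b]. *)
Lemma jucys_bounded (r k : nat) s :
  wsum r (fun w => nat_of_bool (dec_word k w && (wprod w == s))) =
  (fixes_from k s && (perm_len s == r)) :> nat.
Proof.
elim: r k s => [|r IHr] k s.
  rewrite wsum0 /dec_word /= /wprod big_nil; congr nat_of_bool.
  apply/eqP/andP => [<-|[_ /eqP/perm_len0->//]].
  by rewrite perm_len1; split=> //; apply/fixes_fromP => x _; rewrite perm1.
rewrite wsumS -jucys_step; apply: eq_bigr => -[a b] _ /=.
have [ab|ab] /= := ltnP a b; last by rewrite [LHS]big1 // => w _; rewrite /dec_word /= ltnNge ab.
have [bk|kb] /= := ltnP b k; last first.
  by rewrite [LHS]big1 // => w _; rewrite /dec_word /= [(b < k)%N]ltnNge kb /= !andbF.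
rewrite -IHr; apply: eq_wsum => w _; congr nat_of_bool; rewrite /dec_word /= ab bk /=.
rewrite path_sortedE; last by move=> x y z; rewrite /gtn /=; lia.
have -> : (wprod ((a, b) :: w) == s) = (wprod w == (tperm a b * s)%g).
  rewrite /wprod big_cons; apply/eqP/eqP => [<-|->]; first by rewrite mulgA tperm2 mul1g.
  by rewrite mulgA tperm2 mul1g.
rewrite -[all (fun x => x < b)%N _]/(all (gtn b) (tops w)).
have [hb|_] := boolP (all (gtn b) (tops w)); last by rewrite !andbF.
have -> : all (fun x => x < k)%N (tops w) by apply: sub_all hb => x /= hx; apply: ltn_trans bk.
by rewrite !andbT.
Qed.

Lemma jucys (r : nat) s :
  wsum r (fun w => nat_of_bool [&& valid w, sorted gtn (tops w) & wprod w == s]) =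
  (perm_len s == r) :> nat.
Proof.
have -> : (perm_len s == r) = fixes_from d s && (perm_len s == r).
  case: fixes_fromP => // -[] x; rewrite leqNgt ltn_ord //.
rewrite -jucys_bounded; apply: eq_wsum => w _; congr nat_of_bool.
rewrite /dec_word (_ : all _ (tops w) = true) ?andbT ?andbA //.
by apply/allP => _ /mapP[ab _ ->] /=.
Qed.

End Jucys.

(* Moving the letter at the cut to the other side pairs the nonzero terms: both
   factors hold for no cut, or for exactly two consecutive ones. *)
Lemma dec_inc_alternating (A : comNzRingType) (w : seq nat) :
  \sum_(r < (size w).+1) (-1) ^+ r
    * ((sorted gtn (take r w)) && (sorted leq (drop r w)))%:R = (nilp w)%:R :> A.
Proof.
(* The sum over the cuts that leave a first letter [x] in the decreasing prefix. Its value is the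
   term of the remaining cut, where [x] starts the increasing suffix, and the two cancel. *)
have key x v : \sum_(r < (size v).+1) (-1) ^+ r
    * ((path gtn x (take r v)) && (sorted leq (drop r v)))%:R = (path leq x v)%:R :> A.
  elim: v x => [|y v IHv] x; first by rewrite big_ord1 /= expr0 mul1r.
  rewrite big_ord_recl /= expr0 mul1r.
  under eq_bigr => i _ do rewrite /= exprS mulN1r mulNr.
  rewrite sumrN; have [lt_yx|le_xy] := ltnP y x; rewrite ?lt_yx /=.
    by rewrite IHv subrr.
  by rewrite big1 ?subr0 // => i _; rewrite mulr0.
case: w => [|x w]; first by rewrite big_ord1 /= expr0 mul1r.
rewrite big_ord_recl /= expr0 mul1r.
under eq_bigr => i _ do rewrite /= exprS mulN1r mulNr.
by rewrite sumrN key subrr.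
Qed.

(** * Conjugacy classes, extension by a fixed point, and class sizes *)

Section Conjugacy.
Variable T : finType.
Implicit Types (s t : {perm T}) (X Y : {set T}).
Local Open Scope group_scope.

Lemma ctypeD_orbit s X x : stable s X -> x \in X ->
  perm_eq (#|porbit s x| :: ctype s (X :\: porbit s x)) (ctype s X).
Proof.
move=> sX xX; have sO := stable_porbit_set s x.
have OX : porbit s x \subset X by rewrite stable_porbit.
have {2}-> : X = porbit s x :|: (X :\: porbit s x).
  by rewrite setDE setUIr setUCr setIT; apply/esym/setUidPr.
apply: perm_trans (ctypeU _ _ _) => //.
- by rewrite (ctype_orbit (imset_f _ _)) // perm_refl.
- exact: stableD.
by rewrite disjoint_sym disjoints_subset; apply/subsetP => y; rewrite !inE => /andP[].
Qed.

Lemma ctype_mem s X k : stable s X -> k \in ctype s X ->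
  exists2 x, x \in X & #|porbit s x| = k.
Proof.
move=> sX; rewrite (perm_mem (perm_ctype _ _)) => /imageP[O].
rewrite inE => /andP[/imsetP[x _ ->]]; rewrite stable_porbit // => xX ->.
by exists x.
Qed.

(** One cycle at a time: the cycle of [x] is matched with a cycle of [t] of the same length by
    [(s ^+ i) x |-> (t ^+ i) y], and induction on [#|X|] matches the rest. *)
Lemma ctype_matching s t X Y : stable s X -> stable t Y ->
  perm_eq (ctype s X) (ctype t Y) ->
  exists h : T -> T, [/\ {in X &, injective h}, {in X, forall x, h x \in Y} &
    {in X, forall x, h (s x) = t (h x)}].
Proof.
have [n] := ubnP #|X|; elim: n X Y => // n IHn X Y leX sX tY sXY.
have [->|[x xX]] := set_0Vmem X.
  by exists id; split=> x; rewrite ?inE // => y; rewrite inE.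
have hx := ctypeD_orbit sX xX.
have [y yY cy] : exists2 y, y \in Y & #|porbit t y| = #|porbit s x|.
  by apply: ctype_mem => //; rewrite -(perm_mem sXY) -(perm_mem hx) inE eqxx.
have hy := ctypeD_orbit tY yY.
have sX' : stable s (X :\: porbit s x) by rewrite stableD ?stable_porbit_set.
have tY' : stable t (Y :\: porbit t y) by rewrite stableD ?stable_porbit_set.
have [| |h' [inj' im' eq']] := IHn (X :\: porbit s x) (Y :\: porbit t y) _ sX' tY'.
- rewrite ltnS in leX; apply: leq_trans leX; apply: proper_card; apply/properP; split.
    exact: subsetDl.
  by exists x => //; rewrite !inE porbit_id.
- rewrite -(perm_cons #|porbit s x|) (permPl hx) (permPl sXY) -cy.
  by rewrite perm_sym.
set k := #|porbit s x| in cy.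
pose i z := index z (traject s x k).
have iP z : z \in porbit s x -> (i z < k)%N /\ z = (s ^+ i z) x.
  rewrite porbit_traject -/k => zO; have lt : (i z < k)%N by rewrite /i -index_mem size_traject in zO *.
  by split=> //; rewrite permX -(nth_traject s lt x) nth_index.
have iE j : (j < k)%N -> i ((s ^+ j) x) = j.
  move=> lt; rewrite /i permX -(nth_traject s lt x) index_uniq ?size_traject //.
  exact: uniq_traject_porbit.
have k0 : (0 < k)%N by rewrite lt0n card_porbit_neq0.
pose h z := if z \in porbit s x then (t ^+ i z) y else h' z.
have hO z : z \in porbit s x -> h z \in porbit t y by move=> zO; rewrite /h zO mem_porbit.
have hN z : z \in X -> z \notin porbit s x -> h z \in Y :\: porbit t y.
  by move=> zX zO; rewrite /h (negPf zO) im' // inE zO.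
exists h; split.
- move=> z1 z2 z1X z2X E; have [z1O|z1O] := boolP (z1 \in porbit s x);
  have [z2O|z2O] := boolP (z2 \in porbit s x).
  + move: E; rewrite /h z1O z2O; have [l1 e1] := iP _ z1O; have [l2 e2] := iP _ z2O.
    by move/eqP; rewrite porbit_expg_inj ?cy // => /eqP e; rewrite e1 e2 e.
  + by have := hN _ z2X z2O; rewrite -E inE hO.
  + by have := hN _ z1X z1O; rewrite E inE hO.
  by move: E; rewrite /h (negPf z1O) (negPf z2O) => /inj'; apply; rewrite inE ?z1O ?z2O.
- move=> z zX; have [zO|zO] := boolP (z \in porbit s x).
    by have := hO _ zO; apply/subsetP; rewrite stable_porbit.
  by have := hN _ zX zO; rewrite inE => /andP[].
move=> z zX; have sO : (s z \in porbit s x) = (z \in porbit s x).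
  by have /stableP := stable_porbit_set s x; apply.
rewrite /h sO; case: ifPn => zO; last by rewrite eq' // inE zO.
have [lt e] := iP _ zO; have [lt'|] := ltnP (i z).+1 k.
  by rewrite {1}e -permM -expgSr iE // expgSr permM.
(* The last point of the cycle, where [s] returns to [x] and [t] to [y]. *)
move=> ge; have ek : (i z).+1 = k by apply/eqP; rewrite eqn_leq lt ge.
have sx : s z = x by rewrite {1}e -permM -expgSr ek permX iter_porbit.
rewrite sx -[in RHS]permM -expgSr ek -cy [in RHS]permX iter_porbit.
by have := iE 0%N k0; rewrite expg0 perm1 => ->; rewrite expg0 perm1.
Qed.

End Conjugacy.

Lemma cycle_type_conj d (s t : 'S_d) : cycle_type s = cycle_type t ->
  exists g, t = (s ^ g)%g.
Proof.
rewrite !cycle_typeE => E.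
have [|h [hi _ hE]] := ctype_matching (stableT s) (stableT t); first by rewrite E.
have h_inj : injective h by move=> x y; apply: hi; rewrite inE.
exists (perm h_inj); apply/permP => x; rewrite -[x](permKV (perm h_inj)) permJ.
by rewrite !permE hE ?inE.
Qed.

Section Extension.
Variable d : nat.
Implicit Types s t : 'S_d.
Local Open Scope group_scope.

Definition ext s : 'S_d.+1 := lift_perm ord_max ord_max s.

Lemma ext_lift s j : ext s (lift ord_max j) = lift ord_max (s j).
Proof. exact: lift_perm_lift. Qed.

Lemma ext_max s : ext s ord_max = ord_max.
Proof. exact: lift_perm_id. Qed.

Lemma extM s t : ext (s * t) = ext s * ext t.
Proof. by rewrite /ext lift_permM. Qed.

Lemma ext_inj : injective ext.
Proof.
move=> s t E; apply/permP => j; apply: (@lift_inj _ ord_max).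
by rewrite -!ext_lift E.
Qed.

(** Coset decomposition of ['S_d.+1] by the stabiliser of [ord_max]: [a] is recovered as the
    preimage of [ord_max], and the cardinals agree. *)
Lemma ext_decomp_bij : bijective (fun x : 'I_d.+1 * 'S_d => tperm x.1 ord_max * ext x.2).
Proof.
apply: inj_card_bij => [[a s] [b t] /= E|]; last first.
  by rewrite card_prod !card_Sn card_ord factS.
have ab : a = b.
  apply: (@perm_inj _ (tperm a ord_max * ext s)); rewrite {2}E !permM !tpermL !ext_max //.
rewrite ab in E *; congr (_, _); apply: ext_inj.
exact: (mulgI (tperm b ord_max)).
Qed.

Lemma big_ext (R : Type) (idx : R) (op : Monoid.com_law idx) (F : 'S_d.+1 -> R) :
  \big[op/idx]_(u : 'S_d.+1) F u =
  \big[op/idx]_(a : 'I_d.+1) \big[op/idx]_(s : 'S_d) F (tperm a ord_max * ext s).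
Proof. by rewrite pair_big /= (reindex _ (onW_bij _ ext_decomp_bij)). Qed.

Lemma big_ord_max (R : Type) (idx : R) (op : Monoid.com_law idx) (F : 'I_d.+1 -> R) :
  \big[op/idx]_(a : 'I_d.+1) F a = op (F ord_max) (\big[op/idx]_(j : 'I_d) F (lift ord_max j)).
Proof.
rewrite big_ord_recr /= Monoid.mulmC; congr (op _ _); apply: eq_bigr => j _; congr F.
by apply/val_inj; rewrite /= /bump leqNgt ltn_ord.
Qed.

Lemma porbit_ext_max s : porbit (ext s) ord_max = [set ord_max].
Proof.
apply/setP => x; rewrite inE; apply/porbitP/eqP => [[i ->]|->]; last by exists 0%N; rewrite expg0 perm1.
by elim: i => [|i IHi]; rewrite ?expg0 ?perm1 // expgSr permM IHi ext_max.
Qed.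

Lemma ext_transport s (X : {set 'I_d}) : stable s X ->
  ctype (ext s) (lift ord_max @: X) = ctype s X.
Proof. by apply: ctype_transport => [|x]; [apply: lift_inj | rewrite ext_lift]. Qed.

Lemma setC_lift (X : {set 'I_d}) :
  ~: (lift ord_max @: X :|: [set ord_max]) = lift ord_max @: (~: X) :> {set 'I_d.+1}.
Proof.
apply/setP => x; rewrite !inE; case: (unliftP ord_max x) => [j ->|->].
  by rewrite !mem_imset ?inE; try exact: lift_inj; rewrite eq_sym (negPf (neq_lift _ _)) orbF.
rewrite eqxx orbT /=; apply/esym/imsetP => -[j _] /eqP.
by rewrite (negPf (neq_lift _ _)).
Qed.

Lemma cycle_type_ext s : perm_eq (cycle_type (ext s)) (1%N :: cycle_type s).
Proof.
rewrite !cycle_typeE perm_sym -(permPr (ctypeT_porbit (ext s) ord_max)) porbit_ext_max cards1.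
by rewrite -[X in ~: X]set0U -{1}(imset0 (lift ord_max)) setC_lift setC0 ext_transport ?stableT ?perm_refl.
Qed.

(** The fixed point [ord_max] is joined to the cycle of [j]. *)
Lemma cycle_type_insert s j :
  perm_eq (cycle_type (tperm (lift ord_max j) ord_max * ext s))
    (#|porbit s j|.+1 :: ctype s (~: porbit s j)).
Proof.
have E : porbit (ext s) (lift ord_max j) = lift ord_max @: porbit s j.
  by apply: porbit_transport => x; rewrite ext_lift.
have nb : ord_max \notin porbit (ext s) (lift ord_max j).
  rewrite E; apply/imsetP => -[i _] /eqP.
  by rewrite (negPf (neq_lift _ _)).
rewrite cycle_typeE; apply: perm_trans (ctype_join nb) _.
rewrite porbit_ext_max cards1 E card_imset; last exact: lift_inj.
by rewrite addn1 setC_lift ext_transport ?perm_refl // stableC ?stable_porbit_set.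
Qed.

Lemma cycle_type_porbit s j :
  perm_eq (cycle_type s) (#|porbit s j| :: ctype s (~: porbit s j)).
Proof. by rewrite cycle_typeE perm_sym ctypeT_porbit. Qed.

Lemma card_porbit_count s l :
  #|[set j | #|porbit s j| == l]| = (l * count_mem l (cycle_type s))%N.
Proof.
rewrite cycle_typeE -sum1_card.
rewrite (eq_bigl (fun j => (j \in setT) && (#|porbit s j| == l))); last by move=> j; rewrite !inE.
rewrite (set_partition_big_cond _ (partition_porbits s)) /=.
rewrite (eq_bigr (fun O : {set 'I_d} => if #|O| == l then l else 0%N)); last first.
  move=> O /imsetP[x _ ->]; rewrite (eq_bigl (fun j => (j \in porbit s x) && (#|porbit s x| == l))).
    case: eqP => [<-|_]; last by rewrite big1 // => j; rewrite andbF.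
    by under eq_bigl => j do rewrite andbT; rewrite sum1_card.
  move=> j; case jx : (j \in porbit s x) => //=.
  by move: jx; rewrite -eq_porbit_mem => /eqP->.
have -> : count_mem l (ctype s setT) = (\sum_(k <- ctype s setT) (k == l))%N.
  by rewrite -sum1_count big_mkcond /=; apply: eq_bigr => k _ /=; case: (k == l).
rewrite big_distrr /= (big_ctype _ (fun k => (l * (k == l))%N)); apply: eq_big => O.
  by rewrite inE subsetT andbT.
by case: eqP; rewrite ?muln1 ?muln0.
Qed.

End Extension.

Lemma zee_perm (mu nu : seq nat) : perm_eq mu nu -> zee mu = zee nu.
Proof.
move=> E; rewrite /zee (perm_big _ E); congr (_ * _)%N.
rewrite (perm_big (undup nu)) /=; last by apply: perm_undup; apply: perm_mem.
by apply: eq_bigr => j _; rewrite (seq.permP E).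
Qed.

Lemma zee_cons k (mu : seq nat) : zee (k :: mu) = (k * (count_mem k mu).+1 * zee mu)%N.
Proof.
rewrite /zee big_cons -!mulnA; congr (_ * _)%N; rewrite mulnCA; congr (_ * _)%N.
pose r := undup (k :: mu); have ur : uniq r by apply: undup_uniq.
have kr : k \in r by rewrite mem_undup inE eqxx.
have -> : (\prod_(j <- undup mu) (count_mem j mu)`! = \prod_(j <- r) (count_mem j mu)`!)%N.
  rewrite /r /=; case: ifP => // kmu.
  by rewrite big_cons (count_memPn (negbT kmu)) mul1n.
rewrite !(bigD1_seq k) //= eqxx add1n factS mulnA; congr (_ * _)%N.
by apply: eq_bigr => j jk; rewrite /= [k == j]eq_sym (negPf jk).
Qed.

Lemma zee_gt0 (mu : seq nat) : 0%N \notin mu -> (0 < zee mu)%N.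
Proof.
elim: mu => [|k mu IHmu]; first by rewrite /zee !big_nil.
by rewrite inE negb_or zee_cons eq_sym -lt0n muln_gt0 muln_gt0 /= => /andP[k0 /IHmu z0]; rewrite k0 z0.
Qed.

(** Permutations of ['I_d.+1] are sorted by the length k of the cycle of [ord_max]. Removing
    [ord_max] shows that this class of them has d! / z([rem k nu]) elements. Since z([nu]) is k
    m_k([nu]) times z([rem k nu]), summing over the distinct parts leaves d! times the sum of the k
    m_k([nu]), which is d! (d + 1). The induction changes one part, hence [nu] need not be
    sorted. *)
Lemma card_cycle_type d (nu : seq nat) : 0%N \notin nu -> sumn nu = d ->
  (#|[set s : 'S_d | perm_eq (cycle_type s) nu]| * zee nu)%N = d`!.
Proof.
elim: d nu => [|d IHd] nu nu0 nud.
  have nuE : nu = [::] by case: nu nu0 nud => // k mu; rewrite inE /=; case: k.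
  rewrite nuE /zee !big_nil !muln1 (_ : [set _ | _] = setT) ?cardsT ?card_Sn //.
  apply/setP => s; rewrite !inE; have := sumn_cycle_type s.
  rewrite cycle_typeE; have := intpart_ctype s setT; case: (ctype s setT) => // k mu.
  by rewrite /is_intpart inE /=; case: k; rewrite ?andbF.
(* The length of the cycle of [ord_max] in [u x]. *)
pose kk (x : 'I_d.+1 * 'S_d) := if unlift ord_max x.1 is Some j then #|porbit x.2 j|.+1 else 1%N.
pose u (x : 'I_d.+1 * 'S_d) : 'S_d.+1 := (tperm x.1 ord_max * ext x.2)%g.
pose A k := [set x | (kk x == k) && perm_eq (cycle_type (u x)) nu].
have cA k : k \in nu -> (#|A k| * zee (rem k nu))%N = d`!.
  move=> knu; have : {subset rem k nu <= nu} by apply: mem_rem.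
  move: (rem k nu) (perm_to_rem knu) => nu' nuE sub.
  have nu'0 : 0%N \notin nu' by apply: contra nu0; apply: sub.
  have sum' : sumn nu' = (d.+1 - k)%N.
    by rewrite -nud (perm_sumn nuE) /= addKn.
  have k0 : (0 < k)%N by rewrite lt0n; apply: contraNneq nu0 => <-.
  have kd : (k <= d.+1)%N by rewrite -nud (perm_sumn nuE) leq_addr.
  case: k k0 kd knu nuE nu'0 sum' => // -[_ _|k _ kd] knu nuE nu'0 sum'.
    rewrite -(IHd nu') ?sum' ?subn1 //; congr (_ * _)%N.
    rewrite -[RHS](card_imset _ (f := fun s => (ord_max : 'I_d.+1, s))); last by move=> s t [].
    apply: eq_card => -[a s]; rewrite !inE /kk /u /=.
    apply/andP/imsetP => [[] | [t ht [-> ->]]].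
      case: (unliftP ord_max a) => [j _|-> _]; first by rewrite eqSS (negPf (card_porbit_neq0 _ _)).
      rewrite tperm1 mul1g (permPl (cycle_type_ext s)) (permPr nuE) perm_cons => h.
      by exists s; rewrite ?inE.
    rewrite inE in ht; rewrite unlift_none; split=> //.
    by rewrite tperm1 mul1g (permPl (cycle_type_ext t)) (permPr nuE) perm_cons.
  (* Removing [ord_max] from a cycle of length [k.+2] leaves a permutation of type [k.+1 :: nu']
     with a marked point on a cycle of length [k.+1]. *)
  have IH := IHd (k.+1 :: nu').
  rewrite inE negb_or /= nu'0 sum' in IH; rewrite subSS subnKC // in IH; have {}IH := IH isT erefl.
  rewrite -{}IH zee_cons mulnA; congr (_ * _)%N.
  set C := [set s : 'S_d | _].
  pose f (sj : 'S_d * 'I_d) := (lift (ord_max : 'I_d.+1) sj.2, sj.1).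
  pose B := [set sj : 'S_d * 'I_d | (sj.1 \in C) && (#|porbit sj.1 sj.2| == k.+1)].
  have finj : injective f by move=> [s j] [s' j'] E; have /lift_inj /= -> := congr1 fst E; have /= -> := congr1 snd E.
  have -> : A k.+2 = f @: B.
    apply/setP => -[a s]; rewrite !inE /kk /u /=; apply/andP/imsetP => [[] | [[t j]]].
      case: (unliftP ord_max a) => [j -> |_ //]; rewrite eqSS => cj.
      rewrite (permPl (cycle_type_insert s j)) (permPr nuE) (eqP cj) perm_cons => h.
      exists (s, j); rewrite // !inE /= cj andbT.
      by rewrite (permPl (cycle_type_porbit s j)) (eqP cj) perm_cons.
    rewrite !inE /= => /andP[h cj] [-> ->]; rewrite liftK eqSS; split=> //.
    rewrite (permPl (cycle_type_insert t j)) (permPr nuE) (eqP cj) perm_cons.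
    by move: h; rewrite (permPl (cycle_type_porbit t j)) (eqP cj) perm_cons.
  rewrite card_imset // -sum1_card /B.
  rewrite (eq_bigl (fun sj : 'S_d * 'I_d => (sj.1 \in C) && (#|porbit sj.1 sj.2| == k.+1))); last first.
    by move=> js; rewrite inE.
  rewrite -(pair_big_dep (fun s => s \in C) (fun s j => #|porbit s j| == k.+1) (fun _ _ => 1%N)) /=.
  rewrite (eq_bigr (fun=> k.+1 * (count_mem k.+1 nu').+1)%N) ?sum_nat_const // => s.
  rewrite /C inE => sC; rewrite sum1dep_card card_porbit_count (seq.permP sC) /=.
  by rewrite eqxx add1n.
have -> : #|[set s : 'S_d.+1 | perm_eq (cycle_type s) nu]| = (\sum_(k <- undup nu) #|A k|)%N.
  transitivity (\sum_(s : 'S_d.+1) (perm_eq (cycle_type s) nu : nat))%N.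
    by rewrite -sum1_card big_mkcond /=; apply: eq_bigr => s _; rewrite inE; case: ifP.
  rewrite big_ext pair_big /=.
  under [in RHS]eq_bigr => k _ do rewrite -sum1_card big_mkcond /=.
  rewrite exchange_big /=; apply: eq_bigr => x _.
  have [h|h] := boolP (perm_eq _ _); last first.
    by rewrite big1 // => k _; rewrite inE (negPf h) andbF.
  have kx : kk x \in undup nu.
    rewrite mem_undup -(perm_mem h) /kk /=; case: (unliftP ord_max x.1) => [j|] ->.
      by rewrite (perm_mem (cycle_type_insert _ _)) inE eqxx.
    by rewrite tperm1 mul1g (perm_mem (cycle_type_ext _)) inE eqxx.
  rewrite (bigD1_seq (kk x)) ?undup_uniq //= inE eqxx h big1 // => k nk.
  by rewrite inE eq_sym (negPf nk).
rewrite big_distrl /= (eq_big_seq (fun k => k * count_mem k nu * d`!)%N); last first.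
  move=> k; rewrite mem_undup => knu; rewrite -(cA k knu).
  have nuE := perm_to_rem knu; rewrite (zee_perm nuE) zee_cons (seq.permP nuE) /= eqxx add1n.
  by rewrite mulnCA.
rewrite -big_distrl /= factS -nud; congr (_ * _)%N.
rewrite sumnE -[RHS]big_undup_iterop_count /=; apply: eq_bigr => k _.
by rewrite Monoid.iteropE iter_addn_0 mulnC.
Qed.

(** * Convolution of class functions and monotone Hurwitz numbers *)

Section Convolution.
Variables (K : comNzRingType) (d : nat).
Implicit Types (f g h : 'S_d -> K) (s t : 'S_d).

Definition cnv f g : 'S_d -> K := fun s => \sum_t f t * g (t^-1 * s)%g.
Definition cdelta : 'S_d -> K := fun s => (s == 1%g)%:R.
Definition classfun f := forall s t, f (s ^ t)%g = f s.

Lemma cnvE f g s : cnv f g s = \sum_t f (s * t^-1)%g * g t.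
Proof.
rewrite /cnv (reindex_inj (h := fun t => (s * t^-1)%g)) /=; last by move=> t u /mulgI/invg_inj.
by apply: eq_bigr => t _; rewrite invMg invgK mulgKV.
Qed.

Lemma cnvA f g h : cnv f (cnv g h) = cnv (cnv f g) h.
Proof.
apply/funext => s; rewrite /cnv; under [RHS]eq_bigr => t _ do rewrite mulr_suml.
rewrite exchange_big /=; apply: eq_bigr => t _; rewrite mulr_sumr.
rewrite [RHS](reindex_inj (mulgI t)) /=; apply: eq_bigr => u _.
by rewrite mulKg invMg -!mulgA mulrA.
Qed.

Lemma cnv_delta f : cnv f cdelta = f.
Proof.
apply/funext => s; rewrite /cnv (bigD1 s) //= mulVg /cdelta eqxx mulr1 big1 ?addr0 // => t ts.
rewrite (_ : _ == _ = false) ?mulr0 //; apply/negP => /eqP E.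
by case/eqP: ts; rewrite -[t]mulg1 -E mulKVg.
Qed.

Lemma delta_cnv f : cnv cdelta f = f.
Proof.
apply/funext => s; rewrite /cnv (bigD1 1%g) //= invg1 mul1g /cdelta eqxx mul1r big1 ?addr0 // => t ts.
by rewrite (negPf ts) mul0r.
Qed.

Lemma cnvC f g : classfun g -> cnv f g = cnv g f.
Proof.
move=> gc; apply/funext => s; rewrite [RHS]cnvE; apply: eq_bigr => t _; rewrite mulrC; congr (_ * _).
by rewrite -(gc (t^-1 * s)%g t^-1%g) conjgE invgK -mulgA mulKVg.
Qed.

Lemma cnv_classfun f g : classfun f -> classfun g -> classfun (cnv f g).
Proof.
move=> fc gc s t; rewrite /cnv (reindex_inj (conjg_inj t)) /=; apply: eq_bigr => u _.
by rewrite fc -conjVg -conjMg gc.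
Qed.

Lemma classfun_part f : classfun f -> forall s t, cycle_part s = cycle_part t -> f s = f t.
Proof.
move=> fc s t E; have [|g ->] := @cycle_type_conj _ s t; last by rewrite fc.
by rewrite -!cycle_partE E.
Qed.

Lemma part_classfun (psi : part_of d -> K) : classfun (psi \o @cycle_part d).
Proof. by move=> s t; rewrite /= cycle_partJ. Qed.

End Convolution.

Lemma card_cycle_part d (la : part_of d) :
  (#|[set s : 'S_d | cycle_part s == la]| * zee la)%N = d`!.
Proof.
rewrite -(@card_cycle_type d la); first last.
- by apply/eqP; apply: part_ofP.
- by have := partsP la; case/andP.
congr (_ * _)%N; apply: eq_card => s; rewrite !inE -cycle_partP cycle_typeE.
apply/eqP/idP => [->|h]; first exact: perm_refl.
by apply/esym/ctype_eq; rewrite ?partsP // perm_sym.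
Qed.

Lemma cycle_part_surj d (la : part_of d) : exists s : 'S_d, cycle_part s = la.
Proof.
have : (0 < #|[set s : 'S_d | cycle_part s == la]|)%N.
  by have := card_cycle_part la; case: #|_| => // h; have := fact_gt0 d; rewrite -h.
by rewrite card_gt0 => /set0Pn[s]; rewrite inE => /eqP; exists s.
Qed.

Section ZetaW.
Variables (R : comNzRingType) (d : nat).
Implicit Types (s t : 'S_d).

Definition zetaf s : fps R := fps_mono 1 (perm_len s).
Definition inc_count r s : nat :=
  wsum r (fun w => nat_of_bool [&& valid w, sorted leq (tops w) & wprod w == s]).
Definition wf s : fps R := fun r => (-1) ^+ r * (inc_count r s)%:R.

Lemma zetaf_class : classfun zetaf.
Proof. by move=> s t; rewrite /zetaf perm_lenJ. Qed.

Lemma natr_wsum (A : finType) n (P : seq A -> nat) : (wsum n P)%:R = wsum n (fun w => (P w)%:R) :> R.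
Proof. by rewrite /wsum natr_sum. Qed.

Lemma fps_sumE (I : finType) (P : pred I) (F : I -> fps R) n : (\sum_(i | P i) F i) n = \sum_(i | P i) F i n.
Proof. by elim/big_ind2: _ => // x a y b <- <-. Qed.

Lemma fps_mulE (f g : fps R) n : (f * g) n = \sum_(i < n.+1) f i * g (n - i)%N.
Proof. by []. Qed.

(** By [jucys] both factors are sums over words, and a pair of words is one word with a marked cut.
    The coefficient of a given word is then the sum in [dec_inc_alternating]. *)
Lemma zetaf_wf : cnv zetaf wf = @cdelta _ d.
Proof.
apply/funext => s; apply/funext => n; rewrite /cnv fps_sumE.
under eq_bigr => t _ do rewrite fps_mulE.
rewrite exchange_big /=.
transitivity (\sum_(i < n.+1) (-1) ^+ (n - i) * wsum n (fun w => [&& valid w,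
   sorted gtn (take i (tops w)), sorted leq (drop i (tops w)) & wprod w == s]%:R) : R).
  apply: eq_bigr => i _.
  have in_ : (i <= n)%N by rewrite -ltnS.
  rewrite -[X in _ * wsum X _](subnKC in_) -wsum_cat /wsum mulr_sumr.
  transitivity (\sum_t (wsum i (fun u => nat_of_bool [&& valid u, sorted gtn (tops u) & wprod u == t]))%:R
                 * ((-1) ^+ (n - i) * (inc_count (n - i) (t^-1 * s)%g)%:R) : R).
    apply: eq_bigr => t _; rewrite jucys /wf /zetaf /fps_mono eq_sym.
    by case: eqP; rewrite ?mul1r ?mul0r.
  under eq_bigr => t _ do rewrite natr_wsum /wsum mulr_suml.
  rewrite exchange_big /=; apply: eq_bigr => u _.
  rewrite (bigD1 (wprod u)) //= eqxx andbT [X in _ + X]big1 ?addr0; last first.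
    by move=> t tu; rewrite [_ == t]eq_sym (negPf tu) !andbF mul0r.
  rewrite mulrCA; congr (_ * _); rewrite /inc_count natr_wsum /wsum mulr_sumr; apply: eq_bigr => v _.
  rewrite /valid all_cat /tops map_cat take_size_cat ?drop_size_cat ?size_map ?size_tuple //.
  rewrite -natrM mulnb wprod_cat.
  rewrite (_ : (wprod v == (wprod u)^-1 * s)%g = (wprod u * wprod v == s)%g); last first.
    by apply/eqP/eqP => [->|<-]; rewrite ?mulKVg ?mulKg.
  apply: (congr1 (fun b : bool => b%:R)); rewrite -!andbA; congr (_ && _).
  by rewrite andbCA.
under eq_bigr => i _ do rewrite /wsum mulr_sumr.
rewrite exchange_big /=.
transitivity (\sum_(w : n.-tuple ('I_d * 'I_d)) (-1) ^+ n * ((valid w && (wprod w == s))%:R * (nilp (tops w))%:R) : R).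
  apply: eq_bigr => w _; rewrite -[in RHS](dec_inc_alternating R) size_map size_tuple.
  rewrite [RHS]mulrCA mulr_sumr mulr_sumr; apply: eq_bigr => i _.
  rewrite mulrCA (_ : (-1) ^+ (n - i) = (-1) ^+ n * (-1) ^+ i); last first.
    by rewrite -signr_odd oddB ?signr_addb ?signr_odd // -ltnS.
  rewrite -!mulrA; congr (_ * _); rewrite mulrCA; congr (_ * _).
  rewrite -natrM mulnb; apply: (congr1 (fun b : bool => b%:R)).
  by case: (valid w) => //=; rewrite andbA andbC.
case: n => [|n]; last first.
  rewrite big1; last by move=> w _; rewrite /nilp size_map size_tuple !mulr0.
  by rewrite /cdelta; case: eqP.
rewrite (big_pred1 [tuple]) /= => [|w]; last by apply/esym/eqP; exact: tuple0.
rewrite expr0 mul1r mulr1 /cdelta /wprod big_nil eq_sym.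
by case: eqP.
Qed.

Lemma wf_zetaf : cnv wf zetaf = @cdelta _ d.
Proof. by rewrite cnvC ?zetaf_wf //; apply: zetaf_class. Qed.

(** Monotonicity of words is not invariant under conjugation. But a conjugate of [wf] is again an
    inverse of the class function [zetaf], and inverses are unique. *)
Lemma wf_class : classfun wf.
Proof.
move=> s t; pose w' u := wf (u ^ t)%g.
have E : cnv zetaf w' = @cdelta _ d.
  apply/funext => u; have := congr1 (fun F => F (u ^ t)%g) zetaf_wf.
  rewrite /cdelta conjg_eq1 => <-.
  rewrite /cnv [RHS](reindex_inj (conjg_inj t)) /=; apply: eq_bigr => v _.
  by rewrite zetaf_class /w' conjMg conjVg.
have -> : wf (s ^ t)%g = w' s by [].
by rewrite -[w']delta_cnv -wf_zetaf -cnvA E cnv_delta.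
Qed.

End ZetaW.

Definition psi (R : comAlgType rat) d (Z : pseries (laurent R)) (s : 'S_d) : laurent R :=
  Zcoef Z (cycle_part s).

Section HurwitzKernel.
Variables (R : comAlgType rat) (d : nat).
Local Notation K := (laurent R).
Implicit Types (s t : 'S_d) (la nu : part_of d).

Definition zetaK s : K := laurent_of_fps (zetaf R s).
Definition wK s : K := laurent_of_fps (wf R s).

Lemma zetaKE s : zetaK s = hbar R ^+ perm_len s.
Proof. exact: laurent_of_hbarX. Qed.

Lemma zetaK_class : classfun zetaK.
Proof. by move=> s t; rewrite /zetaK zetaf_class. Qed.

Lemma wK_class : classfun wK.
Proof. by move=> s t; rewrite /wK wf_class. Qed.

Lemma cnv_laurent (f g : 'S_d -> fps R) s :
  laurent_of_fps (cnv f g s) = cnv (fun t => laurent_of_fps (f t)) (fun t => laurent_of_fps (g t)) s.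
Proof. by rewrite /cnv rmorph_sum /=; apply: eq_bigr => t _; rewrite rmorphM. Qed.

Lemma zetaK_wK : cnv zetaK wK = @cdelta _ d.
Proof.
apply/funext => s; rewrite -(cnv_laurent (@zetaf R d) (@wf R d)) zetaf_wf /cdelta.
exact: rmorph_nat.
Qed.

Lemma wK_zetaK : cnv wK zetaK = @cdelta _ d.
Proof. by rewrite cnvC ?zetaK_wK //; apply: zetaK_class. Qed.

Lemma foldr_permcomp s (w : seq ('I_d * 'I_d)) :
  foldr (@permcomp d) s [seq tperm ab.1 ab.2 | ab : 'I_d * 'I_d <- w] = (s * (wprod w)^-1)%g.
Proof.
elim: w => [|ab w IHw] /=; first by rewrite /wprod big_nil invg1 mulg1.
by rewrite /permcomp IHw /wprod big_cons invMg tpermV mulgA.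
Qed.

Lemma hurwitz_countE cmp r la nu :
  hurwitz_count cmp d r la nu =
  (\sum_(s | cycle_part s == la) \sum_(t | cycle_part t == nu)
     wsum r (fun w => nat_of_bool [&& valid w, sorted cmp (tops w) & wprod w == (s * t)%g]))%N.
Proof.
rewrite /hurwitz_count -sum1_card big_mkcond /=.
set H := [set x | _].
transitivity (\sum_s \sum_w \sum_t if (s, w, t) \in H then 1 else 0)%N.
  under [RHS]eq_bigr => s _ do rewrite pair_bigA.
  rewrite pair_bigA (reindex (fun x : 'S_d * (r.-tuple ('I_d * 'I_d) * 'S_d) => (x.1, x.2.1, x.2.2))) //=.
  by exists (fun x => (x.1.1, (x.1.2, x.2))) => [[s [w t]]|[[s w] t]].
rewrite [RHS]big_mkcond /=; apply: eq_bigr => s _.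
rewrite exchange_big /=; case: ifPn => hs; last first.
  by apply: big1 => t _; apply: big1 => w _; rewrite inE cycle_partP (negPf hs).
rewrite [RHS]big_mkcond /=; apply: eq_bigr => t _; case: ifPn => ht; last first.
  by apply: big1 => w _; rewrite inE !cycle_partP (negPf ht) andbF.
apply: eq_bigr => w _; rewrite inE !cycle_partP hs ht /= foldr_permcomp /permcomp.
rewrite -/(valid w) -/(tops w); case: (valid w) => //=; case: (sorted _ _) => //=.
rewrite (_ : (_ == 1)%g = (wprod w == s * t)%g); first by case: eqP.
apply/eqP/eqP => [E|->]; last by rewrite invMg !mulgA mulgV mul1g mulVg.
have Es : (t * (wprod w)^-1 = s^-1)%g by rewrite -[LHS]mulg1 -(mulgV s) mulgA E mul1g.
by apply: invg_inj; rewrite invMg -Es mulKg.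
Qed.

Lemma hurwitz_ltnE r la nu : hurwitz_count ltn d r la nu =
  (\sum_(s | cycle_part s == la) \sum_(t | cycle_part t == nu) (perm_len (s * t)%g == r))%N.
Proof.
rewrite hurwitz_countE; apply: eq_bigr => s _; apply: eq_bigr => t _.
rewrite -perm_lenV -jucys -wsum_rev; apply: eq_wsum => w _; congr nat_of_bool.
rewrite /valid all_rev /tops map_rev rev_sorted wprod_rev; congr [&& _, _ & _].
by rewrite (inv_eq invgK).
Qed.

Lemma hurwitz_leqE r la nu : hurwitz_count leq d r la nu =
  (\sum_(s | cycle_part s == la) \sum_(t | cycle_part t == nu) inc_count r (s * t)%g)%N.
Proof. by rewrite hurwitz_countE. Qed.

Lemma laurent_ratM (q : rat) (f : fps R) :
  laurent_of_fps (fun n => q%:A * f n) = ratK R q * laurent_of_fps f.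
Proof.
apply/laurentP => n; rewrite -[ratK R q]/(laurent_mono q%:A 0) laurent_mono_mull subr0.
by case: n => n //=; rewrite mulr0.
Qed.

Lemma HltE la nu : (0 < d)%N -> laurent_of_fps (Hlt R la nu) =
  ratK R d`!%:R^-1 * \sum_(s | cycle_part s == la) \sum_(t | cycle_part t == nu) zetaK (s * t)%g.
Proof.
move=> d0; rewrite -[X in _ * X]/(\sum_(s | _) \sum_(t | _) laurent_of_fps (zetaf R (s * t)%g)).
under [X in _ * X]eq_bigr => s _ do rewrite -raddf_sum.
rewrite -raddf_sum -laurent_ratM; congr laurent_of_fps; apply/funext => n.
rewrite /Hlt fps_sumE /fps_mono.
transitivity ((d`!%:R^-1 : rat)%:A * (hurwitz_count ltn d n la nu)%:R : R); last first.
  rewrite hurwitz_ltnE fps_sumE natr_sum; congr (_ * _); apply: eq_bigr => s _.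
  rewrite fps_sumE natr_sum; apply: eq_bigr => t _; rewrite /zetaf /fps_mono eq_sym.
  by case: eqP.
have E m : (hurwitz ltn d m la nu)%:A = (d`!%:R^-1 : rat)%:A * (hurwitz_count ltn d m la nu)%:R :> R.
  by rewrite /hurwitz mulrC -scalerA mulr_algl scaler_nat.
have [nd|dn] := ltnP n d.
  rewrite (bigD1 (Ordinal nd)) //= eqxx E big1 ?addr0 // => i.
  by rewrite -val_eqE eq_sym /= => /negPf->.
(* Truncating [Hlt] at [d] loses nothing: no permutation of [d] points has length [d] or more. *)
rewrite big1 => [|i _]; last by case: eqP => // E'; have := ltn_ord i; rewrite -E' ltnNge dn.
suff -> : hurwitz_count ltn d n la nu = 0%N by rewrite mulr0.
rewrite hurwitz_ltnE big1 // => s _; apply: big1 => t _.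
by rewrite (ltn_eqF (leq_trans (perm_len_lt _ d0) dn)).
Qed.

Lemma HleE la nu : laurent_of_fps (Hle R la nu) =
  ratK R d`!%:R^-1 * \sum_(s | cycle_part s == la) \sum_(t | cycle_part t == nu) wK (s * t)%g.
Proof.
rewrite -[X in _ * X]/(\sum_(s | _) \sum_(t | _) laurent_of_fps (wf R (s * t)%g)).
under [X in _ * X]eq_bigr => s _ do rewrite -raddf_sum.
rewrite -raddf_sum -laurent_ratM; congr laurent_of_fps; apply/funext => n.
rewrite /Hle /hurwitz mulrC [X in X *: _]mulrC -scalerA scaler_nat mulr_algl -scalerAl.
congr (_ *: _); rewrite mulrC hurwitz_leqE fps_sumE natr_sum mulr_sumr; apply: eq_bigr => s _.
by rewrite fps_sumE natr_sum mulr_sumr.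
Qed.

(** The factor [zee la] / d! is the inverse size of the class [la], so the right-hand side is the
    average over this class of a convolution, which is constant on it. *)
Lemma kernel_relation (k : 'S_d -> K) (psi1 psi2 : part_of d -> K) : classfun k ->
  (forall la, psi1 la = (zee la)%:R * \sum_nu
     (ratK R d`!%:R^-1 * \sum_(s | cycle_part s == la) \sum_(t | cycle_part t == nu) k (s * t)%g) * psi2 nu)
  <-> psi1 \o @cycle_part d = cnv (psi2 \o @cycle_part d) k.
Proof.
move=> kc.
have E la s0 : cycle_part s0 = la -> (zee la)%:R * \sum_nu
     (ratK R d`!%:R^-1 * \sum_(s | cycle_part s == la) \sum_(t | cycle_part t == nu) k (s * t)%g) * psi2 nu
   = cnv (psi2 \o @cycle_part d) k s0.
  move=> s0la.
  transitivity ((zee la)%:R * (ratK R d`!%:R^-1 * \sum_(s | cycle_part s == la) cnv (psi2 \o @cycle_part d) k s)).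
    congr (_ * _); under eq_bigr => nu _ do rewrite -mulrA.
    rewrite -mulr_sumr; congr (_ * _); under eq_bigr => nu _ do rewrite mulr_suml.
    rewrite exchange_big /=; apply: eq_bigr => s _.
    transitivity (\sum_t psi2 (cycle_part t) * k (s * t)%g).
      rewrite [RHS](partition_big (@cycle_part d) xpredT) //=; apply: eq_bigr => nu _.
      by rewrite mulr_suml; apply: eq_bigr => t /eqP->; rewrite mulrC.
    (* A permutation and its inverse have the same type; conjugation by [s] exchanges [s * t] and
       [t * s]. *)
    rewrite /cnv (reindex_inj invg_inj) /=; apply: eq_bigr => t _.
    rewrite cycle_partV; congr (_ * _); rewrite -(kc _ s) conjgE.
    by rewrite -mulgA mulKg.
  rewrite (eq_bigr (fun=> cnv (psi2 \o @cycle_part d) k s0)); last first.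
    move=> s /eqP sla; apply: classfun_part; last by rewrite sla s0la.
    by apply: cnv_classfun => //; apply: part_classfun.
  rewrite sumr_const -[cnv _ _ _ *+ _]mulr_natl mulrA mulrA -(ratK_nat R (zee la)) -ratK_nat -!rmorphM /=.
  rewrite [X in ratK R X](_ : _ = 1) ?rmorph1 ?mul1r //.
  rewrite (_ : #|_| = #|[set s : 'S_d | cycle_part s == la]|); last by apply: eq_card => s; rewrite inE.
  rewrite mulrAC -natrM mulnC card_cycle_part divff //.
  by rewrite pnatr_eq0 -lt0n fact_gt0.
split=> [h|h la].
  by apply/funext => s; rewrite /= h (E _ s).
by have [s sla] := cycle_part_surj la; rewrite (E _ s) // -h /= sla.
Qed.

Variables Z1 Z2 : pseries K.

Lemma Hlt_relationE : (0 < d)%N -> Hlt_relation Z1 Z2 d <-> psi Z1 = cnv (psi Z2) zetaK.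
Proof.
move=> d0; apply: iff_trans (kernel_relation (fun la => Zcoef Z1 la) (fun la => Zcoef Z2 la) zetaK_class).
by split=> h la; rewrite h; congr (_ * _); apply: eq_bigr => nu _; rewrite HltE.
Qed.

Lemma Hle_relationE : Hle_relation Z1 Z2 d <-> psi Z2 = cnv (psi Z1) wK.
Proof.
apply: iff_trans (kernel_relation (fun la => Zcoef Z2 la) (fun la => Zcoef Z1 la) wK_class).
by split=> h la; rewrite h; congr (_ * _); apply: eq_bigr => nu _; rewrite HleE.
Qed.

Lemma Hlt_Hle : (0 < d)%N -> Hlt_relation Z1 Z2 d <-> Hle_relation Z1 Z2 d.
Proof.
move=> d0; rewrite Hlt_relationE // Hle_relationE; split=> ->.
  by rewrite -cnvA zetaK_wK cnv_delta.
by rewrite -cnvA wK_zetaK cnv_delta.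
Qed.

End HurwitzKernel.

(** * Partitioned permutations *)

Section PartitionLattice.
Variable d : nat.
Implicit Types A B C D : {set {set 'I_d}}.
Implicit Types i j k : 'I_d.

Definition is_part A := partition A [set: 'I_d].

Lemma mem_part A i : is_part A -> i \in pblock A i.
Proof. by move=> pA; rewrite mem_pblock (cover_partition pA). Qed.

Lemma part_pblock A i : is_part A -> pblock A i \in A.
Proof. by move=> pA; rewrite pblock_mem // (cover_partition pA). Qed.

Lemma part_def A X i : is_part A -> X \in A -> i \in X -> pblock A i = X.
Proof. by move=> pA XA iX; apply: def_pblock => //; apply: partition_trivIset pA. Qed.

Lemma part_eq A i j : is_part A -> j \in pblock A i -> pblock A i = pblock A j.
Proof.
move=> pA; rewrite -eq_pblock ?(cover_partition pA) ?inE //; first by move/eqP.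
exact: partition_trivIset pA.
Qed.

Lemma part_sym A i j : is_part A -> j \in pblock A i -> i \in pblock A j.
Proof. by move=> pA h; rewrite -(part_eq pA h) mem_part. Qed.

Lemma part_exists A X : is_part A -> X \in A -> exists i, X = pblock A i.
Proof.
move=> pA XA; have /set0Pn[i iX] := partition_neq0 pA XA.
by exists i; rewrite (part_def pA XA iX).
Qed.

(** Partitions are compared through the relation [j \in pblock A i], for which refinement is
    inclusion. *)
Lemma refinesP A B : is_part A -> is_part B ->
  reflect (forall i j, j \in pblock A i -> j \in pblock B i) (refines A B).
Proof.
move=> pA pB; apply: (iffP forall_inP) => h.
  move=> i j ji; have /exists_inP[Y YB /subsetP sub] := h _ (part_pblock i pA).
  by rewrite (part_def pB YB (sub _ (mem_part i pA))) sub.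
move=> X XA; have [i ->] := part_exists pA XA.
by apply/exists_inP; exists (pblock B i); rewrite ?part_pblock //; apply/subsetP => j; apply: h.
Qed.

Lemma refines_refl A : is_part A -> refines A A.
Proof. by move=> pA; apply/refinesP. Qed.

Lemma refines_trans A B C : is_part A -> is_part B -> is_part C ->
  refines A B -> refines B C -> refines A C.
Proof. by move=> pA pB pC /refinesP AB /refinesP BC; apply/refinesP => // i j /AB h; apply: BC => //; apply: h. Qed.

Lemma refines_sub A B : is_part A -> is_part B -> refines A B -> refines B A -> A \subset B.
Proof.
move=> pA pB /(refinesP pA pB) AB /(refinesP pB pA) BA; apply/subsetP => X XA.
have [i ->] := part_exists pA XA; rewrite (_ : pblock A i = pblock B i) ?part_pblock //.
by apply/setP => j; apply/idP/idP => [/AB|/BA].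
Qed.

Lemma refines_anti A B : is_part A -> is_part B -> refines A B -> refines B A -> A = B.
Proof. by move=> *; apply/eqP; rewrite eqEsubset !refines_sub. Qed.

Definition pjoin A B := equivalence_partition
  (connect (fun i j => (j \in pblock A i) || (j \in pblock B i))) [set: 'I_d].

Section Join.
Variables A B : {set {set 'I_d}}.
Hypotheses (pA : is_part A) (pB : is_part B).
Let e i j := (j \in pblock A i) || (j \in pblock B i).

Let e_eqv : {in [set: 'I_d] & &, equivalence_rel (connect e)}.
Proof.
have cs : connect_sym e.
  apply: sym_connect_sym => u v; rewrite /e.
  by apply/orP/orP => -[] h; [left|right|left|right]; apply: part_sym.
move=> x y z _ _ _; split; first exact: connect0.
move=> xy; apply/idP/idP; last exact: connect_trans.
by apply: connect_trans; rewrite cs.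
Qed.

Lemma pjoin_part : is_part (pjoin A B).
Proof. exact: equivalence_partitionP e_eqv. Qed.

Lemma mem_pjoin i j : (j \in pblock (pjoin A B) i) = connect e i j.
Proof. by rewrite pblock_equivalence_partition ?inE. Qed.

Lemma pjoin_l : refines A (pjoin A B).
Proof.
apply/(refinesP pA pjoin_part) => i j ij; rewrite mem_pjoin; apply: connect1.
by rewrite /e ij.
Qed.

Lemma pjoin_r : refines B (pjoin A B).
Proof.
apply/(refinesP pB pjoin_part) => i j ij; rewrite mem_pjoin; apply: connect1.
by rewrite /e ij orbT.
Qed.

Lemma pjoin_min D : is_part D -> refines A D -> refines B D -> refines (pjoin A B) D.
Proof.
move=> pD /(refinesP pA pD) AD /(refinesP pB pD) BD.
apply/(refinesP pjoin_part pD) => i j; rewrite mem_pjoin => /connectP[p].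
elim: p i => [|k p IHp] i /= => [_ ->|/andP[ik /IHp h] /h jk]; first exact: mem_part.
suff ik' : k \in pblock D i by rewrite (part_eq pD ik').
by case/orP: ik => [/AD|/BD].
Qed.

(** The join exists and is unique, so [psconv] is the convolution of a monoid, with product
    [ps_mul], and inherits its associativity. *)
Lemma is_joinE C : is_join A B C = (C == pjoin A B).
Proof.
apply/idP/eqP => [/and4P[pC AC BC /forallP h]|->].
  apply: (refines_anti pC pjoin_part) (pjoin_min pC AC BC).
  by apply: (implyP (h (pjoin A B))); apply/and3P; split; [apply: pjoin_part|apply: pjoin_l|apply: pjoin_r].
apply/and4P; split; [exact: pjoin_part|exact: pjoin_l|exact: pjoin_r|].
apply/forallP => D; apply/implyP.
by case/and3P; apply: pjoin_min.
Qed.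

Lemma refines_pjoin D : is_part D -> refines (pjoin A B) D = refines A D && refines B D.
Proof.
move=> pD; apply/idP/andP => [h|[AD BD]]; last exact: pjoin_min.
by split; apply: refines_trans h => //; [apply: pjoin_part|apply: pjoin_l|apply: pjoin_part|apply: pjoin_r].
Qed.

End Join.

Lemma pjoinA A B C : is_part A -> is_part B -> is_part C ->
  pjoin A (pjoin B C) = pjoin (pjoin A B) C.
Proof.
move=> pA pB pC; have pAB := pjoin_part pA pB; have pBC := pjoin_part pB pC.
have p1 := pjoin_part pA pBC; have p2 := pjoin_part pAB pC.
apply: refines_anti => //; rewrite !refines_pjoin //.
  have h := refines_refl p2; rewrite !refines_pjoin // in h.
  by case/andP: h => /andP[-> ->] ->.
have h := refines_refl p1; rewrite !refines_pjoin // in h.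
by case/andP: h => -> /andP[-> ->].
Qed.

Lemma porbits_part (s : 'S_d) : is_part (porbits s).
Proof. exact: partition_porbits. Qed.

Lemma pblock_porbits (s : 'S_d) i : pblock (porbits s) i = porbit s i.
Proof. by apply: (part_def (porbits_part s)); rewrite ?imset_f ?porbit_id. Qed.

Lemma refines_porbitsP (s : 'S_d) A : is_part A ->
  reflect (forall X, X \in A -> stable s X) (refines (porbits s) A).
Proof.
move=> pA; apply: (iffP (refinesP (porbits_part s) pA)) => [h X XA|h i j].
  have key i : s i \in pblock A i.
    by apply: h; rewrite pblock_porbits; have := mem_porbit s 1 i; rewrite expg1.
  apply/stableP => i; apply/idP/idP => iX.
    by rewrite -(part_def pA XA iX); apply: part_sym.
  by rewrite -(part_def pA XA iX).
rewrite pblock_porbits; have sX := h _ (part_pblock i pA).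
by apply/subsetP; rewrite stable_porbit // mem_part.
Qed.

Lemma porbits1_refines A : is_part A -> refines (porbits (1 : 'S_d)%g) A.
Proof. by move=> pA; apply/refines_porbitsP => // X _; apply/stableP => i; rewrite perm1. Qed.

Lemma pjoin1 A : is_part A -> pjoin (porbits (1 : 'S_d)%g) A = A.
Proof.
move=> pA; have p1 := porbits_part (1 : 'S_d)%g.
apply: refines_anti => //; try exact: pjoin_part; last exact: pjoin_r.
by rewrite refines_pjoin // porbits1_refines // refines_refl.
Qed.

End PartitionLattice.

Section PSMonoid.
Variable d : nat.
Implicit Types x y z : PS d.

Lemma PS_part x : is_part x.1.
Proof. by case: x => x /= /andP[]. Qed.

Lemma PS_refines x : refines (porbits x.2) x.1.
Proof. by case: x => x /= /andP[]. Qed.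

Fact ps_mul_subproof x y : is_PS (pjoin x.1 y.1, permcomp x.2 y.2).
Proof.
have pj := pjoin_part (PS_part x) (PS_part y).
apply/andP; split=> //; apply/refines_porbitsP => // X XJ.
have h1 : refines (porbits x.2) (pjoin x.1 y.1).
  by apply: refines_trans (PS_refines x) (pjoin_l _ _); rewrite ?porbits_part ?PS_part.
have h2 : refines (porbits y.2) (pjoin x.1 y.1).
  by apply: refines_trans (PS_refines y) (pjoin_r _ _); rewrite ?porbits_part ?PS_part.
by apply: stableM; [move/(refines_porbitsP _ pj): h2 | move/(refines_porbitsP _ pj): h1]; apply.
Qed.

Definition ps_mul x y : PS d := PPerm (ps_mul_subproof x y).

Fact ps_one_subproof : is_PS (porbits (1 : 'S_d)%g, 1%g).
Proof. by apply/andP; split; [apply: porbits_part | apply: refines_refl; apply: porbits_part]. Qed.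

Definition ps_one : PS d := PPerm ps_one_subproof.

Lemma ps_mulA x y z : ps_mul x (ps_mul y z) = ps_mul (ps_mul x y) z.
Proof.
apply/val_inj => /=; congr (_, _); first by rewrite pjoinA // PS_part.
by rewrite /permcomp mulgA.
Qed.

Lemma ps_mul1 x : ps_mul ps_one x = x.
Proof.
apply/val_inj; rewrite /= pjoin1 ?PS_part // /permcomp mulg1.
by case: x => -[].
Qed.

Lemma ps_join_eq x y z : is_join x.1 y.1 z.1 && (permcomp x.2 y.2 == z.2) = (ps_mul x y == z).
Proof. by rewrite is_joinE ?PS_part // eq_sym -[RHS]val_eqE. Qed.

Variable K : comNzRingType.
Implicit Types f g h : PS d -> K.

Lemma psconvE f g z : psconv f g z = \sum_x \sum_(y | ps_mul x y == z) f x * g y.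
Proof. by apply: eq_bigr => x _; apply: eq_bigl => y; rewrite ps_join_eq. Qed.

Lemma psconvA f g h z : psconv f (psconv g h) z = psconv (psconv f g) h z.
Proof.
rewrite !psconvE.
transitivity (\sum_x \sum_y \sum_(w | ps_mul x (ps_mul y w) == z) f x * g y * h w).
  apply: eq_bigr => x _.
  transitivity (\sum_(v | ps_mul x v == z) \sum_y \sum_(w | ps_mul y w == v) f x * g y * h w).
    apply: eq_bigr => v _; rewrite psconvE mulr_sumr; apply: eq_bigr => y _.
    by rewrite mulr_sumr; apply: eq_bigr => w _; rewrite mulrA.
  rewrite exchange_big /=; apply: eq_bigr => y _.
  rewrite [RHS](partition_big (ps_mul y) (fun v => ps_mul x v == z)) //=; apply: eq_bigr => v vz.
  by apply: eq_bigl => w; case: eqP => [->|]; rewrite ?vz ?andbF.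
transitivity (\sum_x \sum_y \sum_v \sum_(w | (ps_mul v w == z) && (ps_mul x y == v)) f x * g y * h w).
  apply: eq_bigr => x _; apply: eq_bigr => y _.
  rewrite [RHS](bigD1 (ps_mul x y)) //= [X in _ + X]big1 ?addr0.
    by apply: eq_bigl => w; rewrite eqxx andbT ps_mulA.
  by move=> v ne; apply: big_pred0 => w; rewrite [_ == v]eq_sym (negPf ne) andbF.
under eq_bigr => x _ do rewrite exchange_big.
rewrite exchange_big /=; apply: eq_bigr => v _.
under [RHS]eq_bigr => w _ do rewrite psconvE mulr_suml.
rewrite [RHS]exchange_big /=; apply: eq_bigr => x _.
under [RHS]eq_bigr => w _ do rewrite mulr_suml.
rewrite [RHS]exchange_big /= [RHS]big_mkcond /=; apply: eq_bigr => y _.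
case: eqP => _; last by apply: big_pred0 => w; rewrite andbF.
by apply: eq_bigl => w; rewrite andbT.
Qed.

Lemma delta_psconv f z : psconv (@psdelta K d) f z = f z.
Proof.
rewrite psconvE (bigD1 ps_one) //= [X in _ + X]big1 ?addr0; last first.
  move=> x nx; apply: big1 => y _; rewrite /psdelta [_ && _](_ : _ = false) ?mul0r //.
  by apply: contraNF nx => /andP[/eqP x1 /eqP x2]; apply/eqP/val_inj; rewrite /= -x1 -x2; case: (x) => -[].
rewrite (big_pred1 z) => [|y]; last by rewrite ps_mul1.
by rewrite /psdelta !eqxx mul1r.
Qed.

End PSMonoid.

Section ZetaMuInverse.
Variables (R : comAlgType rat) (d : nat).
Variables (Phi1 Phi2 : forall d : nat, PS d -> fps R) (mu : forall d : nat, PS d -> fps R).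

Lemma zeta_mu_relation : is_psmu mu -> (0 < d)%N ->
  zeta_relation Phi1 Phi2 d <-> mu_relation mu Phi1 Phi2 d.
Proof.
move=> hmu d0; have [zm mz] := hmu d d0; split=> h z.
  rewrite -[LHS]delta_psconv.
  transitivity (psconv (psconv (@mu d) (@pszeta R d)) (@Phi2 d) z).
    by rewrite !psconvE; apply: eq_bigr => x _; apply: eq_bigr => y _; rewrite mz.
  rewrite -psconvA !psconvE; apply: eq_bigr => x _; apply: eq_bigr => y _.
  by rewrite h.
rewrite -[LHS]delta_psconv.
transitivity (psconv (psconv (@pszeta R d) (@mu d)) (@Phi1 d) z).
  by rewrite !psconvE; apply: eq_bigr => x _; apply: eq_bigr => y _; rewrite zm.
rewrite -psconvA !psconvE; apply: eq_bigr => x _; apply: eq_bigr => y _.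
by rewrite h.
Qed.

End ZetaMuInverse.

(** * The moment-cumulant formula *)

Section SubsetCount.
Variables (T : finType) (s : {perm T}).
Implicit Types S U X : {set T}.

Definition stable_sub S (mu : seq nat) :=
  [set U : {set T} | [&& U \subset S, stable s U & perm_eq (ctype s U) mu]].

Lemma ctypeD S U : stable s S -> stable s U -> U \subset S ->
  perm_eq (ctype s U ++ ctype s (S :\: U)) (ctype s S).
Proof.
move=> sS sU US.
have {2}-> : S = U :|: (S :\: U) by rewrite setDE setUIr setUCr setIT; apply/esym/setUidPr.
apply: ctypeU => //; first exact: stableD.
by rewrite disjoint_sym disjoints_subset; apply/subsetP => y; rewrite !inE => /andP[].
Qed.

(** The count is a product of binomial coefficients, one for each cycle length k: m_k([mu]) cycles
    are chosen among m_k([mu]) + m_k([nu]). The proof is Pascal's rule: the cycle [O] of a chosen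
    point lies in [U] or in its complement. *)
Lemma card_stable_sub S (mu nu : seq nat) : stable s S -> perm_eq (mu ++ nu) (ctype s S) ->
  (#|stable_sub S mu| * (zee mu * zee nu) = zee (ctype s S))%N.
Proof.
have [n] := ubnP #|S|; elim: n S mu nu => // n IHn S mu nu leS sS munu.
have [S0|[x xS]] := set_0Vmem S.
  move: munu; rewrite S0 ctype0 => /perm_nilP; case: mu => [|//]; case: nu => [|//] _.
  rewrite /zee !big_nil !muln1 (_ : stable_sub _ _ = [set set0]) ?cards1 //.
  apply/setP => U; rewrite !inE subset0; case: eqP => // ->.
  by rewrite stable0 ctype0.
set O := porbit s x; set S' := S :\: O; pose k := #|O|.
have sO : stable s O by apply: stable_porbit_set.
have sS' : stable s S' by apply: stableD.
have hS : perm_eq (k :: ctype s S') (ctype s S) by apply: ctypeD_orbit.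
have OS : O \subset S by rewrite stable_porbit.
have ltS' : (#|S'| < n)%N.
  rewrite ltnS in leS; apply: leq_trans leS; apply: proper_card; apply/properP; split.
    exact: subsetDl.
  by exists x => //; rewrite !inE porbit_id.
have munu' := perm_trans munu (etrans (perm_sym _ _) hS).
have cnt : (count_mem k mu + count_mem k nu = (count_mem k (ctype s S')).+1)%N.
  by rewrite -count_cat (seq.permP munu') /= eqxx.
(* The case of [O] outside the subset: [O] accounts for one part [k] of [be], and the count is zero
   if there is none. *)
have key1 (al be : seq nat) : perm_eq (al ++ be) (k :: ctype s S') ->
    (#|stable_sub S' al| * (zee al * zee be) = k * count_mem k be * zee (ctype s S'))%N.
  move=> albe; have [kbe|kbe] := boolP (k \in be).
    have bE := perm_to_rem kbe; rewrite (zee_perm bE) zee_cons (seq.permP bE) /= eqxx add1n.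
    rewrite -(IHn S' al (rem k be) ltS' sS').
      by rewrite [(zee al * _)%N]mulnCA mulnCA.
    rewrite -(perm_cons k) -(permPr albe); apply: perm_trans (_ : perm_eq (al ++ k :: rem k be) _).
      by rewrite perm_sym -cat1s perm_catCA.
    by rewrite perm_cat2l perm_sym.
  rewrite (count_memPn kbe) muln0 mul0n; apply/eqP; rewrite muln_eq0 cards_eq0; apply/orP; left.
  apply/eqP/setP => U; rewrite !inE; apply/negP => /and3P[US' sU hU].
  have := seq.permP (ctypeD sS' sU US') (pred1 k); rewrite count_cat (seq.permP hU).
  have := seq.permP albe (pred1 k); rewrite count_cat (count_memPn kbe) /= eqxx; lia.
have notin U : stable s U -> (U \subset S) && (x \notin U) = (U \subset S').
  move=> sU; rewrite subsetD; congr (_ && _); apply/idP/idP => [xU|].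
    rewrite disjoint_sym disjoints_subset stable_porbit ?inE //.
    exact: stableC.
  by rewrite disjoint_sym disjoints_subset => /subsetP/(_ x (porbit_id _ _)); rewrite inE.
have SDK (V : {set T}) : V \subset S -> S :\: (S :\: V) = V.
  by move=> VS; rewrite setDDr setDv set0U; apply/setIidPr.
have split : #|stable_sub S mu| = (#|stable_sub S' nu| + #|stable_sub S' mu|)%N.
  rewrite -(cardsID [set U : {set T} | x \in U]); congr (_ + _)%N; last first.
    apply: eq_card => U; rewrite !inE.
    have [sU|] := boolP (stable s U); last by rewrite !andbF.
    by rewrite andbA [(x \notin U) && _]andbC notin.
  (* A subset containing [O] is counted through its complement, which has type [nu] and lies in
     [S']. *)
  rewrite -(card_in_imset (f := fun U => S :\: U) (D := mem (stable_sub S' nu))).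
    apply: eq_card => U; rewrite !inE; apply/andP/imsetP.
      case=> /and3P[US sU hU] xU; exists (S :\: U); last by rewrite SDK.
      rewrite inE stableD // -notin ?stableD // subsetDl !inE xU /=.
      by rewrite -(perm_cat2l mu) (permPr munu) -(permPr (ctypeD sS sU US)) perm_cat2r perm_sym.
    case=> V; rewrite inE => /and3P[VS' sV hV] ->.
    have /andP[VS xV] : (V \subset S) && (x \notin V) by rewrite notin.
    rewrite subsetDl stableD //= !inE xV xS; split=> //.
    rewrite -(perm_cat2r nu) (permPr munu) -(permPr (ctypeD sS sV VS)).
    by rewrite perm_catC perm_cat2r perm_sym.
  move=> U V; rewrite !inE => /and3P[US' sU _] /and3P[VS' sV _] E.
  have US : U \subset S by apply: subset_trans US' (subsetDl _ _).
  have VS : V \subset S by apply: subset_trans VS' (subsetDl _ _).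
  by rewrite -(SDK _ US) E SDK.
rewrite split mulnDl (key1 mu nu munu') [X in (_ * X + _)%N]mulnC (key1 nu mu); last first.
  by rewrite perm_catC.
by rewrite -(zee_perm hS) zee_cons -cnt -mulnDl -mulnDr.
Qed.
End SubsetCount.

Section PartitionSums.
Variables (T : finType) (K : comNzRingType).
Implicit Types (S U : {set T}) (A : {set {set T}}).

(** Both sides run over the partitions of [S] with a marked block [U]. *)
Lemma sum_partition_block (G : {set T} -> {set {set T}} -> K) S :
  \sum_(U : {set T} | (U \subset S) && (U != set0)) \sum_(A | partition A (S :\: U)) G U A =
  \sum_(A | partition A S) \sum_(U in A) G U (A :\ U).
Proof.
rewrite [RHS](exchange_big_dep xpredT) //= big_mkcond /=; apply: eq_bigr => U _.
case: ifPn => [/andP[US U0]|hU]; last first.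
  rewrite big_pred0 // => A; apply/negP => /andP[pA UA]; case/negP: hU.
  by rewrite (partitionS pA UA) (partition_neq0 pA UA).
rewrite [RHS](reindex_onto (fun A => U |: A) (fun A => A :\ U)) /=; last first.
  by move=> A /andP[_ UA]; rewrite setD1K.
have UnA A : partition A (S :\: U) -> U \notin A.
  move=> pA; apply: contra U0 => UA; have := partitionS pA UA.
  rewrite subsetD => /andP[_]; rewrite -setI_eq0 setIid //.
apply: eq_big => [A|A pA]; last by rewrite setU1K // UnA.
apply/idP/idP => [pA|/andP[/andP[pA _] /eqP E]].
  rewrite setU1K ?UnA // eqxx setU11 !andbT.
  have := partitionU1 pA U0; rewrite setDE setUIr setUCr setIT (setUidPr US); apply.
  by rewrite disjoint_sym disjoints_subset; apply/subsetP => y; rewrite !inE => /andP[].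
by rewrite -E; apply: partitionD1 => //; rewrite setU11.
Qed.

Lemma card_partition_le A S : partition A S -> (#|A| <= #|S|)%N.
Proof.
move=> pA; rewrite (card_partition pA) -sum1_card; apply: leq_sum => X XA.
by rewrite card_gt0 (partition_neq0 pA).
Qed.

End PartitionSums.

Section MomentCumulant.
Variables (R : comAlgType rat) (T : finType) (s : {perm T}).
Local Notation K := (laurent R).
Implicit Types (f g : pseries K) (S U : {set T}) (A : {set {set T}}).

(* The value of Z on the restriction of s to S; sets on which s does not act get the
   junk value 0, which makes the sums over all subsets below correct. *)
Definition hat f S : K := if stable s S then Zcoef f (ctypeP s S) else 0.

(** By [card_stable_sub], the normalisation of [Zcoef] turns each pair of types in a product of
    series into a sum over the splittings of the cycles of [S] with these types. *)
Lemma hat_pmul f g S : stable s S ->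
  hat (pmul f g) S = \sum_(U : {set T} | U \subset S) hat f U * hat g (S :\: U).
Proof.
move=> sS; rewrite /hat sS.
set la := ctypeP s S; have laS : sumn la = #|S| by apply: sumn_ctype.
have cntK (mu nu : seq nat) : perm_eq (mu ++ nu) la ->
    qmono R (zee la)%:R (sumn la)%:Z =
    \sum_(U in stable_sub s S mu) (qmono R (zee mu)%:R (sumn mu)%:Z * qmono R (zee nu)%:R (sumn nu)%:Z).
  move=> h; rewrite sumr_const qmonoM -PoszD -sumn_cat (perm_sumn h).
  rewrite !qmonoE -mulrnAl; congr (_ * _); rewrite -raddfMn /=; congr (ratK R _).
  by rewrite -natrM -mulrnA mulnC card_stable_sub.
rewrite /Zcoef -/la /pmul mulr_sumr.
transitivity (\sum_(a < (sumn la).+1) \sum_(mu : part_of a) \sum_(nu : part_of (sumn la - a) | perm_eq (mu ++ nu) la)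
   \sum_(U : {set T} | (U \subset S) && stable s U) if perm_eq (ctype s U) mu then Zcoef f (ctypeP s U) * Zcoef g (ctypeP s (S :\: U)) else 0).
  apply: eq_bigr => a _; rewrite mulr_sumr; apply: eq_bigr => mu _; rewrite mulr_sumr; apply: eq_bigr => nu munu.
  rewrite (cntK mu nu munu) mulr_suml -big_mkcondr /=; apply: eq_big => U; rewrite !inE ?andbA // => /andP[/andP[US sU] hU].
  have muE : ctypeP s U = mu by apply/val_inj/esym/ctype_eq; rewrite ?partsP // perm_sym.
  have nuE : ctypeP s (S :\: U) = nu.
    apply/val_inj/esym/ctype_eq; first exact: partsP.
    rewrite -(perm_cat2l mu) (permPl munu) -(permPl (ctypeD sS sU US)) perm_sym.
    by rewrite -[parts mu]/(parts (part_val mu)) -muE perm_refl.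
  by rewrite /Zcoef muE nuE mulrACA.
under eq_bigr => a _ do (under eq_bigr => mu _ do rewrite exchange_big; rewrite exchange_big).
rewrite exchange_big /= big_mkcondr /=; apply: eq_bigr => U US.
have [sU|_] := boolP (stable s U); last by rewrite mul0r.
rewrite stableD //; set X := _ * _.
have aU : (#|U| < (sumn la).+1)%N by rewrite ltnS laS subset_leq_card.
(* Given [U], the indices [a], [mu] and [nu] can only be its size, its type and the type of its
   complement. *)
rewrite (bigD1 (Ordinal aU)) //= [X in _ + X]big1 ?addr0; last first.
  move=> a; rewrite -val_eqE /= => na; apply: big1 => mu _; apply: big1 => nu _; case: ifP => // h.
  by case/eqP: na; rewrite -(sumn_ctype sU) (perm_sumn h) (eqP (part_ofP mu)).
have muP : sumn (ctypeP s U) == #|U| by rewrite sumn_ctype.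
have nuP : sumn (ctypeP s (S :\: U)) == (sumn la - #|U|)%N.
  by rewrite laS sumn_ctype ?stableD // cardsD (setIidPr US).
rewrite (bigD1 (PartOf muP)) //= [X in _ + X]big1 ?addr0; last first.
  move=> mu nmu; apply: big1 => nu _; case: ifP => // h; case/eqP: nmu.
  by apply/val_inj/val_inj/ctype_eq; rewrite ?partsP // perm_sym.
rewrite (bigD1 (PartOf nuP)) /=; last exact: ctypeD.
rewrite perm_refl big1 ?addr0 // => nu /andP[h nnu]; case/eqP: nnu.
apply/val_inj/val_inj/ctype_eq; first exact: partsP.
by rewrite -(perm_cat2l (ctype s U)) (permPl h) -(permPl (ctypeD sS sU US)) perm_refl.
Qed.

Variable F : pseries K.
Hypothesis F0 : F (ctypeP s set0) = 0.

Lemma hat_set0 : hat F set0 = 0.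
Proof. by rewrite /hat /Zcoef F0 mulr0 if_same. Qed.

(** Each new factor marks a block. A partition into [k.+1] blocks can be marked in [k.+1] ways, and
    this builds up the factorial that the exponential divides out. *)
Lemma hat_ppow k S : stable s S ->
  hat (ppow F k) S = k`!%:R * \sum_(A | partition A S && (#|A| == k)) \prod_(X in A) hat F X.
Proof.
elim: k S => [|k IHk] S sS.
  rewrite mul1r /hat sS /ppow /= /Zcoef /pone.
  have [->|S0] := eqVneq S set0.
    rewrite /= ctype0 mulr1 /zee !big_nil qmono1 (big_pred1 set0).
      by rewrite big_set0.
    by move=> A; rewrite partition_set0 cards_eq0 andbb.
  rewrite [nilp _](_ : _ = false) ?mulr0.
    rewrite big_pred0 // => A; rewrite cards_eq0; case: eqP => [->|]; rewrite ?andbF // andbT.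
    by rewrite /partition /cover big_set0 eq_sym (negPf S0).
  apply: contraNF S0 => /nilP h; rewrite -cards_eq0 -(sumn_ctype sS).
  by rewrite -[ctype s S]/(parts (ctypeP s S)) h.
rewrite [LHS](hat_pmul _ _ sS).
transitivity (k`!%:R * \sum_(U : {set T} | (U \subset S) && (U != set0))
   \sum_(A | partition A (S :\: U)) (if #|A| == k then hat F U * \prod_(X in A) hat F X else 0)).
  rewrite mulr_sumr [RHS]big_mkcondr /=; apply: eq_bigr => U US.
  have [->|U0] := eqVneq U set0; first by rewrite hat_set0 mul0r.
  have [sU|nU] := boolP (stable s U); last first.
    have -> : hat F U = 0 by rewrite /hat (negPf nU).
    by rewrite mul0r big1 ?mulr0 // => A _; rewrite mul0r if_same.
  rewrite IHk ?stableD // mulrCA -big_mkcondr /=; congr (_ * _); rewrite mulr_sumr.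
  by apply: eq_bigr.
rewrite sum_partition_block factS mulnC natrM -mulrA; congr (_ * _).
rewrite mulr_sumr [RHS]big_mkcondr /=; apply: eq_bigr => A pA.
have [cA|cA] := eqVneq #|A| k.+1; last first.
  apply: big1 => U UA; rewrite ifF //; apply: contraNF cA => /eqP cU.
  by rewrite (cardsD1 U) UA cU.
rewrite -cA -sum1_card natr_sum mulr_suml; apply: eq_bigr => U UA.
have -> : #|A :\ U| = k by move: cA; rewrite (cardsD1 U) UA => -[].
rewrite eqxx mul1r [RHS](bigD1 U) //=; congr (_ * _); apply: eq_bigl => X.
by rewrite !inE andbC.
Qed.

Lemma moment_cumulant S : stable s S ->
  hat (pexp F) S = \sum_(A | partition A S) \prod_(X in A) hat F X.
Proof.
move=> sS; rewrite /hat sS /Zcoef /pexp mulr_sumr.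
transitivity (\sum_(k < #|S|.+1) \sum_(A | partition A S && (#|A| == k)) \prod_(X in A) hat F X).
  rewrite -(sumn_ctype sS); apply: eq_bigr => k _; rewrite mulrCA.
  have := hat_ppow k sS; rewrite /hat sS /Zcoef => ->.
  rewrite mulrA [X in X * _](_ : _ = 1) ?mul1r //.
  rewrite qmonoE mulr1 -ratK_nat -rmorphM /= mulVf ?rmorph1 //.
  by rewrite pnatr_eq0 -lt0n fact_gt0.
(* A partition of [S] has at most [#|S|] blocks, in agreement with the truncation in [pexp]. *)
rewrite [RHS](partition_big (fun A : {set {set T}} => inord #|A| : 'I_#|S|.+1) xpredT) //=.
apply: eq_bigr => k _; apply: eq_bigl => A; apply: andb_id2l => pA.
rewrite -val_eqE /= inordK // ltnS; exact: card_partition_le.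
Qed.

End MomentCumulant.

(** * Sums that factor over the blocks of a partition *)

Section BlockProducts.
Variables (d : nat) (K : comNzRingType).
Implicit Types (A C : {set {set 'I_d}}) (B X : {set 'I_d}) (s t : 'S_d).
Variable C : {set {set 'I_d}}.
Hypothesis pC : is_part C.

Let blockE B i : B \in C -> (i \in B) = (pblock C i == B).
Proof.
move=> BC; apply/idP/eqP => [iB|<-]; first by rewrite (part_def pC BC iB).
exact: mem_part.
Qed.

(** A partition refining [C] is an independent choice of a partition of each block; [glue] and [cut]
    are inverse bijections once families are set to [set0] off [C]. *)
Lemma prod_sum_partitions (u : {set 'I_d} -> K) :
  \sum_(A | is_part A && refines A C) \prod_(X in A) u X =
  \prod_(B in C) \sum_(A | partition A B) \prod_(X in A) u X.
Proof.
rewrite (big_distr_big_dep set0) /=.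
pose glue (f : {ffun {set 'I_d} -> {set {set 'I_d}}}) := \bigcup_(B in C) f B.
pose cut A := [ffun B : {set 'I_d} => if B \in C then [set X in A | X \subset B] else set0].
have glueK A : is_part A && refines A C -> glue (cut A) = A.
  case/andP=> pA /forall_inP AC; apply/setP => X; apply/bigcupP/idP => [[B BC]|XA].
    by rewrite ffunE BC inE => /andP[].
  by have /exists_inP[B BC XB] := AC X XA; exists B => //; rewrite ffunE BC inE XA.
have cut_family A : is_part A && refines A C ->
    cut A \in pfamily set0 (mem C) (fun B => [pred A | partition A B]).
  case/andP=> pA AC; apply/pfamilyP; split=> [|B BC].
    by apply/subsetP => B; rewrite !inE ffunE; case: ifP => //; rewrite eqxx.
  rewrite inE ffunE BC; apply/and3P; split.
  - rewrite eqEsubset; apply/andP; split; first by apply/bigcupsP => X; rewrite inE => /andP[].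
    apply/subsetP => i iB; apply/bigcupP; exists (pblock A i); last exact: mem_part.
    rewrite inE part_pblock //=; apply/subsetP => j ij; move: iB; rewrite !blockE //.
    by rewrite (part_eq pC ((refinesP pA pC AC) _ _ ij)).
  - apply/trivIsetP => X Y; rewrite !inE => /andP[XA _] /andP[YA _].
    by have /trivIsetP := partition_trivIset pA; apply.
  by rewrite inE (partition0 pA).
have cutK f : f \in pfamily set0 (mem C) (fun B => [pred A | partition A B]) ->
    is_part (glue f) && refines (glue f) C /\ cut (glue f) = f.
  move=> /pfamilyP[/subsetP f0 fC].
  have fP B : B \in C -> partition (f B) B by move=> BC; have := fC B BC; rewrite inE.
  have sub B X : B \in C -> X \in f B -> X \subset B by move=> BC; apply: partitionS (fP B BC).
  have uniqB B B' X : B \in C -> B' \in C -> X \in f B -> X \subset B' -> B = B'.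
    move=> BC B'C XB XB'; have /set0Pn[i iX] := partition_neq0 (fP B BC) XB.
    have := subsetP XB' i iX; have := subsetP (sub _ _ BC XB) i iX.
    by rewrite !blockE // => /eqP-> /eqP.
  split; last first.
    apply/ffunP => B; rewrite ffunE; case: ifPn => BC; last first.
      by apply/esym/eqP; apply: contraNT BC => fB; apply: f0; rewrite inE.
    apply/setP => X; rewrite inE; apply/andP/idP => [[/bigcupP[B' B'C XB'] XB]|XB].
      by rewrite -(uniqB _ _ _ B'C BC XB' XB).
    by split; [apply/bigcupP; exists B | apply: sub XB].
  apply/andP; split; last first.
    apply/forall_inP => X /bigcupP[B BC XB]; apply/exists_inP; exists B => //; exact: sub XB.
  apply/and3P; split.
  - rewrite eqEsubset subsetT; apply/subsetP => i _; apply/bigcupP.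
    have BC := part_pblock i pC; have pB := fP _ BC.
    have : i \in cover (f (pblock C i)) by rewrite (cover_partition pB) mem_part.
    by case/bigcupP => X XB iX; exists X => //; apply/bigcupP; exists (pblock C i).
  - apply/trivIsetP => X Y /bigcupP[B BC XB] /bigcupP[B' B'C YB'] nXY.
    have [EB|nB] := eqVneq B B'.
      rewrite -EB in YB'; have /trivIsetP := partition_trivIset (fP B BC); exact.
    have /trivIsetP/(_ _ _ BC B'C nB) := partition_trivIset pC.
    by apply: disjointW; apply: sub; eassumption.
  by apply/bigcupP => -[B BC]; rewrite (partition0 (fP B BC)).
rewrite (reindex_onto glue cut) //=; apply: eq_big => [f|f /andP[hf /eqP cf]].
  apply/andP/idP => [[h /eqP <-]|hf]; first exact: cut_family.
  by have [h1 h2] := cutK f hf; rewrite h1 h2.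
have ff : f \in pfamily set0 (mem C) (fun B => [pred A | partition A B]).
  by rewrite -cf; apply: cut_family.
move/pfamilyP: (ff) => [_ fC].
transitivity (\prod_(B in C) \prod_(X in glue f | X \subset B) u X); last first.
  apply: eq_bigr => B BC; apply: eq_bigl => X; rewrite -{2}cf ffunE BC !inE //.
pose bl X := if [pick i in X] is Some i then pblock C i else set0.
rewrite (partition_big bl (mem C)) /=; last first.
  move=> X Xf; rewrite /bl; case: pickP => [i _|n0]; first exact: part_pblock.
  have /andP[pg _] := hf; have /set0Pn[i iX] := partition_neq0 pg Xf.
  by have := n0 i; rewrite iX.
apply: eq_bigr => B BC; apply: eq_bigl => X; apply: andb_id2l => Xf.
have /andP[pg gC] := hf.
have [i0 i0X] := set0Pn _ (partition_neq0 pg Xf).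
rewrite /bl; case: pickP => [i iX|n0]; last by have := n0 i0; rewrite i0X.
rewrite /= in iX; have /exists_inP[B' B'C XB'] := forall_inP gC X Xf.
apply/eqP/idP => [<-|XB]; last by apply: part_def => //; apply: (subsetP XB).
by rewrite (part_def pC B'C (subsetP XB' i iX)).
Qed.

(** A permutation preserving every block of [C] is a family of permutations, one supported on each
    block. On the left [G B] reads the whole permutation, on the right only its part on [B], whence
    the locality hypothesis. *)
Lemma prod_sum_perms (G : {set 'I_d} -> 'S_d -> K) :
  (forall B s t, B \in C -> stable s B -> stable t B -> {in B, s =1 t} -> G B s = G B t) ->
  \sum_(s | refines (porbits s) C) \prod_(B in C) G B s =
  \prod_(B in C) \sum_(s | perm_on B s) G B s.
Proof.
move=> Gloc; rewrite (big_distr_big_dep (1 : 'S_d)%g) /=.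
pose gfun (f : {ffun {set 'I_d} -> 'S_d}) := [ffun x => f (pblock C x) x].
(* The default value is not reached on [fam]: there the glued map preserves each block, so it is
   injective. *)
pose glue (f : {ffun {set 'I_d} -> 'S_d}) : 'S_d := insubd (1 : 'S_d)%g (gfun f).
pose cut s := [ffun B : {set 'I_d} => if B \in C then restr_perm B s else 1%g].
pose fam := pfamily (1 : 'S_d)%g (mem C) (fun B => [pred s | perm_on B s]).
have glueE f : f \in fam -> forall x, glue f x = f (pblock C x) x.
  move=> /pfamilyP[_ fC] x.
  have fP y : perm_on (pblock C y) (f (pblock C y)) by have := fC _ (part_pblock y pC); rewrite inE.
  have inj : injectiveb (gfun f).
    apply/injectiveP => y z; rewrite !ffunE => E.
    suff Eyz : pblock C y = pblock C z by move: E; rewrite Eyz => /perm_inj.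
    have := perm_closed y (fP y); rewrite mem_part // E => hy.
    have := perm_closed z (fP z); rewrite mem_part // => hz.
    exact: etrans (part_eq pC hy) (esym (part_eq pC hz)).
  have E : val (glue f) = gfun f by rewrite /glue insubdK.
  have -> : f (pblock C x) x = gfun f x by rewrite ffunE.
  rewrite -E; exact: (congr1 (fun g : _ -> _ => g x) (esym (pvalE (glue f)))).
have restrE s B x : stable s B -> x \in B -> restr_perm B s x = s x.
  by move=> /stableP sB xB; rewrite restr_permE //; apply/astabsP => y; rewrite /= /aperm sB.
have stabB s B : refines (porbits s) C -> B \in C -> stable s B.
  by move/(refines_porbitsP _ pC); apply.
have cut_family s : refines (porbits s) C -> cut s \in fam.
  move=> sC; apply/pfamilyP; split=> [|B BC].
    by apply/subsetP => B; rewrite !inE ffunE; case: ifP => //; rewrite eqxx.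
  by rewrite inE ffunE BC restr_perm_on.
have glueK s : refines (porbits s) C -> glue (cut s) = s.
  move=> sC; apply/permP => x; rewrite glueE ?cut_family // ffunE part_pblock //.
  by rewrite restrE ?mem_part ?stabB ?part_pblock.
have glue_agree f B : f \in fam -> B \in C -> {in B, glue f =1 f B}.
  by move=> ff BC x xB; rewrite glueE // (part_def pC BC xB).
have fam_stable f B : f \in fam -> B \in C -> stable (f B) B.
  move=> /pfamilyP[_ fC] BC; have := fC B BC; rewrite inE => h.
  by apply/stableP => x; apply: perm_closed.
have glue_stable f B : f \in fam -> B \in C -> stable (glue f) B.
  move=> ff BC; apply/stableP => x; have [xB|xB] := boolP (x \in B).
    by rewrite (glue_agree f B ff BC x xB) (stableP _ _ (fam_stable f B ff BC)).
  rewrite glueE //; apply: contraNF xB => h; have BxC := part_pblock x pC.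
  have := stableP _ _ (fam_stable _ _ ff BxC) x; rewrite mem_part // => hx.
  by rewrite -(part_def pC BC h) (part_def pC BxC hx) mem_part.
have cutK f : f \in fam -> cut (glue f) = f.
  move=> ff; apply/ffunP => B; rewrite ffunE; move/pfamilyP: (ff) => [/subsetP f1 fC].
  case: ifPn => BC; last first.
    by apply/esym/eqP; apply: contraNT BC => fB; apply: f1; rewrite inE.
  have := fC B BC; rewrite inE => onB; apply/permP => x.
  have [xB|xB] := boolP (x \in B); last by rewrite !(out_perm _ xB) // restr_perm_on.
  by rewrite restrE ?glue_stable // (glue_agree f B ff BC x xB).
rewrite (reindex_onto glue cut) //=; apply: eq_big => [f|f /andP[hf /eqP cf]].
  apply/andP/idP => [[h /eqP <-]|ff]; first exact: cut_family.
  rewrite cutK //; split=> //; apply/(refines_porbitsP _ pC) => X XC; exact: glue_stable.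
have ff : f \in fam by rewrite -cf; apply: cut_family.
by apply: eq_bigr => B BC; apply: Gloc => //; rewrite ?glue_stable ?fam_stable //; apply: glue_agree.
Qed.

End BlockProducts.

Section Restriction.
Variables (d : nat) (B : {set 'I_d}).
Implicit Types s t : 'S_d.

Lemma restrE s i : stable s B -> enum_val (restr B s i) = s (enum_val i).
Proof.
move=> /stableP sB; have iB := enum_valP i.
have E : restr_perm B s (enum_val i) = s (enum_val i).
  by rewrite restr_permE //; apply/astabsP => y; rewrite /= /aperm sB.
by rewrite permE /restr_fun enum_rankK_in E // sB.
Qed.

Lemma restr_agree s t : stable s B -> stable t B -> {in B, s =1 t} -> restr B s = restr B t.
Proof. by move=> sB tB st; apply/permP => i; apply: enum_val_inj; rewrite !restrE // st ?enum_valP. Qed.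

Lemma restrM s t : stable s B -> stable t B -> restr B (s * t)%g = (restr B s * restr B t)%g.
Proof.
move=> sB tB; apply/permP => i; apply: enum_val_inj.
by rewrite restrE ?stableM // !permM !restrE.
Qed.

Lemma restrV s : stable s B -> restr B s^-1%g = (restr B s)^-1%g.
Proof.
move=> sB; apply: (mulIg (restr B s)); rewrite mulVg -restrM ?stableV // mulVg.
by apply/permP => i; apply: enum_val_inj; rewrite restrE ?perm1 //; apply/stableP => x; rewrite perm1.
Qed.

Lemma cycle_type_restr s : stable s B -> cycle_type (restr B s) = ctype s B.
Proof.
move=> sB; rewrite cycle_typeE -(@ctype_transport _ _ (enum_val (A := B)) (restr B s) s).
- congr ctype; apply/setP => x; apply/imsetP/idP => [[i _ ->]|xB]; first exact: enum_valP.
  by exists (enum_rank_in xB x); rewrite // enum_rankK_in.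
- exact: enum_val_inj.
- by move=> i; rewrite restrE.
exact: stableT.
Qed.

Lemma perm_on_stable s : perm_on B s -> stable s B.
Proof. by move=> h; apply/stableP => x; apply: perm_closed. Qed.

Lemma restr_inj : {in [set s : 'S_d | perm_on B s] &, injective (restr B)}.
Proof.
move=> s t; rewrite !inE => sB tB E; apply/permP => x.
have [xB|xB] := boolP (x \in B); last by rewrite !(out_perm _ xB).
have := congr1 (fun p : 'S_#|B| => enum_val (p (enum_rank_in xB x))) E.
by rewrite /= !restrE ?perm_on_stable // enum_rankK_in.
Qed.

Lemma restr_bij : [set restr B s | s in [set s : 'S_d | perm_on B s]] = setT.
Proof.
apply/eqP; rewrite eqEcard subsetT card_in_imset; last exact: restr_inj.
by rewrite cardsT card_Sn leq_eqVlt -(card_perm B); apply/orP; left; apply/eqP; apply: eq_card => s; rewrite !inE.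
Qed.

Lemma sum_restr (V : nmodType) (H : 'S_#|B| -> V) :
  \sum_s H s = \sum_(s : 'S_d | perm_on B s) H (restr B s).
Proof.
rewrite -(eq_bigl _ _ (in_setT (T := _))) -restr_bij big_imset /=; last exact: restr_inj.
by apply: eq_bigl => s; rewrite inE.
Qed.

End Restriction.

Section Mobius.
Variables (d : nat) (K : zmodType) (u1 u2 : PS d -> K).

(* Moebius inversion on the partition lattice, by induction on the number of pairs of
   points lying in a common block. *)
Lemma part_sum_inj :
  (forall C (s : 'S_d), is_part C -> refines (porbits s) C ->
     \sum_(z : PS d | (z.2 == s) && refines z.1 C) u1 z =
     \sum_(z : PS d | (z.2 == s) && refines z.1 C) u2 z) -> u1 =1 u2.
Proof.
move=> h z.
pose r (A : {set {set 'I_d}}) := [set ij : 'I_d * 'I_d | ij.2 \in pblock A ij.1].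
have [n] := ubnP #|r z.1|; elim: n z => // n IHn z; rewrite ltnS => lez.
have := h z.1 z.2 (PS_part z) (PS_refines z).
have Pz : (z.2 == z.2) && refines z.1 z.1 by rewrite eqxx refines_refl ?PS_part.
rewrite (bigD1 z) //= [in RHS](bigD1 z) //=.
rewrite (eq_bigr u2); first by move/addIr.
move=> y /andP[/andP[/eqP y2 yz] ny]; apply: IHn; apply: leq_trans lez.
apply: proper_card; rewrite properE; apply/andP; split.
  apply/subsetP => -[i j]; rewrite !inE; exact: (refinesP (PS_part y) (PS_part z) yz).
apply: contra ny => /subsetP zy; apply/eqP/val_inj.
have : refines z.1 y.1.
  by apply/(refinesP (PS_part z) (PS_part y)) => i j ij; have := zy (i, j); rewrite !inE; apply.
move=> /(refines_anti (PS_part y) (PS_part z) yz).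
by case: (y) (z) y2 => -[yA ya] ? [[zA za] ?] /= -> ->.
Qed.

End Mobius.

(** * From relations between partitioned permutations to Hurwitz relations and back *)

Section PartitionedRelations.
Variables (R : comAlgType rat) (d : nat).
Local Notation K := (laurent R).
Implicit Types (s t : 'S_d) (C : {set {set 'I_d}}).

(** Multiplicativity reduces this to one block, where the prefactor in [associated] is the inverse
    of the one in [Zcoef]. *)
Lemma Phi_hat (f : pseries K) (Phi : forall d, PS d -> fps R) (z : PS d) :
  associated f Phi -> (0 < d)%N ->
  laurent_of_fps (Phi d z) = \prod_(B in z.1) hat z.2 f B.
Proof.
case=> [[_ mP]] aP d0; rewrite mP // rmorph_prod; apply: eq_bigr => B Bz.
have sB : stable z.2 B by have /(refines_porbitsP _ (PS_part z)) := PS_refines z; apply.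
have B0 : (0 < #|B|)%N by rewrite card_gt0 (partition_neq0 (PS_part z)).
have := aP #|B| (cycle_part (restr B z.2)) (restr B z.2) B0 (esym (cycle_partE _)).
have E : part_val (cycle_part (restr B z.2)) = ctypeP z.2 B.
  by apply/val_inj; rewrite /= -cycle_typeE cycle_type_restr.
rewrite E => fE; rewrite /hat sB /Zcoef fE mulrA qmonoM (sumn_ctype sB) subrr.
rewrite mulfV ?qmono1 ?mul1r // pnatr_eq0 -lt0n zee_gt0 //.
by have /andP[] := intpart_ctype z.2 B.
Qed.

Lemma sum_PS (f : pseries K) (Phi : forall d, PS d -> fps R) C s :
  associated f Phi -> (0 < d)%N -> f (IntPart (isT : is_intpart [::])) = 0 ->
  is_part C -> refines (porbits s) C ->
  \sum_(z : PS d | (z.2 == s) && refines z.1 C) laurent_of_fps (Phi d z) =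
  \prod_(B in C) hat s (pexp f) B.
Proof.
move=> aP d0 f0 pC sC.
have f0' : f (ctypeP s set0) = 0.
  by rewrite -f0; congr f; apply/val_inj; rewrite /= ctype0.
transitivity (\prod_(B in C) \sum_(A | partition A B) \prod_(X in A) hat s f X); last first.
  apply: eq_bigr => B BC; rewrite moment_cumulant //.
  by have /(refines_porbitsP _ pC) := sC; apply.
rewrite -prod_sum_partitions //.
under eq_bigr => z _ do rewrite (Phi_hat z aP d0).
transitivity (\sum_(A | (is_part A && refines A C) && is_PS (A, s)) \prod_(X in A) hat s f X).
  rewrite (reindex_onto (fun A => insubd (ps_one d) (A, s)) (fun z : PS d => z.1)) /=.
    apply: eq_big => [A|A /andP[/andP[/eqP A2 _] /eqP A1]]; last by rewrite A2 A1.
    apply/idP/idP => [/andP[/andP[/eqP A2 AC] /eqP A1]|/andP[/andP[_ AC] hPS]].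
      have := ps_pairP (insubd (ps_one d) (A, s)); move: AC; rewrite A1.
      have -> : ps_pair (insubd (ps_one d) (A, s)) = (A, s).
        by move: A1 A2; case: (ps_pair _) => /= ? ? -> ->.
      by move=> refAC h; rewrite h refAC !andbT; case/andP: h.
    by rewrite -[ps_pair _]/(val _) insubdK //= !eqxx AC.
  move=> z /andP[/eqP z2 _]; apply/val_inj; rewrite insubdK /= -?z2; first by case: (z) => -[].
  by rewrite /= -surjective_pairing; apply: ps_pairP.
(* A partition that is not above the cycles of [s] has an unstable block, on which [hat] is 0. *)
rewrite [RHS](bigID (fun A => is_PS (A, s))) /= [X in _ + X]big1 ?addr0 // => A.
case/andP=> /andP[pA AC]; rewrite /is_PS /= -/(is_part A) pA /= => /forall_inPn[O Os].
case/imsetP: Os => x _ -> nx.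
rewrite (bigD1 (pblock A x)) ?part_pblock //= /hat ifN ?mul0r //.
apply: contra nx => sx; apply/exists_inP; exists (pblock A x); rewrite ?part_pblock //.
by rewrite stable_porbit // mem_part.
Qed.

End PartitionedRelations.

Section PartitionedRelations.
Variables (R : comAlgType rat).
Local Notation K := (laurent R).
Local Notation nilpart := (IntPart (isT : is_intpart [::])).

Lemma hatT d (Z : pseries K) (s : 'S_d) : hat s Z setT = psi Z s.
Proof.
rewrite /hat stableT /psi; congr Zcoef; apply/val_inj.
Qed.

Lemma hat_restr d (Z : pseries K) (s : 'S_d) B : stable s B -> hat s Z B = psi Z (restr B s).
Proof.
move=> sB; rewrite /hat sB /psi; congr Zcoef; apply/val_inj => /=.
by rewrite -cycle_typeE cycle_type_restr.
Qed.

Lemma one_block_part d : is_part (one_block d).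
Proof. by have /andP[] := PS_one_subproof (1 : 'S_d)%g. Qed.

Lemma one_blockE d : (0 < d)%N -> one_block d = [set [set: 'I_d]].
Proof.
move=> d0; rewrite /one_block; apply/setP => X; rewrite !inE; case: eqP => //= ->.
by apply/esym/negP => /eqP /setP/(_ (Ordinal d0)); rewrite !inE.
Qed.

Lemma refines_one d (A : {set {set 'I_d}}) : (0 < d)%N -> is_part A -> refines A (one_block d).
Proof.
move=> d0 pA; apply/forall_inP => X _; apply/exists_inP; exists setT; rewrite ?subsetT //.
by rewrite one_blockE // inE.
Qed.

(** The length of the restriction of [s] to [B]: it makes [zetaK] factor over the blocks of a
    partition preserved by [s]. *)
Definition block_len d (s : 'S_d) B := (\sum_(k <- ctype s B) k.-1)%N.

Lemma perm_len_block d (s : 'S_d) : perm_len s = block_len s setT.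
Proof.
rewrite /block_len (big_ctype _ (fun k => k.-1)) /=.
have E : (\sum_(O in orbits_in s setT) #|O|.-1 + #|orbits_in s setT| = d)%N.
  rewrite -sum1_card -big_split /= -[RHS]card_ord -cardsT.
  rewrite (card_partition (orbits_in_partition (stableT s))); apply: eq_bigr => O.
  by rewrite inE => /andP[/imsetP[x _ ->] _]; rewrite addn1 prednK // lt0n card_porbit_neq0.
have -> : perm_len s = (d - #|orbits_in s setT|)%N.
  by rewrite /perm_len; congr (_ - _)%N; apply: eq_card => O; rewrite inE subsetT andbT.
by rewrite -{1}E addnK.
Qed.

Lemma block_len_sum d (s : 'S_d) C : is_part C -> refines (porbits s) C ->
  perm_len s = (\sum_(B in C) block_len s B)%N.
Proof.
move=> pC sC; rewrite perm_len_block /block_len (big_ctype _ (fun k => k.-1)) /=.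
under [RHS]eq_bigr => B _ do rewrite (big_ctype _ (fun k => k.-1)) /=.
have stB B : B \in C -> stable s B by have /(refines_porbitsP _ pC) := sC; apply.
rewrite (exchange_big_dep (fun O => O \in orbits_in s setT)) /=.
  apply: eq_bigr => O OT; move: (OT); rewrite inE => /andP[/imsetP[x _ Ox] _].
  rewrite (big_pred1 (pblock C x)) // => B; rewrite inE.
  have [BC|BC] /= := boolP (B \in C); last first.
    by apply/esym/eqP => E; rewrite E part_pblock in BC.
  rewrite Ox imset_f //= stable_porbit ?stB //.
  by apply/idP/eqP => [xB|->]; [rewrite (part_def pC BC xB) | apply: mem_part].
by move=> B O BC; rewrite !inE => /andP[-> _]; rewrite subsetT.
Qed.

Section Degree.
Variable d : nat.
Hypothesis d0 : (0 < d)%N.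
Variables (f1 f2 : pseries K) (Phi1 Phi2 : forall d, PS d -> fps R).
Hypotheses (a1 : associated f1 Phi1) (a2 : associated f2 Phi2).
Hypotheses (f10 : f1 nilpart = 0) (f20 : f2 nilpart = 0).
Implicit Types (s t : 'S_d).

(** A join refines [C] exactly when both arguments do, so the two factors separate. Of the first,
    [pszeta] keeps only the pairs [(porbits t, t)]; the sum over the second is given by [sum_PS]. *)
Lemma sum_psconv_zeta C s : is_part C -> refines (porbits s) C ->
  \sum_(z : PS d | (z.2 == s) && refines z.1 C) laurent_of_fps (psconv (@pszeta R d) (@Phi2 d) z) =
  \sum_(t : 'S_d | refines (porbits t) C) zetaK R t * \prod_(B in C) hat (s * t^-1)%g (pexp f2) B.
Proof.
move=> pC sC.
pose mk t : PS d := PPerm (introT andP (conj (porbits_part t) (refines_refl (porbits_part t))) : is_PS (porbits t, t)).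
have mkK : cancel mk (fun x : PS d => x.2) by [].
transitivity (\sum_(z : PS d | (z.2 == s) && refines z.1 C)
   \sum_x \sum_(y | ps_mul x y == z) laurent_of_fps (pszeta R x) * laurent_of_fps (@Phi2 d y)).
  apply: eq_bigr => z _; rewrite psconvE rmorph_sum; apply: eq_bigr => x _.
  by rewrite rmorph_sum; apply: eq_bigr => y _; rewrite rmorphM.
rewrite exchange_big /=.
transitivity (\sum_(x : PS d) \sum_(y : PS d | (permcomp x.2 y.2 == s) && (refines x.1 C && refines y.1 C))
   laurent_of_fps (pszeta R x) * laurent_of_fps (@Phi2 d y)).
  apply: eq_bigr => x _.
  rewrite [RHS](partition_big (ps_mul x) (fun z : PS d => (z.2 == s) && refines z.1 C)) /=.
    apply: eq_bigr => z /andP[z2 zC]; apply: eq_bigl => y.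
    have [E|nE] := eqVneq (ps_mul x y) z; last by rewrite andbF.
    by move: z2 zC; rewrite -E /= => -> ; rewrite refines_pjoin ?PS_part // => ->.
  by move=> y /andP[-> h]; rewrite refines_pjoin ?PS_part.
rewrite (bigID (fun x : PS d => x.1 == porbits x.2)) /= [X in _ + X]big1 ?addr0; last first.
  by move=> x nx; apply: big1 => y _; rewrite /pszeta (negPf nx) rmorph0 mul0r.
rewrite (reindex_onto mk (fun x : PS d => x.2)) /=; last first.
  by move=> x /eqP E; apply/val_inj; rewrite /= -E; case: (x) => -[].
rewrite [RHS]big_mkcond /=.
rewrite (eq_bigl xpredT); last by move=> t; rewrite !eqxx.
apply: eq_bigr => t _; case: ifPn => tC; last by apply: big_pred0 => y; rewrite andbF.
rewrite -mulr_sumr; congr (_ * _); first by rewrite /pszeta eqxx.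
rewrite -(@sum_PS _ d f2 Phi2) //.
  by apply: eq_bigl => y; rewrite /= /permcomp; congr (_ && _); apply/eqP/eqP => [<-|->]; rewrite ?mulgK ?mulgKV.
apply/(refines_porbitsP _ pC) => B BC; apply: stableM.
  by have /(refines_porbitsP _ pC) := sC; apply.
by apply: stableV; have /(refines_porbitsP _ pC) := tC; apply.
Qed.

Lemma zeta_Hlt : zeta_relation Phi1 Phi2 d -> Hlt_relation (pexp f1) (pexp f2) d.
Proof.
move=> h; apply/Hlt_relationE => //; apply/funext => s.
have pC := one_block_part d; have ref (t : 'S_d) : refines (porbits t) (one_block d).
  by apply: refines_one => //; apply: porbits_part.
have := sum_PS a1 d0 f10 pC (ref s).
rewrite one_blockE // big_set1 hatT => <-.
rewrite -one_blockE //; under eq_bigr => z _ do rewrite h.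
rewrite sum_psconv_zeta // cnvE.
rewrite (eq_bigl xpredT) //; apply: eq_bigr => t _.
by rewrite one_blockE // big_set1 hatT mulrC.
Qed.

Lemma Hlt_zeta :
  (forall e, (0 < e <= d)%N -> Hlt_relation (pexp f1) (pexp f2) e) -> zeta_relation Phi1 Phi2 d.
Proof.
move=> h z; apply: laurent_of_fps_inj; move: z.
apply: part_sum_inj => C s pC sC; rewrite sum_psconv_zeta // (sum_PS a1) //.
have stB (t : 'S_d) B : refines (porbits t) C -> B \in C -> stable t B.
  by move=> tC; have /(refines_porbitsP _ pC) := tC; apply.
transitivity (\prod_(B in C) \sum_(t | perm_on B t) (hbar R ^+ block_len t B * hat (s * t^-1)%g (pexp f2) B)).
  apply: eq_bigr => B BC; have sB := stB _ _ sC BC.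
  (* The hypothesis is used in the degree of each block, not only in degree [d]. *)
  have e0 : (0 < #|B| <= d)%N.
    rewrite card_gt0 (partition_neq0 pC BC) /=.
    by rewrite -[X in (_ <= X)%N]card_ord max_card.
  have /andP[e1 _] := e0.
  have := congr1 (fun F => F (restr B s)) ((Hlt_relationE (pexp f1) (pexp f2) e1).1 (h _ e0)).
  rewrite hat_restr // => ->.
  rewrite cnvE sum_restr; apply: eq_bigr => t tB; have sBt := perm_on_stable tB.
  rewrite mulrC zetaKE; congr (_ * _).
    by rewrite perm_len_block /block_len -cycle_typeE cycle_type_restr.
  by rewrite hat_restr ?stableM ?stableV // restrM ?stableV // restrV.
rewrite -(prod_sum_perms pC (G := fun B t => hbar R ^+ block_len t B * hat (s * t^-1)%g (pexp f2) B)).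
  apply: eq_bigr => t tC; rewrite big_split /=; congr (_ * _).
  by rewrite zetaKE (block_len_sum pC tC) prodrXr.
move=> B t u BC tB uB tu; congr (_ * _).
  by rewrite /block_len (ctype_agree tB uB tu).
have sB := stB _ _ sC BC.
rewrite !hat_restr ?stableM ?stableV //; congr psi.
by rewrite !restrM ?stableV // !restrV // (restr_agree tB uB tu).
Qed.

End Degree.
End PartitionedRelations.

(** * Cut-and-join on symmetric polynomials *)

Section Derivations.
Variables (A : comNzRingType) (D : A -> A).
Hypotheses (DD : {morph D : x y / x + y}) (DM : forall x y, D (x * y) = D x * y + x * D y).

Lemma deriv1 : D 1 = 0.
Proof. by have := DM 1 1; rewrite !mulr1 mul1r -[LHS]addr0 => /addrI <-. Qed.

Lemma deriv0 : D 0 = 0.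
Proof. by have := DD 0 0; rewrite addr0 -[LHS]addr0 => /addrI <-. Qed.

Lemma deriv_sum (I : Type) (r : seq I) (P : pred I) (F : I -> A) :
  D (\sum_(i <- r | P i) F i) = \sum_(i <- r | P i) D (F i).
Proof. by elim/big_rec2: _ => [|i x y _ <-]; rewrite ?deriv0 ?DD. Qed.

Lemma deriv_logprod (I : Type) (r : seq I) (P : pred I) (q c : I -> A) :
  (forall i, P i -> D (q i) = c i * q i) ->
  D (\prod_(i <- r | P i) q i) = (\sum_(i <- r | P i) c i) * \prod_(i <- r | P i) q i.
Proof.
move=> Dq; elim: r => [|i r IHr]; first by rewrite !big_nil deriv1 mul0r.
rewrite !big_cons; case: ifP => // Pi; rewrite DM Dq // IHr; ring.
Qed.

Lemma deriv_exp x n : D (x ^+ n) = n%:R * x ^+ n.-1 * D x.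
Proof.
elim: n => [|n IHn]; first by rewrite deriv1 !mul0r.
rewrite exprS DM IHn /=; case: n {IHn} => [|n]; first by rewrite /= expr0; ring.
by rewrite /= !exprS -[in RHS]natr1 -[n.+1%:R in LHS]natr1; ring.
Qed.

End Derivations.

Section Alternants.
Variables (K : comNzRingType) (N : nat).
Local Notation MP := {mpoly K[N]}.
Implicit Types (p q h : MP) (m : 'I_N -> nat) (i j : 'I_N).

Definition powD L p : MP := \sum_i 'X_i ^+ L.+1 * p^`M(i).
Definition theta i p : MP := 'X_i * p^`M(i).
Definition Theta p : MP := \sum_i theta i (theta i p).

Lemma powDD L : {morph powD L : p q / p + q}.
Proof. by move=> p q; rewrite /powD -big_split /=; apply: eq_bigr => i _; rewrite mderivD mulrDr. Qed.

Lemma powDM L p q : powD L (p * q) = powD L p * q + p * powD L q.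
Proof.
rewrite /powD mulr_suml mulr_sumr -big_split /=; apply: eq_bigr => i _.
by rewrite mderivM; ring.
Qed.

Lemma thetaD i : {morph theta i : p q / p + q}.
Proof. by move=> p q; rewrite /theta mderivD mulrDr. Qed.

Lemma thetaM i p q : theta i (p * q) = theta i p * q + p * theta i q.
Proof. by rewrite /theta mderivM; ring. Qed.

Lemma mderivXU i j : ('X_j : MP)^`M(i) = (i == j)%:R.
Proof.
rewrite mderivX mnm1E eq_sym; case: eqP => [->|_]; last by rewrite scale0r.
rewrite (_ : (U_(j) - U_(j))%MM = 0%MM) ?mpolyX0 ?scale1r //.
by apply/mnmP => k; rewrite mnmBE subnn mnm0E.
Qed.

Lemma thetaX i j n : theta i (('X_j : MP) ^+ n) = (n * (i == j))%:R * 'X_j ^+ n.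
Proof.
rewrite (deriv_exp (thetaM i)) /theta mderivXU natrM.
case: eqP => [->|_]; last by rewrite !mulr0 mul0r.
by case: n => [|n]; rewrite ?mul0r // /= !mulr1 exprS; ring.
Qed.

Lemma powDX L j : powD L ('X_j : MP) = 'X_j ^+ L.+1.
Proof.
rewrite /powD (bigD1 j) //= mderivXU eqxx mulr1 big1 ?addr0 // => i ij.
by rewrite mderivXU (negPf ij) mulr0.
Qed.

Lemma powDXn L j n : powD L (('X_j : MP) ^+ n) = n%:R * 'X_j ^+ (n + L).
Proof.
rewrite (deriv_exp (powDM L)) powDX; case: n => [|n]; first by rewrite !mul0r.
by rewrite -mulrA -exprD /= addnS.
Qed.

(** Exponents are arbitrary, so that a box can be added in any row; the determinant vanishes when
    two exponents agree. *)
Definition am m : MP := \det (\matrix_(i, j) ('X_i ^+ m j : MP)).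

Lemma amE m : am m = \sum_(w : 'S_N) (-1) ^+ w * \prod_i 'X_i ^+ m (w i).
Proof. by apply: eq_bigr => w _; congr (_ * _); apply: eq_bigr => i _; rewrite mxE. Qed.

Lemma eq_am m1 m2 : m1 =1 m2 -> am m1 = am m2.
Proof. by move=> E; rewrite !amE; apply: eq_bigr => w _; congr (_ * _); apply: eq_bigr => i _; rewrite E. Qed.

Lemma alternantE la : alternant K N la = am (fun j => nth 0%N la j + (N - j.+1))%N.
Proof. by []. Qed.

(** Pieri's rule for one box: in the term of the permutation [w], multiplying by the variable of
    index [w^-1 j] raises the exponent [m j]. *)
Lemma powersum1_am m : powersum K N 1 * am m = \sum_j am (fun k => m k + (k == j))%N.
Proof.
rewrite amE mulr_sumr; under [RHS]eq_bigr => j _ do rewrite amE.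
rewrite exchange_big /=; apply: eq_bigr => w _.
rewrite /powersum mulr_suml (reindex_inj (@perm_inj _ w^-1)) /=; apply: eq_bigr => j _.
rewrite mulrCA; congr (_ * _); rewrite expr1.
rewrite [in RHS](eq_bigr (fun i => 'X_i ^+ m (w i) * 'X_i ^+ (w i == j))); last by move=> i _; rewrite exprD.
rewrite big_split /= mulrC; congr (_ * _).
rewrite (bigD1 (w^-1 j)%g) //= permKV eqxx expr1 big1 ?mulr1 // => i ij.
by rewrite -(inj_eq (@perm_inj _ w^-1%g)) permK (negPf ij).
Qed.

Lemma Theta_monomial (c : 'I_N -> nat) :
  Theta (\prod_i 'X_i ^+ c i) = (\sum_i c i ^ 2)%N%:R * \prod_i ('X_i : MP) ^+ c i.
Proof.
have E i : theta i (\prod_k ('X_k : MP) ^+ c k) = (c i)%:R * \prod_k 'X_k ^+ c k.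
  rewrite (@deriv_logprod _ _ (thetaM i) _ _ _ _ (fun k => (c k * (i == k))%:R)); last first.
    by move=> k _; apply: thetaX.
  rewrite (bigD1 i) //= eqxx muln1 big1 ?addr0 // => k ki.
  by rewrite eq_sym (negPf ki) muln0.
rewrite /Theta natr_sum mulr_suml; apply: eq_bigr => i _.
rewrite E thetaM E (_ : theta i _ = 0) ?mul0r ?add0r ?mulrA; last first.
  by rewrite /theta -mpolyC_nat mderivC mulr0.
by rewrite -natrM mulnn.
Qed.

Lemma ThetaD : {morph Theta : p q / p + q}.
Proof. by move=> p q; rewrite /Theta -big_split /=; apply: eq_bigr => i _; rewrite !thetaD. Qed.

Lemma ThetaZ (c : K) p : Theta (c *: p) = c *: Theta p.
Proof. by rewrite /Theta scaler_sumr; apply: eq_bigr => i _; rewrite /theta mderivZ -scalerAr mderivZ -scalerAr. Qed.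

Lemma Theta_sum (I : Type) (r : seq I) (P : pred I) (F : I -> MP) :
  Theta (\sum_(i <- r | P i) F i) = \sum_(i <- r | P i) Theta (F i).
Proof.
elim/big_rec2: _ => [|i x y _ <-]; last by rewrite ThetaD.
by have := ThetaZ 0 0; rewrite !scale0r.
Qed.

(** All monomials of the determinant have the same exponents up to order, hence the same
    eigenvalue. *)
Lemma Theta_am m : Theta (am m) = (\sum_j m j ^ 2)%N%:R * am m.
Proof.
rewrite amE Theta_sum mulr_sumr; apply: eq_bigr => w _.
have -> p : (-1) ^+ w * p = ((-1) ^+ w : K) *: p.
  by rewrite -mul_mpolyC rmorphXn /= rmorphN1.
rewrite ThetaZ Theta_monomial -scalerAr; congr (_ *: (_ %:R * _)).
by rewrite [RHS](reindex_inj (@perm_inj _ w)).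
Qed.

(** Exponents decrease in the alternant and increase in a Vandermonde matrix; [c] is the sign of the
    reversal. *)
Lemma vandermonde_alternant : exists c : K, alternant K N [::] =
  c *: \prod_(i < N) \prod_(j < N | (i < j)%N) ('X_j - 'X_i : MP).
Proof.
exists ((-1) ^+ (perm (@rev_ord_inj N))^-1%g).
rewrite -[X in _ *: X](_ : \det (Vandermonde N (\row_i ('X_i : MP))) = _); last first.
  rewrite det_Vandermonde; apply: eq_bigr => i _; apply: eq_bigr => j _.
  by rewrite !mxE.
rewrite -mul_mpolyC rmorphXn /= rmorphN1 -det_perm -[\det (Vandermonde _ _)]det_tr.
rewrite mulrC -det_mulmx /alternant; congr (\det _).
by rewrite -col_permE; apply/matrixP => i j; rewrite !mxE permE /= nth_nil add0n.
Qed.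

(** Logarithmic derivative of the Vandermonde product: the factor ['X_j - 'X_i] contributes the
    quotient of ['X_j ^+ L.+1 - 'X_i ^+ L.+1] by itself, which is [hh i j]. Doubling turns the sum
    over i < j into one over i != j, and the missing diagonal terms are [L.+1] times [p_L]. *)
Lemma powD_alternant L :
  powD L (alternant K N [::]) *+ 2 = alternant K N [::] *
    (\sum_(k < L.+1) powersum K N k * powersum K N (L - k) - powersum K N L *+ L.+1).
Proof.
have [c ->] := vandermonde_alternant.
have powDZ p : powD L (c *: p) = c *: powD L p.
  by rewrite /powD scaler_sumr; apply: eq_bigr => i _; rewrite mderivZ -scalerAr.
rewrite powDZ scalerMnr -scalerAl; congr (_ *: _).
pose hh i j : MP := \sum_(k < L.+1) 'X_j ^+ (L - k) * 'X_i ^+ k.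
rewrite (@deriv_logprod _ _ (powDM L) _ _ _ _ (fun i => \sum_(j < N | (i < j)%N) hh i j)); last first.
  move=> i _; apply: (@deriv_logprod _ _ (powDM L)) => j _.
  rewrite powDD -[- 'X_i]mulN1r powDM (_ : powD L (-1) = 0) ?mul0r ?add0r ?mulN1r; last first.
    by rewrite /powD big1 // => k _; rewrite mderivN -mpolyC1 mderivC oppr0 mulr0.
  by rewrite !powDX subrXX mulrC.
rewrite mulrC -mulrnAr; congr (_ * _).
transitivity (\sum_i \sum_(j | j != i) hh i j).
  rewrite mulr2n; under [RHS]eq_bigr => i _ do rewrite (bigID (fun j => (i < j)%N)) /=.
  rewrite big_split /=; congr (_ + _).
    by apply: eq_bigr => i _; apply: eq_bigl => j; rewrite -val_eqE /=; lia.
  rewrite (exchange_big_dep xpredT) //= ; apply: eq_bigr => j _.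
  rewrite [RHS](eq_bigl (fun i => (i < j)%N)); last first.
    by move=> i; rewrite -val_eqE /=; lia.
  apply: eq_bigr => i _; rewrite /hh (reindex_inj rev_ord_inj) /=; apply: eq_bigr => k _.
  have lk : (k <= L)%N by rewrite -ltnS.
  by rewrite subSS subKn // mulrC.
rewrite -(addrK (\sum_i hh i i) (\sum_i _)); congr (_ - _).
  rewrite -big_split /=.
  transitivity (\sum_i \sum_j hh i j).
    by apply: eq_bigr => i _; rewrite [RHS](bigD1 i) //= addrC.
  transitivity (\sum_i \sum_(k < L.+1) \sum_j ('X_j : MP) ^+ (L - k) * 'X_i ^+ k).
    by apply: eq_bigr => i _; rewrite exchange_big.
  rewrite exchange_big /=; apply: eq_bigr => k _.
  rewrite /powersum mulr_suml; apply: eq_bigr => i _; rewrite mulr_sumr; apply: eq_bigr => j _.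
  by rewrite mulrC.
rewrite /powersum -sumrMnl; apply: eq_bigr => i _; rewrite /hh.
rewrite (eq_bigr (fun=> 'X_i ^+ L)) ?sumr_const ?card_ord // => k _.
by rewrite -exprD subnK // -ltnS.
Qed.

End Alternants.

Section CutAndJoin.
Variables (K : comNzRingType) (N : nat).
Local Notation MP := {mpoly K[N]}.
Local Notation p_ := (powersum K N).
Local Notation ad := (alternant K N [::]).

Definition psprod (mu : seq nat) : MP := \prod_(k <- mu) p_ k.
Definition cutsum L : MP := \sum_(1 <= k < L) p_ k * p_ (L - k).

(* Twice the cut-and-join operator applied to p_mu, by recursion on mu: its first part
   L is cut, or joined to a part of mu' by the derivation p_k |-> k p_(k + L). *)
Fixpoint cutjoin (mu : seq nat) : MP :=
  if mu is L :: mu' then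
    p_ L * cutjoin mu' + L%:R * cutsum L * psprod mu' + (2 * L)%:R * powD L (psprod mu')
  else 0.

Lemma psprod_perm (mu nu : seq nat) : perm_eq mu nu -> psprod mu = psprod nu.
Proof. exact: perm_big. Qed.

Lemma psprod_cons k mu : psprod (k :: mu) = p_ k * psprod mu.
Proof. exact: big_cons. Qed.

Lemma powD_powersum L k : powD L (p_ k) = k%:R * p_ (k + L).
Proof.
rewrite /powersum (deriv_sum (@powDD K N L)) mulr_sumr; apply: eq_bigr => i _.
exact: powDXn.
Qed.

(** The multiple [2 * N] comes from the terms [k = 0] and [k = L] of [powD_alternant], since
    [p_0 = N]. *)
Lemma powD_ad L : (0 < L)%N ->
  powD L ad *+ 2 = ad * (cutsum L + (p_ L *+ (2 * N) - p_ L *+ L.+1)).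
Proof.
move=> L0; rewrite powD_alternant; congr (_ * _); rewrite addrA; congr (_ - _).
have p0 : p_ 0 = N%:R by rewrite /powersum (eq_bigr (fun=> 1)) ?sumr_const ?card_ord // => i _; rewrite expr0.
rewrite -(big_mkord xpredT (fun k => p_ k * p_ (L - k))) big_nat_recr //= big_ltn //.
by rewrite subn0 subnn p0 /cutsum; ring.
Qed.

Lemma Theta_powersum L (h : MP) :
  Theta (p_ L * h) = p_ L * Theta h + (2 * L)%:R * powD L h + (L ^ 2)%N%:R * p_ L * h.
Proof.
have thp i : theta i (p_ L) = L%:R * 'X_i ^+ L.
  rewrite /powersum (deriv_sum (@thetaD K N i)) (bigD1 i) //= thetaX eqxx muln1 big1 ?addr0 // => j ji.
  by rewrite thetaX eq_sym (negPf ji) muln0 mul0r.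
rewrite /Theta /powD [p_ L in X in _ + X]/powersum mulr_sumr mulr_sumr mulr_sumr mulr_suml.
rewrite -!big_split /=; apply: eq_bigr => i _.
rewrite (thetaM i (p_ L) h) thp thetaD (thetaM i (L%:R * _) h) (thetaM i L%:R) (thetaM i (p_ L)) thp.
have -> : theta i (L%:R : MP) = 0 by rewrite /theta -mpolyC_nat mderivC mulr0.
rewrite thetaX eqxx muln1 /theta exprS; ring.
Qed.

(** The cross term of [Theta_powersum] also differentiates the alternant, which supplies the cuts by
    [powD_ad]. There the multiple [- L * L.+1] of [p_L] meets [L ^ 2], leaving [L * (2 * N - 1)];
    these sum to the scalar in front of [psprod mu]. *)
Lemma Theta_psprod (mu : seq nat) : 0%N \notin mu ->
  Theta (psprod mu * ad) =
  cutjoin mu * ad + (sumn mu)%:R * ((2 * N)%:R - 1) * psprod mu * ad + psprod mu * Theta ad.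
Proof.
elim: mu => [|L mu IHmu]; first by rewrite /psprod big_nil mul1r /=; move=> _; ring.
rewrite inE negb_or eq_sym -lt0n => /andP[L0 mu0].
rewrite psprod_cons -mulrA Theta_powersum IHmu // powDM /= .
have E := powD_ad L0.
have -> : (2 * L)%:R * (powD L (psprod mu) * ad + psprod mu * powD L ad) =
   (2 * L)%:R * powD L (psprod mu) * ad + L%:R * psprod mu * (powD L ad *+ 2) :> MP by ring.
rewrite E; ring.
Qed.

End CutAndJoin.

(** * Multiplication by all transpositions, read on power sums *)

Section GroupCutJoin.
Variables (K : comNzRingType) (N d : nat).
Local Notation MP := {mpoly K[N]}.
Local Notation p_ := (powersum K N).
Implicit Types (s t : 'S_d) (a b : 'I_d).

Variable s : 'S_d.
Let G a b : MP := psprod K N (cycle_type (tperm a b * s)%g).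
Let outside (l : seq {set 'I_d}) : MP := \prod_(O in porbits s | O \notin l) p_ #|O|.

Lemma sum_porbit (V : nmodType) (F : 'I_d -> V) a :
  \sum_(b in porbit s a) F b = \sum_(k < #|porbit s a|) F ((s ^+ k)%g a).
Proof.
rewrite (eq_bigl (mem (traject s a #|porbit s a|))); last by move=> b; exact: porbit_traject.
rewrite -big_uniq ?uniq_traject_porbit //= (big_nth a) size_traject big_mkord.
by apply: eq_bigr => k _; rewrite nth_traject // permX.
Qed.

Lemma psprod_ctype X : psprod K N (ctype s X) = \prod_(O in orbits_in s X) p_ #|O|.
Proof. exact: (big_ctype _ p_). Qed.

Lemma cut_sum a : \sum_(b in porbit s a | b != a) G a b =
  cutsum K N #|porbit s a| * \prod_(O in porbits s | O != porbit s a) p_ #|O|.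
Proof.
rewrite big_mkcondr sum_porbit; set L := #|_|.
have L0 : (0 < L)%N by rewrite lt0n card_porbit_neq0.
rewrite -(big_mkord xpredT (fun k => if (s ^+ k)%g a != a then G a ((s ^+ k)%g a) else 0)).
rewrite big_ltn //= expg0 perm1 eqxx add0r /cutsum mulr_suml.
apply: eq_big_nat => k kL; rewrite porbit_expg_neq //.
rewrite /G cycle_typeE (psprod_perm _ _ (ctype_cut kL)) !psprod_cons mulrA; congr (_ * _).
rewrite psprod_ctype; apply: eq_bigl => O; rewrite inE.
have [/imsetP[x _ ->]/=|//] := boolP (O \in porbits s).
rewrite stable_porbit; last by apply: stableC; apply: stable_porbit_set.
by rewrite inE eq_porbit_mem.
Qed.

Lemma join_sum a b : b \notin porbit s a ->
  G a b = p_ (#|porbit s a| + #|porbit s b|) *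
     \prod_(O in porbits s | (O != porbit s a) && (O != porbit s b)) p_ #|O|.
Proof.
move=> nb; rewrite /G cycle_typeE (psprod_perm _ _ (ctype_join nb)) psprod_cons; congr (_ * _).
rewrite psprod_ctype; apply: eq_bigl => O; rewrite inE.
have [/imsetP[x _ ->]/=|//] := boolP (O \in porbits s).
rewrite stable_porbit; last by apply: stableC; apply: stableU; apply: stable_porbit_set.
by rewrite !inE !eq_porbit_mem negb_or.
Qed.

Lemma powD_orbits L (l : seq {set 'I_d}) : uniq l ->
  powD L (psprod K N [seq #|(O0 : {set 'I_d})| | O0 <- l]) =
  \sum_(O <- l) #|(O : {set 'I_d})|%:R * p_ (L + #|O|) * \prod_(O' <- l | O' != O) p_ #|O'|.
Proof.
elim: l => [|O l IHl]; first by rewrite /psprod !big_nil (deriv1 (@powDM K N L)).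
rewrite /= => /andP[Ol ul]; rewrite psprod_cons powDM powD_powersum IHl // !big_cons eqxx.
congr (_ + _).
  rewrite [(L + _)%N]addnC; congr (_ * _); rewrite /psprod big_map.
  rewrite [RHS]big_seq_cond [LHS]big_seq_cond; apply: eq_bigl => O'; rewrite andbT.
  by case O'l : (O' \in l) => //=; apply/esym; apply: contraTneq O'l => ->.
rewrite mulr_sumr [LHS]big_seq [RHS]big_seq; apply: eq_bigr => O' O'l.
rewrite big_cons ifT; last by apply: contraNneq Ol => ->.
by ring.
Qed.

(** The pairs of points are listed by their cycles, following the recursion of [cutjoin]: two points
    of the new cycle [O] give the cuts ([E1]), a point of [O] and a point of an earlier cycle give
    the joins ([E2]). The cycles outside [l] are carried along as a common factor. *)
Lemma cutjoin_orbits (l : seq {set 'I_d}) : uniq l -> {subset l <= porbits s} ->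
  \sum_(O <- l) \sum_(a in O) \sum_(O' <- l) \sum_(b in O' | b != a) G a b =
  cutjoin K N [seq #|(O0 : {set 'I_d})| | O0 <- l] * outside l.
Proof.
elim: l => [|O l IHl] /= ; first by rewrite big_nil mul0r.
case/andP=> Ol ul sub.
have subl : {subset l <= porbits s} by move=> O' h; apply: sub; rewrite inE h orbT.
have Os : O \in porbits s by apply: sub; rewrite inE eqxx.
pose Q := outside (O :: l).
have outl : outside l = p_ #|O| * Q.
  rewrite /outside (bigD1 O) ?Os //=; congr (_ * _); apply: eq_bigl => O'.
  by rewrite inE negb_or -!andbA; congr (_ && _); rewrite andbC.
have outall : \prod_(O' in porbits s | O' != O) p_ #|O'| = psprod K N [seq #|(O0 : {set 'I_d})| | O0 <- l] * Q.
  rewrite (bigID (fun O' => O' \in l)) /=; congr (_ * _).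
    rewrite /psprod big_map big_uniq //=; apply: eq_bigl => O'.
    have [O'l|] := boolP (O' \in l); rewrite ?andbF //= andbT subl //=.
    by apply: contraNneq Ol => <-.
  by apply: eq_bigl => O'; rewrite inE negb_or -andbA.
have sumO (a : 'I_d) : a \in O -> porbit s a = O.
  case/imsetP: Os => x _ ->; by rewrite -eq_porbit_mem => /eqP.
rewrite big_cons.
under eq_bigr => a aO do rewrite big_cons.
rewrite big_split /=.
under [X in _ + X]eq_big_seq => O' O'l do (under eq_bigr => a aO do rewrite big_cons; rewrite big_split /=).
rewrite big_split /= IHl // outl.
have E1 : \sum_(a in O) \sum_(b in O | b != a) G a b = #|O|%:R * cutsum K N #|O| * psprod K N [seq #|(O0 : {set 'I_d})| | O0 <- l] * Q.
  rewrite [LHS](eq_bigr (fun=> cutsum K N #|O| * (psprod K N [seq #|(O0 : {set 'I_d})| | O0 <- l] * Q))).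
    by rewrite sumr_const -mulr_natl; ring.
  move=> a aO; rewrite -outall -{1 2 3}(sumO a aO); exact: cut_sum.
have E2 O' : O' \in l -> \sum_(a in O) \sum_(b in O' | b != a) G a b =
    #|O|%:R * (#|O'|%:R * p_ (#|O| + #|O'|) * \prod_(O'' <- l | O'' != O') p_ #|O''|) * Q.
  move=> O'l; have O's := subl _ O'l.
  have nO : O' != O by apply: contraNneq Ol => <-.
  have sumO' b : b \in O' -> porbit s b = O'.
    case/imsetP: O's => x _ ->; by rewrite -eq_porbit_mem => /eqP.
  rewrite [LHS](eq_bigr (fun=> #|O'|%:R * (p_ (#|O| + #|O'|) * (\prod_(O'' <- l | O'' != O') p_ #|O''| * Q)))).
    by rewrite sumr_const -mulr_natl; ring.
  move=> a aO; rewrite [LHS](eq_bigr (fun=> p_ (#|O| + #|O'|) * (\prod_(O'' <- l | O'' != O') p_ #|O''| * Q))).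
    rewrite (eq_bigl (fun b => b \in O')); first by rewrite sumr_const -[LHS]mulr_natl.
    move=> b /=.
    rewrite andb_idr // => bO'; apply: contraNneq nO => E.
    by rewrite -(sumO' b bO') -(sumO a aO) E.
  move=> b /andP[bO' _]; rewrite join_sum ?(sumO a aO) ?(sumO' b bO') //; last first.
    by apply: contra nO => bO; rewrite -(sumO' b bO') (sumO b bO).
  congr (_ * _); rewrite (bigID (fun O'' => O'' \in l)) /=; congr (_ * _).
    rewrite -big_filter -[RHS]big_filter (big_uniq _ (filter_uniq _ ul)) /= big_filter; apply: eq_bigl => O''.
    rewrite mem_filter; have [O''l|] := boolP (O'' \in l); rewrite ?andbF //= !andbT subl //=.
    by rewrite andb_idl // => _; apply: contraNneq Ol => <-.
  apply: eq_bigl => O''; rewrite inE negb_or; case: (O'' \in porbits s) => //=.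
  have [->|] := eqVneq O'' O => //=; have [->|] := eqVneq O'' O' => //=; by rewrite O'l.
(* The ordered pairs met in the opposite order; they account for the factor 2 of the joining term in
   [cutjoin]. *)
have E3 O' : O' \in l -> \sum_(a in O') \sum_(b in O | b != a) G a b = \sum_(a in O) \sum_(b in O' | b != a) G a b.
  move=> O'l; under eq_bigr => a _ do rewrite big_mkcondr.
  under [RHS]eq_bigr => a _ do rewrite big_mkcondr.
  rewrite exchange_big /=; apply: eq_bigr => a _; apply: eq_bigr => b _.
  by rewrite eq_sym /G tpermC.
rewrite E1 exchange_big /= (eq_big_seq _ E2) [X in _ + (X + _)](eq_big_seq _ E3) (eq_big_seq _ E2).
rewrite -!mulr_suml -!mulr_sumr -powD_orbits // -/Q; ring.
Qed.

Lemma group_cutjoin :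
  \sum_a \sum_(b | b != a) G a b =
  cutjoin K N [seq #|(O0 : {set 'I_d})| | O0 <- enum (porbits s)].
Proof.
have sub : {subset enum (porbits s) <= porbits s} by move=> X; rewrite mem_enum.
have := @cutjoin_orbits (enum (porbits s)) (enum_uniq _) sub.
rewrite /outside [X in _ * X]big1 ?mulr1 => [<-|X]; last by rewrite mem_enum => /andP[->].
rewrite big_enum /=.
rewrite (eq_bigl _ _ (fun a => esym (in_setT a))) (set_partition_big _ (partition_porbits s)) /=.
apply: eq_bigr => X _; apply: eq_bigr => a _; rewrite big_enum /=.
rewrite (eq_bigl (fun b => (b \in setT) && (b != a))); last by move=> b; rewrite inE.
by rewrite (set_partition_big_cond _ (partition_porbits s)).
Qed.

End GroupCutJoin.

(** * The sum of transpositions and induction to the next symmetric group *)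

Section ClassAlgebra.
Variable K : comNzRingType.

(* Twice the sum of all transpositions: (a b) and (b a) are both counted. *)
Definition kap d (t : 'S_d) : K := \sum_a \sum_(b | b != a) (t == tperm a b)%:R.

Lemma cnv_kap d (f : 'S_d -> K) s : cnv (@kap d) f s = \sum_a \sum_(b | b != a) f (tperm a b * s)%g.
Proof.
rewrite /cnv /kap; under eq_bigr => t _ do rewrite mulr_suml.
rewrite exchange_big /=; apply: eq_bigr => a _.
under eq_bigr => t _ do rewrite mulr_suml.
rewrite exchange_big /=; apply: eq_bigr => b _.
rewrite (bigD1 (tperm a b)) //= eqxx mul1r tpermV big1 ?addr0 // => t /negPf->.
by rewrite mul0r.
Qed.

Lemma kap_class d : classfun (@kap d).
Proof.
move=> s t; rewrite /kap (reindex_inj (@perm_inj _ t)) /=; apply: eq_bigr => a _.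
rewrite (reindex_inj (@perm_inj _ t)) /=; apply: eq_big => b; first by rewrite (inj_eq perm_inj).
by rewrite -tpermJ (inj_eq (conjg_inj t)).
Qed.

Definition extf d (f : 'S_d -> K) (s : 'S_d.+1) : K := \sum_t (s == ext t)%:R * f t.
(** For a class function [f], d! times the induced class function; this avoids dividing by the order
    of the subgroup. *)
Definition pind d (f : 'S_d -> K) (s : 'S_d.+1) : K := \sum_g extf f (s ^ g)%g.

Lemma extf_ext d (f : 'S_d -> K) t : extf f (ext t) = f t.
Proof.
rewrite /extf (bigD1 t) //= eqxx mul1r big1 ?addr0 // => u ut.
by rewrite (inj_eq (@ext_inj d)) eq_sym (negPf ut) mul0r.
Qed.

Lemma extf_out d (f : 'S_d -> K) (s : 'S_d.+1) : s ord_max != ord_max -> extf f s = 0.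
Proof.
move=> h; rewrite /extf big1 // => t _; case: eqP => [E|]; last by rewrite mul0r.
by move: h; rewrite E ext_max eqxx.
Qed.

Lemma pind_class d (f : 'S_d -> K) : classfun (pind f).
Proof.
move=> s t; rewrite /pind [RHS](reindex_inj (mulgI t)) /=; apply: eq_bigr => g _.
by rewrite conjgM.
Qed.

(* d! times the Frobenius characteristic, in N variables. *)
Definition ev N d (f : 'S_d -> K) : {mpoly K[N]} := \sum_s f s *: psprod K N (cycle_type s).

Lemma ev_pind N d (f : 'S_d -> K) :
  ev N (pind f) = (d.+1)`!%:R * (powersum K N 1 * ev N f).
Proof.
rewrite /ev /pind; under eq_bigr => s _ do rewrite scaler_suml.
rewrite exchange_big /=.
transitivity (\sum_(g : 'S_d.+1) \sum_s extf f s *: psprod K N (cycle_type s)).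
  apply: eq_bigr => g _; rewrite [RHS](reindex_inj (conjg_inj g)) /=; apply: eq_bigr => s _.
  by rewrite cycle_typeJ.
rewrite sumr_const -[LHS]mulr_natl card_Sn; congr (_ * _).
transitivity (\sum_(t : 'S_d) \sum_s ((s == ext t)%:R * f t) *: psprod K N (cycle_type s)).
  by rewrite exchange_big /=; apply: eq_bigr => s _; rewrite scaler_suml.
rewrite mulr_sumr; apply: eq_bigr => t _.
rewrite (bigD1 (ext t)) //= eqxx mul1r big1 ?addr0; last first.
  by move=> s /negPf->; rewrite mul0r scale0r.
by rewrite (psprod_perm _ _ (cycle_type_ext t)) psprod_cons -scalerAr.
Qed.

Lemma evZ N d (c : K) (f : 'S_d -> K) : ev N (fun s => c * f s) = c *: ev N f.
Proof. by rewrite /ev scaler_sumr; apply: eq_bigr => s _; rewrite scalerA. Qed.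

Lemma evB N d (f g : 'S_d -> K) : ev N (fun s => f s - g s) = ev N f - ev N g.
Proof. by rewrite /ev -sumrB; apply: eq_bigr => s _; rewrite scalerBl. Qed.

Lemma ev_sum N d (I : finType) (F : I -> 'S_d -> K) : ev N (fun s => \sum_i F i s) = \sum_i ev N (F i).
Proof. by rewrite /ev exchange_big /=; apply: eq_bigr => s _; rewrite scaler_suml. Qed.

Lemma psprod_orbits N d (s : 'S_d) :
  psprod K N (cycle_type s) = psprod K N [seq #|(O0 : {set 'I_d})| | O0 <- enum (porbits s)].
Proof.
rewrite cycle_typeE; apply: psprod_perm; apply: perm_trans (perm_ctype _ _) _.
rewrite /image_mem (eq_enum (B := porbits s)) ?perm_refl // => O.
by rewrite inE subsetT andbT.
Qed.

(** Up to scalars, convolution by [kap] is [Theta] conjugated by multiplication by the alternant of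
    the empty partition, whose own eigenvalue is the last scalar. *)
Lemma Theta_ev N d (f : 'S_d -> K) :
  Theta (ev N f * alternant K N [::]) =
  (ev N (cnv (@kap d) f) + d%:R * ((2 * N)%:R - 1) * ev N f
    + (\sum_(j < N) (N - j.+1) ^ 2)%N%:R * ev N f) * alternant K N [::].
Proof.
have E : ev N (cnv (@kap d) f) = \sum_s f s *: cutjoin K N [seq #|(O0 : {set 'I_d})| | O0 <- enum (porbits s)].
  transitivity (\sum_(s : 'S_d) \sum_a \sum_(b | b != a) f s *: psprod K N (cycle_type (tperm a b * s)%g)).
    rewrite /ev exchange_big /=; under eq_bigr => s _ do rewrite cnv_kap scaler_suml.
    rewrite exchange_big /=; apply: eq_bigr => a _.
    under eq_bigr => s _ do rewrite scaler_suml.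
    rewrite [RHS]exchange_big /= exchange_big /=; apply: eq_bigr => b _.
    rewrite [RHS](reindex_inj (mulgI (tperm a b))) /=; apply: eq_bigr => s _.
    by rewrite mulgA tperm2 mul1g.
  apply: eq_bigr => s _; rewrite -group_cutjoin scaler_sumr; apply: eq_bigr => a _.
  by rewrite scaler_sumr.
have -> : Theta (ev N f * alternant K N [::]) =
    \sum_s Theta (f s *: psprod K N (cycle_type s) * alternant K N [::]).
  by rewrite -Theta_sum -mulr_suml.
transitivity (\sum_s f s *: ((cutjoin K N [seq #|(O0 : {set 'I_d})| | O0 <- enum (porbits s)]
   + d%:R * ((2 * N)%:R - 1) * psprod K N (cycle_type s)
   + (\sum_(j < N) (N - j.+1) ^ 2)%N%:R * psprod K N (cycle_type s)) * alternant K N [::])).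
  apply: eq_bigr => s _; rewrite -scalerAl ThetaZ; congr (_ *: _).
  rewrite psprod_orbits Theta_psprod; last first.
    apply/mapP => -[O]; rewrite mem_enum => /imsetP[x _ ->] /esym/eqP.
    by rewrite (negPf (card_porbit_neq0 _ _)).
  have -> : sumn [seq #|(O0 : {set 'I_d})| | O0 <- enum (porbits s)] = d.
    rewrite -[RHS](sumn_cycle_type s) cycle_typeE; apply: perm_sumn; rewrite perm_sym.
    apply: perm_trans (perm_ctype _ _) _.
    rewrite /image_mem (eq_enum (B := porbits s)) ?perm_refl // => O.
    by rewrite inE subsetT andbT.
  rewrite {2}alternantE Theta_am -alternantE.
  rewrite (eq_bigr (fun j : 'I_N => (N - j.+1) ^ 2)%N); last by move=> j _; rewrite nth_nil.
  by ring.
rewrite E /ev; set x := d%:R * _; set y := (\sum_(j < N) _)%N%:R; move: (alternant K N [::]) x y => A x y.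
rewrite [x * _]mulr_sumr [y * _]mulr_sumr -!big_split /= mulr_suml; apply: eq_bigr => s _.
by rewrite -!scalerAr -!scalerDr -scalerAl.
Qed.

End ClassAlgebra.

(** The box is taken from the last row. A row of length one then disappears, and [i0] equals
    [size la]. *)
Lemma remove_box d (la' : part_of d.+1) : exists (la : part_of d) (i0 : nat),
  [/\ forall j, nth 0%N la' j = (nth 0%N la j + (j == i0))%N, (i0 <= size la)%N,
      (i0 < size la')%N & (size la <= size la')%N].
Proof.
case: la' => -[la' hla'] /= sum'.
case/lastP: la' => [|l x] in hla' sum' *; first by [].
move: (hla') => /andP[srt n0]; rewrite mem_rcons inE negb_or in n0; case/andP: n0 => x0 l0.
have sl : sorted geq l by move: srt; rewrite -cats1 => /cat_sorted2[].
rewrite sumn_rcons in sum'.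
have [x1|x1] := eqVneq x 1%N.
  have hl : is_intpart l by rewrite /is_intpart sl l0.
  have suml : sumn (IntPart hl) == d by rewrite /= x1 addn1 eqSS in sum' *.
  exists (PartOf suml), (size l); rewrite /= size_rcons; split=> // j.
  rewrite nth_rcons x1; have [lt|lt|E] := ltngtP j (size l); rewrite ?addn0 //.
    by rewrite nth_default // ltnW.
  by rewrite nth_default // E.
have hl : is_intpart (rcons l x.-1).
  rewrite /is_intpart mem_rcons inE negb_or l0 andbT; apply/andP; split; last by lia.
  case: l {sum' l0 sl hla'} srt => //= y l; rewrite !rcons_path => /andP[-> /=].
  by rewrite /geq /=; lia.
have suml : sumn (IntPart hl) == d by rewrite /= sumn_rcons; lia.
exists (PartOf suml), (size l); rewrite /= !size_rcons; split=> // j.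
rewrite !nth_rcons; have [lt|lt|E] := ltngtP j (size l); rewrite ?addn0 //; lia.
Qed.

Lemma nth_intpart (la : intpart) i j : (i <= j)%N -> (nth 0%N la j <= nth 0%N la i)%N.
Proof.
have /andP[srt _] := partsP la; move=> ij.
have [js|sj] := ltnP j (size la); last by rewrite nth_default.
have geq_tr : transitive geq by move=> a b c; rewrite /geq /=; lia.
apply: (sorted_leq_nth geq_tr _ 0%N srt) => //; rewrite ?inE //.
  by move=> a; rewrite /geq /=.
exact: leq_ltn_trans js.
Qed.

(** * Schur functions as class functions *)

Section SchurStep.
Implicit Types (la : intpart).

(* Twice the sum of the contents j - i, that is the eigenvalue of kap on s_la;
   row_eig la i is the same number for la with a box added in row i. *)
Definition content_sum la : rat :=
  \sum_(i < size la) (nth 0%N la i)%:R * ((nth 0%N la i)%:R - 2 * (i : nat)%:R - 1).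

Definition row_eig la (i : nat) : rat := content_sum la + 2 * ((nth 0%N la i)%:R - i%:R).

(** The numbers la_i - i strictly decrease, so [kap] separates the rows. *)
Lemma row_eig_inj la : injective (row_eig la).
Proof.
move=> i j; rewrite /row_eig => /addrI /(mulfI _) E.
have {}E : (nth 0%N la i)%:R - i%:R = (nth 0%N la j)%:R - j%:R :> rat by apply: E.
have {}E : (nth 0%N la i + j = nth 0%N la j + i)%N.
  by apply/eqP; rewrite -(eqr_nat rat) !natrD; apply/eqP; lra.
have [ij|ji|//] := ltngtP i j.
  by have := nth_intpart la (ltnW ij); lia.
by have := nth_intpart la (ltnW ji); lia.
Qed.

Lemma big_parts_widen (la : seq nat) N (V : nmodType) (F : nat -> nat -> V) : (size la <= N)%N ->
  (forall i, F i 0%N = 0) ->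
  \sum_(i < N) F i (nth 0%N la i) = \sum_(i < size la) F i (nth 0%N la i).
Proof.
move=> sN F0; rewrite [RHS](big_ord_widen N (fun i => F i (nth 0%N la i)) sN) [RHS]big_mkcond /=.
apply: eq_bigr => i _; case: ltnP => // h.
by rewrite nth_default.
Qed.

(** The left-hand side is the eigenvalue of [Theta] on [row_am la i]; the first two terms on the
    right are the scalars of [Theta_ev] in degree [d.+1], so that [row_eig la i] is left for
    [kap]. *)
Lemma sum_row_sq d (la : part_of d) N (i : 'I_N) : (size la <= N)%N ->
  (\sum_(j < N) (nth 0%N la j + (N - j.+1) + (j == i)) ^ 2)%N%:R =
  d.+1%:R * ((2 * N)%:R - 1) + (\sum_(j < N) (N - j.+1) ^ 2)%N%:R + row_eig la i :> rat.
Proof.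
move=> sN.
have sumla : \sum_(j < N) (nth 0%N la j)%:R = d%:R :> rat.
  rewrite (big_parts_widen sN (F := fun _ k => k%:R)) // -natr_sum; congr _%:R.
  by apply: etrans (eqP (part_ofP la)); rewrite sumnE (big_nth 0%N) big_mkord.
have cs : \sum_(j < N) (nth 0%N la j)%:R * ((nth 0%N la j)%:R - 2 * (j : nat)%:R - 1) = content_sum la.
  by rewrite (big_parts_widen sN (F := fun j k => k%:R * (k%:R - 2 * j%:R - 1))) // => j; rewrite mul0r.
rewrite natr_sum.
transitivity (\sum_(j < N) (((N - j.+1) ^ 2)%N%:R + (nth 0%N la j)%:R * ((2 * N)%:R - 1)
    + (nth 0%N la j)%:R * ((nth 0%N la j)%:R - 2 * (j : nat)%:R - 1)
    + (j == i)%:R * (2 * ((nth 0%N la j)%:R + N%:R - j%:R - 1) + 1)) : rat).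
  apply: eq_bigr => j _.
  have NE : (N - j.+1)%:R = N%:R - j%:R - 1 :> rat.
    by rewrite natrB // -natr1 opprD addrA.
  rewrite natrM !natrX !natrD NE.
  by case: (j == i) => /=; ring.
rewrite !big_split /= cs -mulr_suml sumla -natr_sum.
have -> : \sum_(j < N) (j == i)%:R * (2 * ((nth 0%N la j)%:R + N%:R - (j : nat)%:R - 1) + 1)
    = 2 * ((nth 0%N la i)%:R + N%:R - (i : nat)%:R - 1) + 1 :> rat.
  rewrite (bigD1 i) //= eqxx mul1r big1 ?addr0 // => j /negPf->.
  by rewrite mul0r.
rewrite /row_eig -natr1 natrM; ring.
Qed.

(* Characterises f by the bialternant formula for s_la; f is the character of la
   divided by d!. *)
Definition schur_fun d (la : seq nat) (f : 'S_d -> rat) : Prop :=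
  forall N, (size la <= N)%N ->
    ev N f * alternant rat N [::] = alternant rat N la.

(* Zero unless row i of la can receive a box. *)
Definition row_am N (la : seq nat) (i : 'I_N) : {mpoly rat[N]} :=
  am rat (fun j => nth 0%N la j + (N - j.+1) + (j == i))%N.

Lemma schur_pind d la (f : 'S_d -> rat) N : schur_fun la f -> (size la <= N)%N ->
  ev N (pind f) * alternant rat N [::] = (d.+1)`!%:R * \sum_(i < N) row_am la i.
Proof.
move=> h sN; rewrite ev_pind -!mulrA h // alternantE powersum1_am.
by [].
Qed.

Lemma ev_kap_rows d (la : part_of d) N (f : 'S_d.+1 -> rat) (k : 'I_N -> rat) : (size la <= N)%N ->
  ev N f * alternant rat N [::] = \sum_(i < N) k i *: row_am la i ->
  ev N (cnv (@kap rat d.+1) f) * alternant rat N [::] = \sum_(i < N) (k i * row_eig la i) *: row_am la i.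
Proof.
move=> sN hf; have := Theta_ev N f; rewrite !mulrDl -!mulrA hf.
set X := _ * alternant _ _ _ => E.
have -> : X = Theta (\sum_(i < N) k i *: row_am la i)
   - d.+1%:R * (((2 * N)%:R - 1) * \sum_(i < N) k i *: row_am la i)
   - (\sum_(j < N) (N - j.+1) ^ 2)%N%:R * \sum_(i < N) k i *: row_am la i.
  by rewrite E; ring.
rewrite Theta_sum !mulr_sumr -!sumrB; apply: eq_bigr => i _.
rewrite ThetaZ Theta_am -!scalerAr -!scalerBr -[RHS]scalerA; congr (_ *: _).
rewrite -[RHS]mul_mpolyC mulrA -!mulrBl; congr (_ * _).
rewrite -!mpolyC_nat -mpolyC1 -!mpolyCB -!mpolyCM -!mpolyCB; congr (_%:MP).
rewrite sum_row_sq //; ring.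
Qed.

(* Lagrange projection onto the e i0-eigenspace of kap along those of e r, r in rs. *)
Fixpoint lagr d (e : nat -> rat) (i0 : nat) (rs : seq nat) (f : 'S_d -> rat) : 'S_d -> rat :=
  if rs is r :: rs' then
    fun s => (e i0 - e r)^-1 * (cnv (@kap rat d) (lagr e i0 rs' f) s - e r * lagr e i0 rs' f s)
  else f.

Lemma ev_lagr_rows d (la : part_of d) N (f : 'S_d.+1 -> rat) (k : 'I_N -> rat) i0 rs : (size la <= N)%N ->
  ev N f * alternant rat N [::] = \sum_(i < N) k i *: row_am la i ->
  ev N (lagr (row_eig la) i0 rs f) * alternant rat N [::] =
  \sum_(i < N) (k i * \prod_(r <- rs) ((row_eig la i0 - row_eig la r)^-1 * (row_eig la i - row_eig la r))) *: row_am la i.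
Proof.
move=> sN hf; elim: rs => [|r rs IHrs] /=.
  by rewrite hf; apply: eq_bigr => i _; rewrite big_nil mulr1.
rewrite evZ evB evZ -scalerAl mulrBl -scalerAl (ev_kap_rows sN IHrs) IHrs scaler_sumr -sumrB scaler_sumr.
apply: eq_bigr => i _; rewrite scalerA -scalerBl scalerA big_cons; congr (_ *: _); ring.
Qed.

Lemma am_eq0 (K : comNzRingType) N (m : 'I_N -> nat) i j : i != j -> m i = m j -> am K m = 0.
Proof.
move=> ij mij; rewrite /am -det_tr; apply: (determinant_alternate ij) => k.
by rewrite !mxE mij.
Qed.

(** Rows [i.-1] and [i] are both empty, so a box added to the second makes two exponents equal. *)
Lemma row_am_out N la (i : 'I_N) : (size la < i)%N -> row_am la i = 0.
Proof.
move=> si; have i0 : (0 < i)%N by apply: leq_ltn_trans si.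
have hi : (i.-1 < N)%N by rewrite (leq_ltn_trans (leq_pred _)).
have ne : Ordinal hi != i by rewrite -val_eqE /=; lia.
apply: (am_eq0 _ ne); rewrite eqxx (negPf ne) /=.
have si' : (size la <= i.-1)%N by lia.
by rewrite (nth_default _ (ltnW si)) (nth_default _ si'); have := ltn_ord i; lia.
Qed.

(** All rows up to [size la] other than [i0] are projected away. Those that cannot receive a box do
    no harm: their [row_am] vanishes, and their number [row_eig] still differs from that of [i0]. *)
Definition grow d (la : seq nat) (e : nat -> rat) i0 (f : 'S_d -> rat) : 'S_d.+1 -> rat :=
  lagr e i0 [seq r <- iota 0 (size la).+1 | r != i0] (fun s => (d.+1)`!%:R^-1 * pind f s).

Lemma schur_grow d (la : part_of d) (la' : part_of d.+1) i0 (f : 'S_d -> rat) :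
  (forall j, nth 0%N la' j = nth 0%N la j + (j == i0))%N ->
  (i0 <= size la)%N -> (i0 < size la')%N -> (size la <= size la')%N ->
  schur_fun la f -> schur_fun la' (grow la (row_eig la) i0 f).
Proof.
move=> hla' i0s i0s' ss' hf N sN.
have sNl := leq_trans ss' sN; have i0N := leq_trans i0s' sN.
have h0 : ev N (fun s => (d.+1)`!%:R^-1 * pind f s) * alternant rat N [::] = \sum_(i < N) 1 *: row_am la i.
  rewrite evZ -scalerAl (schur_pind hf sNl).
  rewrite -mpolyC_nat mul_mpolyC scalerA mulVf ?scale1r; last by rewrite pnatr_eq0 -lt0n fact_gt0.
  by apply: eq_bigr => i _; rewrite scale1r.
rewrite /grow; set rs := [seq r <- _ | _].
have rsE r : (r \in rs) = (r != i0) && (r <= size la)%N by rewrite mem_filter mem_iota.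
move: rs rsE => rs rsE.
rewrite (ev_lagr_rows _ _ sNl h0) (bigD1 (Ordinal i0N)) //= [X in _ + X]big1 ?addr0; last first.
  move=> i; rewrite -val_eqE /= => ii0.
  have [si|is_] := ltnP (size la) i; first by rewrite row_am_out // scaler0.
  rewrite (big_rem (i : nat)) /=; last by rewrite rsE ii0.
  by rewrite subrr mulr0 mul0r mulr0 scale0r.
rewrite mul1r big_seq big1 ?scale1r; last first.
  move=> r; rewrite rsE => /andP[ri _]; rewrite mulVf // subr_eq0.
  by rewrite (inj_eq (@row_eig_inj la)) eq_sym.
rewrite alternantE; apply: eq_am => j; rewrite hla' -val_eqE /=; lia.
Qed.

End SchurStep.

(** * Independence of alternants and the basis of Schur class functions *)

Section AlternantBasis.
Variables (K : comNzRingType) (N : nat).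

(** Permuting strictly decreasing exponents gives a strictly decreasing vector only for the
    identity, so an alternant has a single dominant monomial. *)
Lemma mcoeff_am (m1 m2 : 'I_N -> nat) :
  {homo m1 : i j / (i < j)%N >-> (i > j)%N} -> {homo m2 : i j / (i < j)%N >-> (i > j)%N} ->
  (am K m1)@_[multinom m2 i | i < N] = [forall i, m1 i == m2 i]%:R.
Proof.
move=> h1 h2.
have inj1 : injective m1.
  move=> i j E; apply: val_inj; have [lt|lt|//] := ltngtP (val i) (val j).
    by have := h1 _ _ lt; rewrite E ltnn.
  by have := h1 _ _ lt; rewrite E ltnn.
rewrite amE linear_sum /=.
have coefE (w : 'S_N) : ((-1) ^+ w * \prod_i 'X_i ^+ m1 (w i) : {mpoly K[N]})@_[multinom m2 i | i < N]
   = (-1) ^+ w * [forall i, m1 (w i) == m2 i]%:R.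
  have -> p : (-1) ^+ w * p = ((-1) ^+ w : K) *: p :> {mpoly K[N]}.
    by rewrite -mul_mpolyC rmorphXn /= rmorphN1.
  rewrite mcoeffZ; congr (_ * _).
  have -> : \prod_i ('X_i : {mpoly K[N]}) ^+ m1 (w i) = 'X_[[multinom m1 (w i) | i < N]].
    by rewrite mpolyXE_id; apply: eq_bigr => i _; rewrite mnmE.
  rewrite mcoeffX; congr (nat_of_bool _)%:R; apply/eqP/forallP => [E i|E].
    by have := congr1 (fun m : 'X_{1..N} => m i) E; rewrite !mnmE => ->.
  by apply/mnmP => i; rewrite !mnmE; apply/eqP.
have sortE (w : 'S_N) : [forall i, m1 (w i) == m2 i] -> forall i, m1 i = m2 i.
  move=> /forallP hw i.
  have srt (m : 'I_N -> nat) : {homo m : i j / (i < j)%N >-> (i > j)%N} -> sorted gtn [seq m i | i <- enum 'I_N].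
    move=> h; have tr : transitive gtn by move=> a b c; rewrite /gtn /=; lia.
    rewrite sorted_map; have := sort_sorted (leT := fun i j : 'I_N => (i <= j)%N).
    move=> _; have : sorted ltn [seq val i | i <- enum 'I_N] by rewrite val_enum_ord iota_ltn_sorted.
    by rewrite sorted_map; apply: sub_sorted => a b /= /h.
  have E : [seq m1 i | i <- enum 'I_N] = [seq m2 i | i <- enum 'I_N].
    apply: (sorted_eq (leT := gtn)); rewrite ?srt //.
    - by move=> a b c; rewrite /gtn /=; lia.
    - by move=> a b; rewrite /gtn /=; lia.
    have -> : [seq m2 i | i <- enum 'I_N] = [seq m1 (w i) | i <- enum 'I_N].
      by apply: eq_map => j; apply/esym/eqP.
    rewrite (map_comp m1 w); apply: perm_map; apply: uniq_perm; rewrite ?enum_uniq //.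
      by rewrite map_inj_uniq ?enum_uniq //; apply: perm_inj.
    move=> j; rewrite mem_enum /=; apply/esym/mapP; exists (w^-1 j)%g; rewrite ?permKV ?mem_enum //.
  have := congr1 (fun s => nth 0%N s i) E.
  rewrite (nth_map i) ?size_enum_ord // (nth_map i) ?size_enum_ord //.
  by rewrite !nth_ord_enum.
case: forallP => [E|nE].
  rewrite (bigD1 1%g) //= coefE odd_perm1 expr0 mul1r [X in _ + X]big1 ?addr0.
    by rewrite (_ : [forall i, _] = true) //; apply/forallP => i; rewrite perm1 E.
  move=> w w1; rewrite coefE; case: forallP => [hw|]; rewrite ?mulr0 //.
  case/eqP: w1; apply/permP => i; rewrite perm1; apply: inj1.
  by rewrite (eqP (hw i)) (eqP (E i)).
rewrite big1 // => w _; rewrite coefE.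
case hw : [forall i, m1 (w i) == m2 i]; last by rewrite mulr0.
by case: nE => i; rewrite (sortE w hw).
Qed.

End AlternantBasis.

Lemma sum_indicator (I : finType) (V : comNzRingType) (c X : I -> V) i :
  (forall j, X j = (j == i)%:R) -> \sum_j c j * X j = c i.
Proof.
move=> XE; rewrite (bigD1 i) //= XE eqxx mulr1 big1 ?addr0 // => j /negPf ji.
by rewrite XE ji mulr0.
Qed.

Section SchurBasis.
Variables (d : nat) (sg : part_of d -> 'S_d -> rat).
Hypotheses (sg_class : forall la, classfun (sg la)) (sg_schur : forall la : part_of d, schur_fun la (sg la)).
Local Notation ad := (alternant rat d [::]).

Lemma size_part_le n (la : part_of n) : (size la <= n)%N.
Proof.
case: la => -[s /= /andP[_ n0]] /= /eqP <-; elim: s n0 => //= k s IHs.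
by rewrite inE negb_or eq_sym -lt0n => /andP[k0 /IHs]; lia.
Qed.

Lemma alternant_shift_homo (la : part_of d) :
  {homo (fun j : 'I_d => nth 0%N la j + (d - j.+1))%N : i j / (i < j)%N >-> (i > j)%N}.
Proof. by move=> i j ij; have := nth_intpart la (ltnW ij); have := ltn_ord j; lia. Qed.

(** With [d] variables every partition of [d] fits, and among these alternants the monomial of
    exponents la + delta occurs only in that of [la]. *)
Lemma alternant_free (c : part_of d -> rat) :
  \sum_la c la *: alternant rat d la = 0 -> forall la, c la = 0.
Proof.
move=> E la; pose m := [multinom (nth 0%N la j + (d - j.+1))%N | j < d].
suff coefE (mu : part_of d) : (alternant rat d mu)@_m = (mu == la)%:R.
  transitivity (\sum_mu c mu * (alternant rat d mu)@_m).
    exact/esym/sum_indicator.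
  transitivity ((\sum_mu c mu *: alternant rat d mu)@_m); last by rewrite E mcoeff0.
  by rewrite [RHS](raddf_sum (mcoeff m)); apply: eq_bigr => mu _; rewrite [RHS]mcoeffZ.
rewrite [alternant _ _ _]alternantE (mcoeff_am _ (@alternant_shift_homo mu) (@alternant_shift_homo la)).
congr (nat_of_bool _)%:R; apply/forallP/eqP => [h|-> //].
have hi i : nth 0%N mu i = nth 0%N la i.
  have [id_|di] := ltnP i d; first by have /eqP := h (Ordinal id_); rewrite /=; lia.
  by rewrite !nth_default // (leq_trans (size_part_le _)).
have sz (al be : part_of d) : (forall i, nth 0%N al i = nth 0%N be i) -> (size al <= size be)%N.
  move=> hab; rewrite leqNgt; apply/negP => lt.
  have /andP[_] := partsP al; case/negP.
  by have := mem_nth 0%N lt; rewrite hab nth_default.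
apply/val_inj/val_inj; apply: (@eq_from_nth _ 0%N) => [|i _]; last exact: hi.
by apply/eqP; rewrite eqn_leq !sz.
Qed.

(** The matrix of values at class representatives is square, with rows and columns indexed by
    partitions. A relation between its rows passes through [ev] to the alternants, so it is
    invertible; [S] is its inverse. *)
Lemma schur_span_rat : exists S : part_of d -> part_of d -> rat,
  forall s la, \sum_mu S la mu * sg mu s = (cycle_part s == la)%:R.
Proof.
pose n := #|{: part_of d}|.
have rep la : {s : 'S_d | cycle_part s = la} by apply/cid; apply: cycle_part_surj.
pose M : 'M[rat]_n := \matrix_(i, j) sg (enum_val i) (sval (rep (enum_val j))).
have sgE la s : sg la s = M (enum_rank la) (enum_rank (cycle_part s)).
  rewrite mxE !enum_rankK; apply: classfun_part => //.
  by rewrite (svalP (rep _)).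
have Mu : M \in unitmx.
  rewrite -row_free_unit; apply: inj_row_free => v vM.
  pose c la := v 0 (enum_rank la).
  have c0 : forall s, \sum_la c la * sg la s = 0.
    move=> s; transitivity ((v *m M) 0 (enum_rank (cycle_part s))); last by rewrite vM mxE.
    rewrite mxE [RHS](reindex (@enum_rank (part_of d))) /=; last first.
      by exists enum_val => i _; rewrite ?enum_valK ?enum_rankK.
    by apply: eq_bigr => la _; rewrite sgE.
  have : \sum_la c la *: alternant rat d la = 0.
    transitivity (ev d (fun s => \sum_la c la * sg la s) * ad).
      rewrite ev_sum mulr_suml; apply: eq_bigr => la _.
      by rewrite evZ -scalerAl sg_schur ?size_part_le.
    by rewrite /ev big1 ?mul0r // => s _; rewrite c0 scale0r.
  move/alternant_free => cE; apply/rowP => i; rewrite mxE.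
  by have := cE (enum_val i); rewrite /c enum_valK.
exists (fun la mu => invmx M (enum_rank la) (enum_rank mu)) => s la.
have := congr1 (fun A : 'M_n => A (enum_rank la) (enum_rank (cycle_part s))) (mulVmx Mu).
rewrite mxE [RHS]mxE (inj_eq enum_rank_inj) eq_sym => <-.
rewrite [RHS](reindex (@enum_rank (part_of d))) /=; last first.
  by exists enum_val => i _; rewrite ?enum_valK ?enum_rankK.
by apply: eq_bigr => mu _; rewrite sgE.
Qed.

Lemma classfun_span (A : comNzRingType) (iota : {rmorphism rat -> A}) (phi : 'S_d -> A) : classfun phi ->
  exists c : part_of d -> A, phi = fun s => \sum_mu c mu * iota (sg mu s).
Proof.
move=> phic; have [S hS] := schur_span_rat.
have rep la : {s : 'S_d | cycle_part s = la} by apply/cid; apply: cycle_part_surj.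
exists (fun mu => \sum_la phi (sval (rep la)) * iota (S la mu)); apply/funext => s.
under eq_bigr => mu _ do rewrite mulr_suml.
rewrite exchange_big /=.
transitivity (\sum_la phi (sval (rep la)) * (cycle_part s == la)%:R).
  rewrite (bigD1 (cycle_part s)) //= eqxx mulr1 big1 ?addr0.
    by apply: classfun_part => //; rewrite (svalP (rep _)).
  by move=> la; rewrite eq_sym => /negPf->; rewrite mulr0.
apply: eq_bigr => la _; rewrite -(rmorph_nat iota) -hS rmorph_sum mulr_sumr.
by apply: eq_bigr => mu _; rewrite rmorphM mulrA.
Qed.

Lemma ev_inj (phi : 'S_d -> rat) : classfun phi -> ev d phi * ad = 0 -> phi = fun _ => 0.
Proof.
move=> phic; have [c ->] := classfun_span (idfun : {rmorphism rat -> rat}) phic.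
rewrite ev_sum mulr_suml => E; have {}E : \sum_la c la *: alternant rat d la = 0.
  by apply: etrans E; apply: eq_bigr => la _; rewrite evZ -scalerAl sg_schur ?size_part_le.
by apply/funext => s; rewrite big1 // => la _; rewrite (alternant_free E) mul0r.
Qed.

End SchurBasis.

(** * Zeta from one symmetric group to the next *)

Section ZetaRecursion.
Variable R : comAlgType rat.
Local Notation K := (laurent R).

Lemma size_cycle_type_le d (s : 'S_d) : (size (cycle_type s) <= d)%N.
Proof. by rewrite size_sort size_image card_porbits_le. Qed.

Lemma perm_len_ext d (a : 'I_d.+1) (s : 'S_d) :
  perm_len (tperm a ord_max * ext s)%g = (perm_len s + (a != ord_max))%N.
Proof.
have h := size_cycle_type_le s; rewrite !perm_len_size.
case: (unliftP ord_max a) => [j ->|->].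
  rewrite (perm_size (cycle_type_insert s j)) /=.
  have /= <- := perm_size (cycle_type_porbit s j).
  by rewrite eq_sym neq_lift addn1 subSn.
by rewrite tperm1 mul1g (perm_size (cycle_type_ext s)) eqxx addn0 subSS.
Qed.

Lemma cnv_zeta_extf d (phi : 'S_d -> K) (a : 'I_d.+1) (v : 'S_d) :
  cnv (@zetaK R d.+1) (extf phi) (tperm a ord_max * ext v)%g =
  hbar R ^+ (a != ord_max) * cnv (@zetaK R d) phi v.
Proof.
rewrite !cnvE /extf; under eq_bigr => t _ do rewrite mulr_sumr.
rewrite exchange_big /= mulr_sumr; apply: eq_bigr => u _.
rewrite (bigD1 (ext u)) //= eqxx mul1r big1 ?addr0; last first.
  by move=> t /negPf->; rewrite mul0r mulr0.
rewrite mulrA; congr (_ * _); rewrite !zetaKE -exprD addnC; congr (_ ^+ _).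
rewrite -perm_len_ext; congr (perm_len _); rewrite -mulgA; congr (_ * _)%g.
by apply: (mulIg (ext u)); rewrite mulgKV -extM mulgKV.
Qed.

Lemma ext_eq_max d (v : 'S_d) x : (ext v x == ord_max) = (x == ord_max).
Proof. by rewrite -(inj_eq (@perm_inj _ (ext v)) x ord_max) ext_max. Qed.

(** The transpositions moving [ord_max] form the last Jucys-Murphy element, counted twice; the
    others act inside ['S_d]. *)
Lemma cnv_kap_extf d (psi : 'S_d -> K) (a : 'I_d.+1) (v : 'S_d) :
  let s := (tperm a ord_max * ext v)%g in
  cnv (@kap K d.+1) (extf psi) s = extf (cnv (@kap K d) psi) s + (a != ord_max)%:R * psi v *+ 2.
Proof.
move=> s; rewrite cnv_kap big_ord_max /=.
have ext_tperm (j k : 'I_d) : ext (tperm j k) = tperm (lift ord_max j) (lift ord_max k).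
  apply/permP => x; case: (unliftP ord_max x) => [i ->|->].
    rewrite ext_lift; case: tpermP => [->|->|ij ik]; rewrite ?tpermL ?tpermR //.
    by rewrite tpermD // (inj_eq (@lift_inj _ _)) eq_sym; apply/eqP.
  by rewrite ext_max tpermD // eq_sym neq_lift.
have smax : s ord_max = ext v a by rewrite permM tpermR.
have extva : (ext v a == ord_max) = (a == ord_max) by apply: ext_eq_max.
have pairmax j : extf psi (tperm (lift ord_max j) ord_max * s)%g = (a == lift ord_max j)%:R * psi v.
  case: eqP => [aj|naj]; first by rewrite /s -aj mulgA tperm2 mul1g extf_ext mul1r.
  rewrite mul0r extf_out // permM tpermR permM.
  have [aM|aM] := eqVneq a ord_max.
    by rewrite aM tperm1 perm1 ext_eq_max eq_sym neq_lift.
  rewrite tpermD ?(introN eqP naj) //; last exact: neq_lift.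
  by rewrite ext_eq_max eq_sym neq_lift.
have sum_pair : \sum_j extf psi (tperm (lift ord_max j) ord_max * s)%g = (a != ord_max)%:R * psi v.
  under eq_bigr => j _ do rewrite pairmax.
  rewrite -mulr_suml; congr (_ * _); case: (unliftP ord_max a) => [k ->|->].
    rewrite (bigD1 k) //= eqxx big1 ?addr0 ?[_ == ord_max]eq_sym ?neq_lift // => j jk.
    by rewrite (inj_eq (@lift_inj _ _)) eq_sym (negPf jk).
  by rewrite eqxx big1 // => j _; rewrite (negPf (neq_lift _ _)).
rewrite big_mkcond big_ord_max /= eqxx add0r.
under eq_bigr => j _ do rewrite eq_sym neq_lift tpermC.
rewrite sum_pair.
transitivity ((a != ord_max)%:R * psi v + \sum_(j < d) ((a == lift ord_max j)%:R * psi v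
   + \sum_(k < d | k != j) extf psi (tperm (lift ord_max j) (lift ord_max k) * s)%g)).
  congr (_ + _); apply: eq_bigr => j _; rewrite big_mkcond big_ord_max /= neq_lift pairmax.
  congr (_ + _); rewrite [RHS]big_mkcond /=; apply: eq_bigr => k _.
  by rewrite (inj_eq (@lift_inj _ _)).
rewrite big_split /= -(eq_bigr _ (fun j _ => pairmax j)) sum_pair addrA -mulr2n addrC; congr (_ + _).
have [aM|aM] := eqVneq a ord_max.
  have -> : s = ext v by rewrite /s aM tperm1 mul1g.
  rewrite extf_ext cnv_kap; apply: eq_bigr => j _; apply: eq_bigr => k _.
  by rewrite -ext_tperm -extM extf_ext.
rewrite [RHS]extf_out ?smax ?extva // big1 // => j _; rewrite big1 // => k _.
by rewrite -ext_tperm extf_out // permM ext_max smax extva.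
Qed.

(** The Jucys-Murphy element is eliminated in favour of the two operators [kap]. Unlike it, they are
    convolutions by class functions, so the identity can be averaged over conjugation. *)
Lemma zeta_extf d (phi : 'S_d -> K) s :
  let psi := cnv (@zetaK R d) phi in
  cnv (@zetaK R d.+1) (extf phi) s *+ 2 =
  extf psi s *+ 2 + hbar R * (cnv (@kap K d.+1) (extf psi) s - extf (cnv (@kap K d) psi) s).
Proof.
move=> psi; have [inv _ invK] := ext_decomp_bij d.
rewrite -(invK s); case: (inv s) => a v /=.
rewrite cnv_zeta_extf -/psi cnv_kap_extf [_ + _ - _]addrC addKr.
have [->|aM] := eqVneq a ord_max.
  by rewrite tperm1 mul1g extf_ext expr0 mul1r mul0r mul0rn mulr0 addr0.
rewrite extf_out ?mul0rn ?add0r ?expr1 ?mul1r ?mulrnAr //.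
by rewrite permM tpermR ext_eq_max.
Qed.

Lemma cnv_pind d (z : 'S_d.+1 -> K) (phi : 'S_d -> K) s : classfun z ->
  cnv z (pind phi) s = \sum_g cnv z (extf phi) (s ^ g)%g.
Proof.
move=> zc; rewrite /cnv /pind; under eq_bigr => t _ do rewrite mulr_sumr.
rewrite exchange_big /=; apply: eq_bigr => g _.
rewrite [RHS](reindex_inj (conjg_inj g)) /=; apply: eq_bigr => t _.
by rewrite zc conjMg conjVg.
Qed.

Lemma zeta_pind d (phi : 'S_d -> K) s :
  let psi := cnv (@zetaK R d) phi in
  cnv (@zetaK R d.+1) (pind phi) s *+ 2 =
  pind psi s *+ 2 + hbar R * (cnv (@kap K d.+1) (pind psi) s - pind (cnv (@kap K d) psi) s).
Proof.
move=> psi; rewrite cnv_pind; last exact: zetaK_class.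
rewrite (cnv_pind psi); last exact: kap_class.
rewrite /pind -sumrMnl -sumrMnl -sumrB mulr_sumr -big_split /=; apply: eq_bigr => g _.
exact: zeta_extf.
Qed.

End ZetaRecursion.

(** * Schur functions as eigenvectors of zeta *)

Section SchurFunctions.
Variable R : comAlgType rat.
Local Notation K := (laurent R).
Local Notation iota := (ratK R).
Local Notation h := (hbar R).

Lemma cnv_iota d (f g : 'S_d -> rat) s : cnv (iota \o f) (iota \o g) s = iota (cnv f g s).
Proof. by rewrite /cnv rmorph_sum; apply: eq_bigr => t _; rewrite rmorphM. Qed.

Lemma kap_iota d : @kap K d = iota \o @kap rat d.
Proof.
apply/funext => s; rewrite /kap /= rmorph_sum; apply: eq_bigr => a _.
by rewrite rmorph_sum; apply: eq_bigr => b _; rewrite rmorph_nat.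
Qed.

Lemma pind_iota d (f : 'S_d -> rat) : pind (iota \o f) = iota \o pind f.
Proof.
apply/funext => s; rewrite /pind /= rmorph_sum; apply: eq_bigr => g _.
by rewrite /extf rmorph_sum; apply: eq_bigr => t _; rewrite rmorphM rmorph_nat.
Qed.

Lemma cnvZr (A : comNzRingType) d (z f : 'S_d -> A) c s : cnv z (fun t => c * f t) s = c * cnv z f s.
Proof. by rewrite /cnv mulr_sumr; apply: eq_bigr => t _; rewrite mulrCA. Qed.

Lemma cnvDr (A : comNzRingType) d (z f g : 'S_d -> A) s :
  cnv z (fun t => f t + g t) s = cnv z f s + cnv z g s.
Proof. by rewrite /cnv -big_split; apply: eq_bigr => t _; rewrite mulrDr. Qed.

Lemma cnvBr (A : comNzRingType) d (z f g : 'S_d -> A) s :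
  cnv z (fun t => f t - g t) s = cnv z f s - cnv z g s.
Proof. by rewrite /cnv -sumrB; apply: eq_bigr => t _; rewrite mulrBr. Qed.

Lemma cnv_comm (A : comNzRingType) d (y z f : 'S_d -> A) : classfun z ->
  cnv z (cnv y f) = cnv y (cnv z f).
Proof. by move=> zc; rewrite !cnvA (cnvC y zc). Qed.

(* zeta f = kappa (1 + (h / 2) (kap - E)) f, doubled to avoid the division; if
   kap f = (E + 2 c) f the right-hand side is kappa (1 + h c) f. *)
Definition zeta_partial d (kappa : K) (E : rat) (f : 'S_d -> rat) :=
  forall s, cnv (@zetaK R d) (iota \o f) s *+ 2 =
    kappa * (iota (f s) *+ 2 + h * (iota (cnv (@kap rat d) f s) - iota E * iota (f s))).

(** On the eigenvector [f], [kap] of ['S_d] is the scalar [E]; what is left of [zeta_pind] involves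
    only class functions of ['S_d.+1]. *)
Lemma zeta_partial_pind d (f : 'S_d -> rat) kappa E :
  cnv (@kap rat d) f = (fun s => E * f s) ->
  cnv (@zetaK R d) (iota \o f) = (fun s => kappa * iota (f s)) ->
  zeta_partial kappa E (pind f).
Proof.
move=> kE zE s; rewrite -pind_iota zeta_pind zE.
have P1 : pind (fun t => kappa * iota (f t)) = fun t => kappa * iota (pind f t).
  apply/funext => t; rewrite -[iota (pind f t)]/((iota \o pind f) t) -pind_iota /pind mulr_sumr; apply: eq_bigr => g _.
  by rewrite /extf mulr_sumr; apply: eq_bigr => u _; rewrite mulrCA.
have P2 : pind (fun t => (kappa * iota E) * iota (f t)) = fun t => kappa * iota E * iota (pind f t).
  apply/funext => t; rewrite -[iota (pind f t)]/((iota \o pind f) t) -pind_iota /pind mulr_sumr; apply: eq_bigr => g _.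
  by rewrite /extf mulr_sumr; apply: eq_bigr => u _; rewrite mulrCA.
have -> : cnv (@kap K d) (fun t => kappa * iota (f t)) = fun t => kappa * iota E * iota (f t).
  apply/funext => t; rewrite cnvZr kap_iota (cnv_iota (@kap rat d) f) kE rmorphM.
  by rewrite mulrA.
rewrite P1 P2 cnvZr kap_iota (cnv_iota (@kap rat d.+1) (pind f)).
by rewrite -mulrnAr; ring.
Qed.

Lemma zeta_partialZ d kappa E c (f : 'S_d -> rat) :
  zeta_partial kappa E f -> zeta_partial kappa E (fun s => c * f s).
Proof.
move=> hf s; rewrite cnvZr !rmorphM /=.
have -> : iota \o (fun t => c * f t) = fun t => iota c * iota (f t).
  by apply/funext => t; rewrite /= rmorphM.
rewrite cnvZr -mulrnAr hf; ring.
Qed.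

Lemma zeta_partialB d kappa E (f g : 'S_d -> rat) :
  zeta_partial kappa E f -> zeta_partial kappa E g -> zeta_partial kappa E (fun s => f s - g s).
Proof.
move=> hf hg s; rewrite cnvBr !rmorphB /=.
have -> : iota \o (fun t => f t - g t) = fun t => iota (f t) - iota (g t).
  by apply/funext => t; rewrite /= rmorphB.
rewrite cnvBr mulrnBl hf hg; ring.
Qed.

Lemma zeta_partial_kap d kappa E (f : 'S_d -> rat) :
  zeta_partial kappa E f -> zeta_partial kappa E (cnv (@kap rat d) f).
Proof.
move=> hf s; have -> : iota \o cnv (@kap rat d) f = cnv (@kap K d) (iota \o f).
  by apply/funext => t; rewrite kap_iota cnv_iota.
rewrite cnv_comm; last exact: zetaK_class.
have -> : cnv (@kap K d) (cnv (@zetaK R d) (iota \o f)) s *+ 2 =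
          cnv (@kap K d) (fun t => cnv (@zetaK R d) (iota \o f) t *+ 2) s.
  by rewrite /cnv -sumrMnl; apply: eq_bigr => t _; rewrite mulrnAr.
rewrite (_ : (fun t => _ *+ 2) = (fun t => kappa * ((2 * iota (f t)) + h * (iota (cnv (@kap rat d) f t) - iota E * iota (f t))))); last first.
  by apply/funext => t; rewrite hf mulr_natl.
rewrite cnvZr cnvDr !cnvZr cnvBr cnvZr kap_iota.
rewrite (cnv_iota (@kap rat d) f) (cnv_iota (@kap rat d) (cnv (@kap rat d) f)).
by rewrite mulr_natl.
Qed.

(** The relation is linear in [f] and commutes with [kap], hence survives the projection; it becomes
    an eigenvalue equation for zeta once the projected function is an eigenvector of [kap]. *)
Lemma zeta_partial_lagr d kappa E e i0 rs (f : 'S_d -> rat) :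
  zeta_partial kappa E f -> zeta_partial kappa E (lagr e i0 rs f).
Proof.
move=> hf; elim: rs => //= r rs IHrs; apply: zeta_partialZ; apply: zeta_partialB.
  exact: zeta_partial_kap.
exact: zeta_partialZ.
Qed.

Lemma lagr_class d e i0 rs (f : 'S_d -> rat) : classfun f -> classfun (lagr e i0 rs f).
Proof.
move=> fc; elim: rs => //= r rs IHrs s t; rewrite IHrs (cnv_classfun _ IHrs) //.
exact: kap_class.
Qed.

Lemma content_prod_widen (la : seq nat) N : (size la <= N)%N ->
  content_prod R la = \prod_(i < N) \prod_(j < nth 0%N la i) (1 + laurent_mono (j%:Z - i%:Z)%:~R 1).
Proof.
move=> sN; rewrite /content_prod.
rewrite (big_ord_widen N (fun i => \prod_(j < nth 0%N la i) (1 + laurent_mono (j%:Z - i%:Z)%:~R 1)) sN) big_mkcond /=.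
apply: eq_bigr => i _; case: ltnP => // hs.
by rewrite nth_default // big_ord0.
Qed.

Lemma content_prod_grow (la la' : seq nat) i0 :
  (forall j, nth 0%N la' j = nth 0%N la j + (j == i0))%N -> (i0 < size la')%N -> (size la <= size la')%N ->
  content_prod R la' = content_prod R la * (1 + h * iota ((nth 0%N la i0)%:R - i0%:R)).
Proof.
move=> hla i0s ss; rewrite (content_prod_widen (leqnn _)) (content_prod_widen ss).
rewrite (bigD1 (Ordinal i0s)) //= [in RHS](bigD1 (Ordinal i0s)) //=.
rewrite hla eqxx addn1 big_ord_recr /= mulrAC; congr (_ * _ * _); last first.
  congr (1 + _); rewrite laurent_monoE mulrC; congr (_ * _).
  rewrite /ratK /= -[(nth 0%N la i0)%:R]/((nth 0%N la i0)%:~R) -[i0%:R]/(i0%:~R) -rmorphB /=.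
  by congr laurentC; rewrite -[RHS]/(in_alg R _) rmorph_int.
by apply: eq_bigr => i; rewrite -val_eqE /= hla => /negPf->; rewrite addn0.
Qed.

Lemma content_sum_grow d (la : part_of d) (la' : part_of d.+1) i0 :
  (forall j, nth 0%N la' j = nth 0%N la j + (j == i0))%N -> (i0 < size la')%N -> (size la <= size la')%N ->
  content_sum la' = row_eig la i0.
Proof.
move=> hla i0s ss; rewrite /row_eig /content_sum.
pose F (i k : nat) : rat := k%:R * (k%:R - 2 * i%:R - 1).
rewrite -(big_parts_widen ss (F := F)) /F => [|i]; last by rewrite mul0r.
rewrite (bigD1 (Ordinal i0s)) //= [in RHS](bigD1 (Ordinal i0s)) //= hla eqxx.
rewrite (eq_bigr (fun i : 'I_(size la') => F i (nth 0%N la i))); last first.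
  by move=> i; rewrite -val_eqE /= hla => /negPf->; rewrite addn0.
rewrite /F natrD /=; ring.
Qed.

(** The clause on [kap] is carried along because [zeta_partial_pind] needs it to reach the next
    degree. *)
Definition schur_data d (la : part_of d) (f : 'S_d -> rat) :=
  [/\ classfun f, schur_fun la f, cnv (@kap rat d) f = (fun s => content_sum la * f s) &
      cnv (@zetaK R d) (iota \o f) = (fun s => content_prod R la * iota (f s))].

(** The eigenvalue of [kap] is checked on alternants through [ev_inj], which needs the functions of
    a whole degree to span; they are therefore all chosen before any is shown to be an
    eigenvector. *)
Lemma schur_exists d : exists sg : part_of d -> 'S_d -> rat, forall la, schur_data la (sg la).
Proof.
elim: d => [|d [sg hsg]].
  exists (fun _ _ => 1) => la.
  have la0 : parts la = [::].
    by apply/size0nil/eqP; rewrite -leqn0; exact: size_part_le.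
  have s1 (s : 'S_0) : s = 1%g by apply/permP => -[].
  split.
  - by [].
  - move=> N _; rewrite la0 /ev (big_pred1 1%g) => [|s]; last by apply/esym/eqP; apply: s1.
    have -> : cycle_type (1 : 'S_0)%g = [::].
      by apply/size0nil/eqP; rewrite -leqn0; exact: size_cycle_type_le.
    by rewrite /psprod big_nil scale1r mul1r.
  - apply/funext => s; rewrite cnv_kap big_ord0 /content_sum la0 /=.
    by rewrite big_ord0 mul0r.
  apply/funext => s; rewrite /cnv (big_pred1 1%g) => [|t]; last by apply/esym/eqP; apply: s1.
  rewrite zetaKE perm_len1 expr0 mul1r /content_prod la0 big_ord0 mul1r.
  by rewrite /= rmorph1.
have step (la' : part_of d.+1) : exists f : 'S_d.+1 -> rat, exists la : part_of d, exists i0 : nat,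
    [/\ classfun f, schur_fun la' f, zeta_partial (content_prod R la) (content_sum la) f &
     [/\ forall j, nth 0%N la' j = (nth 0%N la j + (j == i0))%N, (i0 < size la')%N & (size la <= size la')%N]].
  have [la [i0 [hla i0s i0s' ss]]] := remove_box la'.
  have [fc fs fk fz] := hsg la.
  exists (grow la (row_eig la) i0 (sg la)), la, i0; split=> //.
  - by apply: lagr_class => s t; rewrite pind_class.
  - exact: schur_grow.
  by apply: zeta_partial_lagr; apply: zeta_partialZ; apply: zeta_partial_pind.
have [sg' hsg'] := choice step.
have cls la : classfun (sg' la) by have [la1 [i0 []]] := hsg' la.
have sch (la : part_of d.+1) : schur_fun la (sg' la) by have [la1 [i0 []]] := hsg' la.
have eig (la : part_of d.+1) : cnv (@kap rat d.+1) (sg' la) = fun s => content_sum la * sg' la s.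
  have E := ev_inj cls sch (phi := fun s => cnv (@kap rat d.+1) (sg' la) s - content_sum la * sg' la s).
  apply/funext => s; apply/eqP; rewrite -subr_eq0; apply/eqP.
  suff E0 : (fun s => cnv (@kap rat d.+1) (sg' la) s - content_sum la * sg' la s) = fun _ => 0.
    exact: (congr1 (fun F => F s) E0).
  apply: E.
    by move=> t u; rewrite cls (cnv_classfun (@kap_class rat d.+1) (cls la)).
  have [la1 [i0 [_ _ _ [hla i0s ss]]]] := hsg' la.
  have i0N : (i0 < d.+1)%N := leq_trans i0s (size_part_le la).
  have sN : (size la1 <= d.+1)%N := leq_trans ss (size_part_le la).
  have h1 : ev d.+1 (sg' la) * alternant rat d.+1 [::] = \sum_(i < d.+1) (i == Ordinal i0N)%:R *: row_am la1 i.
    rewrite sch ?size_part_le // (bigD1 (Ordinal i0N)) //= eqxx scale1r big1 ?addr0; last first.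
      by move=> i /negPf->; rewrite scale0r.
    rewrite alternantE; apply: eq_am => j; rewrite hla -val_eqE /=; lia.
  rewrite evB evZ mulrBl -scalerAl (ev_kap_rows sN h1) h1 scaler_sumr -sumrB big1 // => i _.
  rewrite scalerA (content_sum_grow hla i0s ss).
  by case: eqP => [->|_]; rewrite ?mul1r ?mulr1 ?subrr // mul0r mulr0 subrr.
exists sg' => la; split=> //.
have [la1 [i0 [_ _ zp [hla i0s ss]]]] := hsg' la.
apply/funext => s; have := zp s; rewrite eig (content_sum_grow hla i0s ss) (content_prod_grow hla i0s ss).
move=> E; have half : iota 2^-1 * 2 = 1 by rewrite -(ratK_nat R 2) -rmorphM mulVf ?rmorph1.
have key x : x = iota 2^-1 * (x *+ 2) by rewrite -[x *+ 2]mulr_natl mulrA half mul1r.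
rewrite [LHS]key E /row_eig; set q := (_ - _ : rat).
have -> : iota ((content_sum la1 + 2 * q) * sg' la s) = (iota (content_sum la1) + 2 * iota q) * iota (sg' la s).
  by rewrite rmorphM; congr (_ * _); rewrite rmorphD; congr (_ + _); rewrite rmorphM; congr (_ * _); apply: (ratK_nat R 2).
transitivity ((iota 2^-1 * 2) * (content_prod R la1 * (1 + h * iota q) * iota (sg' la s))).
  by ring.
by rewrite half mul1r.
Qed.

End SchurFunctions.

(** * The operator D as convolution by zeta *)

Section OperatorD.
Variable R : comAlgType rat.
Local Notation K := (laurent R).
Local Notation iota := (ratK R).
Implicit Types f g : pseries K.

Lemma map_powersum N k : map_mpoly iota (powersum rat N k) = powersum K N k.
Proof. by rewrite /powersum rmorph_sum; apply: eq_bigr => i _; rewrite rmorphXn /= map_mpolyX. Qed.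

Lemma map_alternant N la : map_mpoly iota (alternant rat N la) = alternant K N la.
Proof.
rewrite /alternant -det_map_mx; congr (\det _); apply/matrixP => i j.
by rewrite !mxE rmorphXn /= map_mpolyX.
Qed.

Lemma map_psprod N mu : map_mpoly iota (psprod rat N mu) = psprod K N mu.
Proof. by rewrite /psprod rmorph_prod; apply: eq_bigr => k _; apply: map_powersum. Qed.

Definition schur_series d (f : 'S_d -> rat) : pseries K :=
  fun nu => \sum_(s | cycle_type s == nu) iota (f s).

Lemma schur_series_is_schur d (la : part_of d) (f : 'S_d -> rat) :
  schur_fun la f -> is_schur la (schur_series f).
Proof.
move=> hf; split=> [nu|N sN].
  rewrite /phomog (eqP (part_ofP la)); case: eqP => // nd.
  by rewrite /schur_series big1 // => s /eqP E; case: nd; rewrite -E sumn_cycle_type.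
rewrite -[RHS]map_alternant -(hf N sN) rmorphM /= map_alternant; congr (_ * _).
have key e : e = d -> \sum_(mu : part_of e) schur_series f mu *: \prod_(k <- parts mu) powersum K N k
    = map_mpoly iota (ev N f).
  move=> ->; rewrite /ev rmorph_sum /=.
  rewrite [RHS](partition_big (@cycle_part d) xpredT) //=; apply: eq_bigr => mu _.
  rewrite /schur_series scaler_suml; apply: eq_big => s; first by rewrite cycle_partP.
  by move=> /eqP <-; rewrite map_mpolyZ map_psprod.
by apply: key; apply/eqP; apply: part_ofP.
Qed.

Lemma schur_seriesE d (f : 'S_d -> rat) (s : 'S_d) : classfun f ->
  (zee (cycle_part s))%:R * schur_series f (cycle_part s) = (d`!)%:R * iota (f s).
Proof.
move=> fc; rewrite /schur_series (eq_bigr (fun=> iota (f s))); last first.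
  by move=> t; rewrite cycle_partP => /eqP E; congr iota; apply: classfun_part.
rewrite (eq_bigl (fun t => t \in [set t : 'S_d | cycle_part t == cycle_part s])); last first.
  by move=> t; rewrite inE cycle_partP.
by rewrite sumr_const -[iota _ *+ _]mulr_natl mulrA -natrM mulnC card_cycle_part.
Qed.

Lemma Zcoef_inj f g (la : intpart) : Zcoef f la = Zcoef g la -> f la = g la.
Proof.
have zK : qmono R (zee la)%:R^-1 (- (sumn la)%:Z) * qmono R (zee la)%:R (sumn la)%:Z = 1.
  rewrite qmonoM addNr mulVf ?qmono1 // pnatr_eq0 -lt0n zee_gt0 //.
  by have /andP[] := partsP la.
move=> /(congr1 (fun x => qmono R (zee la)%:R^-1 (- (sumn la)%:Z) * x)).
by rewrite /Zcoef !mulrA zK !mul1r.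
Qed.

Variable D : pseries K -> pseries K.
Hypothesis hD : is_D D.

Lemma D_sum (I : Type) (r : seq I) (c : I -> K) (F : I -> pseries K) :
  D (fun nu => \sum_(i <- r) c i * F i nu) = fun nu => \sum_(i <- r) c i * D (F i) nu.
Proof.
have [Dlin _ _] := hD; apply/funext => nu; elim: r nu => [|i r IHr] nu.
  have := Dlin 0 (fun=> 0) (fun=> 0) nu.
  rewrite (_ : (fun mu : intpart => 0 * 0 + 0) = fun _ => 0 :> K); last by apply/funext => mu; rewrite mul0r addr0.
  rewrite mul0r add0r big_nil (_ : (fun nu0 : intpart => \sum_(i <- [::]) c i * F i nu0) = fun _ => 0); last first.
    by apply/funext => mu; rewrite big_nil.
  (* Linearity is given for [a * f + g]; [a = -1] with both series zero shows that [D] kills the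
     zero series. *)
  by move=> _; have := Dlin (-1) (fun=> 0) (fun=> 0) nu;
   rewrite (_ : (fun mu : intpart => -1 * 0 + 0) = fun _ => 0 :> K) ?mulN1r ?addNr //;
   apply/funext => mu; rewrite mulr0 addr0.
rewrite (_ : (fun nu0 => \sum_(j <- i :: r) c j * F j nu0) =
    fun nu0 => c i * F i nu0 + \sum_(j <- r) c j * F j nu0); last first.
  by apply/funext => mu; rewrite big_cons.
by rewrite Dlin IHr big_cons.
Qed.

(** The values of [D] are prescribed on Schur series only. Compatibility with [phomog] reduces to
    the component of degree [d], a finite combination of them. *)
Lemma psi_D d f : psi (D f) = cnv (psi f) (@zetaK R d).
Proof.
have [_ Dhom Dschur] := hD.
have [sg hsg] := schur_exists R d.
have sgc la : classfun (sg la) by have [] := hsg la.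
have sgs (la : part_of d) : schur_fun la (sg la) by have [] := hsg la.
have psic : classfun (psi f : 'S_d -> K) by move=> s t; rewrite /psi cycle_partJ.
have [c hc] := classfun_span sgc sgs (iota : {rmorphism rat -> K}) psic.
rewrite cnvC; last exact: zetaK_class.
have -> : cnv (@zetaK R d) (psi f) = fun s => \sum_mu c mu * (content_prod R mu * iota (sg mu s)).
  apply/funext => s; rewrite hc /cnv; under eq_bigr => t _ do rewrite mulr_sumr.
  rewrite exchange_big /=; apply: eq_bigr => mu _.
  have [_ _ _ zE] := hsg mu; have := congr1 (fun F => F s) zE; rewrite /= => <-.
  by rewrite /cnv mulr_sumr; apply: eq_bigr => t _; rewrite mulrCA.
(* [Zcoef] multiplies by z_la hbar^d, and [schur_seriesE] trades z_la for d!; [c'] compensates for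
   both. *)
pose c' mu := qmono R (d`!%:R)^-1 (- d%:Z) * c mu.
have zd (s : 'S_d) : sumn (cycle_part s) = d by apply/eqP; apply: part_ofP.
have hom : phomog d f = fun nu => \sum_(mu : part_of d) c' mu * schur_series (sg mu) nu.
  apply/funext => nu; rewrite /phomog; case: eqP => [nud|nd]; last first.
    rewrite big1 // => mu _; rewrite /schur_series big1 ?mulr0 // => s /eqP E.
    by case: nd; rewrite -E sumn_cycle_type.
  have nuP : sumn nu == d by rewrite nud.
  have [s sE] := cycle_part_surj (PartOf nuP).
  have -> : nu = cycle_part s by rewrite sE.
  pose g : pseries K := fun nu => \sum_mu c' mu * schur_series (sg mu) nu.
  apply: (@Zcoef_inj f g); rewrite -[LHS]/(psi f s) hc /Zcoef /g mulr_sumr zd.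
  apply: eq_bigr => mu _; rewrite /c'.
  have := schur_seriesE s (sgc mu); rewrite -!ratK_nat => E.
  rewrite !qmonoE ratK_nat -ratK_nat.
  have lm := mono_unitK R d%:Z.
  have fm : iota d`!%:R^-1 * iota d`!%:R = 1.
    by rewrite -rmorphM mulVf ?rmorph1 // pnatr_eq0 -lt0n fact_gt0.
  transitivity ((iota d`!%:R^-1 * iota d`!%:R) * (laurent_mono 1 d%:Z * laurent_mono 1 (- d%:Z)) * (c mu * iota (sg mu s))).
    by rewrite fm lm !mul1r.
  transitivity (iota d`!%:R^-1 * (laurent_mono 1 d%:Z * laurent_mono 1 (- d%:Z)) * c mu * (iota d`!%:R * iota (sg mu s))).
    by ring.
  rewrite -E; ring.
apply/funext => s.
have -> : psi (D f) s = Zcoef (phomog d (D f)) (cycle_part s).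
  by rewrite /psi /Zcoef /phomog zd eqxx.
have -> : Zcoef (phomog d (D f)) (cycle_part s) = Zcoef (D (phomog d f)) (cycle_part s).
  by rewrite /Zcoef Dhom.
rewrite hom D_sum /Zcoef mulr_sumr zd; apply: eq_bigr => mu _.
rewrite (Dschur _ _ (schur_series_is_schur (sgs mu))) /c'.
have := schur_seriesE s (sgc mu); rewrite -!ratK_nat => E.
rewrite !qmonoE.
have lm := mono_unitK R d%:Z.
have fm : iota d`!%:R^-1 * iota d`!%:R = 1.
  by rewrite -rmorphM mulVf ?rmorph1 // pnatr_eq0 -lt0n fact_gt0.
transitivity (iota d`!%:R^-1 * (laurent_mono 1 d%:Z * laurent_mono 1 (- d%:Z)) * c mu * content_prod R mu * (iota d`!%:R * iota (sg mu s))).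
  rewrite -E; ring.
transitivity ((iota d`!%:R^-1 * iota d`!%:R) * (laurent_mono 1 d%:Z * laurent_mono 1 (- d%:Z)) * (c mu * (content_prod R mu * iota (sg mu s)))).
  by ring.
by rewrite fm lm !mul1r.
Qed.

(** The Hurwitz relations say nothing in degree 0, where [D] acts as the identity; equality of the
    constant terms fills this gap. *)
Lemma D_Hlt Z1 Z2 : Z1 (IntPart (isT : is_intpart [::])) = Z2 (IntPart (isT : is_intpart [::])) ->
  Z1 =1 D Z2 <-> forall d, (0 < d)%N -> Hlt_relation Z1 Z2 d.
Proof.
move=> Z0; split=> [E d d0|h la].
  apply/Hlt_relationE => //; apply: etrans (psi_D d Z2).
  by apply/funext => s; rewrite /psi /Zcoef E.
apply: Zcoef_inj; have [d0|d0] := posnP (sumn la); last first.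
  have [s sE] := cycle_part_surj (PartOf (eqxx (sumn la))).
  have -> : la = cycle_part s by rewrite sE.
  have := congr1 (fun F => F s) (psi_D (sumn la) Z2); rewrite /psi => ->.
  by have /(Hlt_relationE _ _ d0) E := h _ d0; exact: (congr1 (fun F => F s) E).
have la0 : la = IntPart (isT : is_intpart [::]).
  have laP : sumn la == 0%N by rewrite d0.
  by apply/val_inj/size0nil/eqP; rewrite -leqn0; exact: (size_part_le (PartOf laP)).
have s1 (s : 'S_0) : s = 1%g by apply/permP => -[].
have cE : cycle_part (1 : 'S_0)%g = la :> intpart.
  rewrite la0; apply/val_inj/size0nil/eqP; rewrite -leqn0; exact: (size_part_le (cycle_part _)).
have := congr1 (fun F => F 1%g) (psi_D 0 Z2).
rewrite /cnv (big_pred1 1%g) => [|s]; last by apply/esym/eqP; apply: s1.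
rewrite zetaKE invg1 mulg1 perm_len1 expr0 mulr1 /psi cE => ->.
by rewrite /Zcoef la0 Z0.
Qed.

End OperatorD.

Theorem theorem2p15 (R : comAlgType rat)
    (F1 F2 : nat -> seq nat -> R)
    (Z1 Z2 : pseries (laurent R))
    (hZ1 : topological F1 Z1) (hZ2 : topological F2 Z2)
    (Phi1 Phi2 : forall d : nat, PS d -> fps R)
    (hPhi1 : associated (free_energy F1) Phi1)
    (hPhi2 : associated (free_energy F2) Phi2)
    (mu : forall d : nat, PS d -> fps R) (hmu : is_psmu mu)
    (D : pseries (laurent R) -> pseries (laurent R)) (hD : is_D D) :
  [/\ forall d : nat, (0 < d)%N ->
        [<-> forall e : nat, (0 < e <= d)%N -> Hlt_relation Z1 Z2 e;
             forall e : nat, (0 < e <= d)%N -> zeta_relation Phi1 Phi2 e;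
             forall e : nat, (0 < e <= d)%N -> Hle_relation Z1 Z2 e;
             forall e : nat, (0 < e <= d)%N -> mu_relation mu Phi1 Phi2 e],
      forall d : nat, (0 < d)%N ->
        [/\ Hlt_relation Z1 Z2 d <-> Hle_relation Z1 Z2 d,
            zeta_relation Phi1 Phi2 d <-> mu_relation mu Phi1 Phi2 d &
            zeta_relation Phi1 Phi2 d -> Hlt_relation Z1 Z2 d] &
      [<-> Z1 =1 D Z2;
           forall d : nat, (0 < d)%N -> Hlt_relation Z1 Z2 d;
           forall d : nat, (0 < d)%N -> zeta_relation Phi1 Phi2 d;
           forall d : nat, (0 < d)%N -> Hle_relation Z1 Z2 d;
           forall d : nat, (0 < d)%N -> mu_relation mu Phi1 Phi2 d]].
Proof.
have Z1E : Z1 = pexp (free_energy F1) by apply/funext => la; rewrite (hZ1.2 la).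
have Z2E : Z2 = pexp (free_energy F2) by apply/funext => la; rewrite (hZ2.2 la).
have nilE F : free_energy F (IntPart (isT : is_intpart [::])) = 0 :> laurent R by [].
(* The constant term 1 common to both series, needed for degree 0 in [D_Hlt]. *)
have pexp_nil F : pexp (free_energy F) (IntPart (isT : is_intpart [::])) = 1 :> laurent R.
  by rewrite /pexp big_ord1 /ppow /= /pone /= mulr1 invr1 qmono1.
have HH d : (0 < d)%N -> Hlt_relation Z1 Z2 d <-> Hle_relation Z1 Z2 d by apply: Hlt_Hle.
have zm d : (0 < d)%N -> zeta_relation Phi1 Phi2 d <-> mu_relation mu Phi1 Phi2 d.
  exact: zeta_mu_relation.
have zH d : (0 < d)%N -> zeta_relation Phi1 Phi2 d -> Hlt_relation Z1 Z2 d.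
  by move=> d0; rewrite Z1E Z2E; apply: zeta_Hlt.
have Hz d : (0 < d)%N -> (forall e, (0 < e <= d)%N -> Hlt_relation Z1 Z2 e) -> zeta_relation Phi1 Phi2 d.
  by move=> d0; rewrite Z1E Z2E; apply: Hlt_zeta.
have bounded d : (forall e, (0 < e <= d)%N -> Hlt_relation Z1 Z2 e) ->
    forall e, (0 < e <= d)%N -> zeta_relation Phi1 Phi2 e.
  move=> h e /andP[e0 ed]; apply: Hz => // e' /andP[e'0 e'e].
  by apply: h; rewrite e'0 (leq_trans e'e ed).
split.
- move=> d d0; tfae=> [/bounded //|h e ed|h e ed|h e ed].
  + by have /andP[e0 _] := ed; apply/HH => //; apply: zH => //; apply: h.
  + have /andP[e0 _] := ed; apply/zm => //.
    by apply: (bounded d) ed => e' ed'; have /andP[e'0 _] := ed'; apply/HH => //; apply: h.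
  + by have /andP[e0 _] := ed; apply: zH => //; apply/zm => //; apply: h.
- by move=> d d0; split; [apply: HH | apply: zm | apply: zH].
have DH : Z1 =1 D Z2 <-> forall d, (0 < d)%N -> Hlt_relation Z1 Z2 d.
  by apply: D_Hlt => //; rewrite Z1E Z2E !pexp_nil.
tfae=> [/DH //|h d d0|h d d0|h d d0|h].
- by apply: Hz => // e /andP[e0 _]; apply: h.
- by apply/HH => //; apply: zH => //; apply: h.
- by apply/zm => //; apply: Hz => // e /andP[e0 _]; apply/HH => //; apply: h.
by apply/DH => d d0; apply: zH => //; apply/zm => //; apply: h.
Qed.
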